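(* Any invariant solution to the pluriclosed flow on a solvmanifold exists for all positive times. That is, let $\mathsf G$ be a solvable Lie group, $\Gamma\le\mathsf G$ a discrete subgroup, and $(J,g_0)$ an SKT Hermitian structure on $\mathsf G/\Gamma$ which lifts to a left-invariant Hermitian structure on $\mathsf G$. Then the invariant solution $g(t)$ of the pluriclosed flow on $(\mathsf G/\Gamma,J)$ with $g(0)=g_0$ exists for all $t\in[0,\infty)$.
   Context: A Hermitian manifold $(M,J,g)$ consists of an integrable complex structure $J$ and a $J$-orthogonal Riemannian metric $g$; its fundamental form is $\omega=g(J\cdot,\cdot)$. The metric is SKT (pluriclosed) if $\mathrm d\mathrm d^c\omega=0$, where $\mathrm d^c=J^{-1}\mathrm dJ$ (equivalently $\partial\bar\partial\omega=0$). The pluriclosed flow starting at an SKT metric $g_0$ is $$\tfrac{\partial}{\partial t}g=-S+Q,\qquad g(0)=g_0,$$ where, with $R$ and $T$ the curvature and torsion of the Chern connection of $(J,g)$ (the unique connection with $\nabla g=0$, $\nabla J=0$, $T^{1,1}=0$), $S_{i\bar j}=g^{k\bar l}R_{k\bar l i\bar j}$ and $Q_{i\bar j}=g^{k\bar l}g^{m\bar n}T_{ik\bar n}T_{\bar j\bar l m}$. An invariant solution is one that lifts to a left-invariant solution on $\mathsf G$ (the flow is then an ODE on left-invariant metrics). *)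

(* Defs.v *)
From HB Require Import structures.
From mathcomp Require Import all_boot all_order all_algebra.
From mathcomp Require Import all_classical all_reals all_analysis.
From mathcomp Require Import complex.

Set Implicit Arguments.
Unset Strict Implicit.
Unset Printing Implicit Defensive.

Import Order.TTheory GRing.Theory Num.Theory.
Import numFieldNormedType.Exports.

Local Open Scope classical_set_scope.
Local Open Scope ring_scope.

(** * Lie groups and their Lie algebras *)

#[short(type="topGroupType")]
HB.structure Definition TopGroup := {G of Topological G & Group G}.

(* Only used for open [U]. Asking for continuity at every stage makes
   [C_on k U f] say that the partial derivatives of order at most [k] exist
   and are continuous on [U]. *)
Fixpoint C_on (R : realType) (n k : nat) (U : set 'rV[R]_n)
    (f : 'rV[R]_n -> R) : Prop :=
  (forall x, U x -> {for x, continuous f}) /\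
  (if k is k'.+1 then
     forall j : 'I_n, (forall x, U x -> derivable f x (delta_mx 0 j)) /\
                      C_on k' U (fun x => 'D_(delta_mx 0 j) f x)
   else True).

Definition smooth_on (R : realType) (n : nat) (U : set 'rV[R]_n)
    (f : 'rV[R]_n -> R) : Prop :=
  forall k, C_on k U f.

Definition smooth_map_on (R : realType) (n m : nat) (U : set 'rV[R]_n)
    (f : 'rV[R]_n -> 'rV[R]_m) : Prop :=
  forall i : 'I_m, smooth_on U (fun x => f x 0 i).

(* [chart_map] and [chart_inv] are total functions, meaningful only on
   [chart_dom] and on its image. *)
Record chart (R : realType) (n : nat) (M : topologicalType) := Chart {
  chart_dom : set M;
  chart_map : M -> 'rV[R]_n;
  chart_inv : 'rV[R]_n -> M;
  chart_dom_open : open chart_dom;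
  chart_im_open : open (chart_map @` chart_dom);
  chart_mapK : forall x, chart_dom x -> chart_inv (chart_map x) = x;
  chart_map_cont : {within chart_dom, continuous chart_map};
  chart_inv_cont : {within chart_map @` chart_dom, continuous chart_inv}
}.

Definition chart_im (R : realType) (n : nat) (M : topologicalType)
    (c : chart R n M) : set 'rV[R]_n := chart_map c @` chart_dom c.

Record lie_group (R : realType) (n : nat) := LieGroup {
  lg_sort :> topGroupType;
  lg_atlas : set (chart R n lg_sort);
  lg_hausdorff : hausdorff_space lg_sort;
  lg_second_countable : @second_countable lg_sort;
  lg_cover : forall x : lg_sort, exists2 c, lg_atlas c & chart_dom c x;
  lg_transition : forall c c', lg_atlas c -> lg_atlas c' ->
    smooth_map_on (chart_map c @` (chart_dom c `&` chart_dom c'))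
                  (chart_map c' \o chart_inv c);
  lg_op_cont : continuous (fun p : lg_sort * lg_sort => (p.1 * p.2^-1)%g);
  (* (x, y) |-> x y^-1 is smooth; a point of R^n x R^n is a row of length n + n *)
  lg_op_smooth : forall c1 c2 c3,
    lg_atlas c1 -> lg_atlas c2 -> lg_atlas c3 ->
    let op p := (chart_inv c1 (lsubmx p) * (chart_inv c2 (rsubmx p))^-1)%g in
    smooth_map_on
      [set p : 'rV[R]_(n + n) |
        [/\ chart_im c1 (lsubmx p), chart_im c2 (rsubmx p) &
            chart_dom c3 (op p)]]
      (chart_map c3 \o op)
}.

Section LieGroupTheory.
Context (R : realType) (n : nat) (G : lie_group R n).

Definition smooth_fun (f : G -> R) : Prop :=
  forall c, lg_atlas c -> smooth_on (chart_im c) (f \o chart_inv c).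

(* Vector fields are the derivations of the algebra of smooth functions; the
   values of [X] on non-smooth functions are irrelevant. *)
Definition is_vector_field (X : (G -> R) -> (G -> R)) : Prop :=
  [/\ forall f, smooth_fun f -> smooth_fun (X f),
      forall (a : R) f h, smooth_fun f -> smooth_fun h ->
        forall x, X (fun y => a * f y + h y) x = a * X f x + X h x &
      forall f h, smooth_fun f -> smooth_fun h ->
        forall x, X (fun y => f y * h y) x = f x * X h x + X f x * h x].

Definition left_invariant (X : (G -> R) -> (G -> R)) : Prop :=
  forall (a : G) f, smooth_fun f ->
    forall x, X (fun y => f (a * y)%g) x = X f (a * x)%g.

(* A model of the Lie algebra of [G]: a finite-dimensional vector space
   identified by [la_field] with the space of all left-invariant vector fields,
   the bracket being the commutator of vector fields. *)
Record lie_algebra_of := LieAlgebraOf {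
  la_sort :> vectType R;
  la_bracket : la_sort -> la_sort -> la_sort;
  la_field : la_sort -> (G -> R) -> (G -> R);
  la_fieldP : forall v,
    is_vector_field (la_field v) /\ left_invariant (la_field v);
  la_field_linear : forall (a : R) u v f, smooth_fun f ->
    forall x, la_field (a *: u + v) f x = a * la_field u f x + la_field v f x;
  la_field_inj : forall u v,
    (forall f, smooth_fun f -> forall x, la_field u f x = la_field v f x) ->
    u = v;
  la_field_surj : forall X, is_vector_field X -> left_invariant X ->
    exists v, forall f, smooth_fun f -> forall x, la_field v f x = X f x;
  la_bracketE : forall u v f, smooth_fun f -> forall x,
    la_field (la_bracket u v) f x =
      la_field u (la_field v f) x - la_field v (la_field u f) x
}.

Definition discrete_subgroup (Gamma : set G) : Prop :=
  [/\ Gamma 1%g,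
      forall x y, Gamma x -> Gamma y -> Gamma (x * y^-1)%g &
      forall x, Gamma x -> exists2 U, open U & Gamma `&` U = [set x]].

End LieGroupTheory.

(** * Left-invariant Hermitian geometry *)

(* A left-invariant tensor, or a left-invariant connection, is determined by its
   values on left-invariant vector fields, and these values are constant (resp.
   left-invariant). All objects below are hence given on the Lie algebra [V],
   with bracket [br]. A tensor on the quotient of the Lie group by the left
   translations of a discrete subgroup, when it lifts to a left-invariant tensor,
   is given by the same data, whatever the subgroup. *)
Section InvariantGeometry.
Context (R : realType) (V : vectType R) (br : V -> V -> V).

Fixpoint derived_algebra (k : nat) : {vspace V} :=
  if k is k'.+1 then
    let B := vbasis (derived_algebra k') in
    <<[seq br x y | x <- B, y <- B]>>%VS
  else fullv.

(* A Lie group is called solvable when its Lie algebra is; for connected groups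
   this agrees with solvability of the abstract group. *)
Definition solvable_lie : Prop := exists k, derived_algebra k = 0%VS.

Definition complex_structure (J : 'End(V)) : Prop :=
  (forall x, J (J x) = - x) /\
  (forall x y, br (J x) (J y) - J (br (J x) y) - J (br x (J y)) - br x y = 0).

Definition bilinear_form (b : V -> V -> R) : Prop :=
  (forall a x y z, b (a *: x + y) z = a * b x z + b y z) /\
  (forall a x y z, b x (a *: y + z) = a * b x y + b x z).

Definition hermitian_metric (J : 'End(V)) (g : V -> V -> R) : Prop :=
  [/\ bilinear_form g,
      forall x y, g x y = g y x,
      forall x, x != 0 -> 0 < g x x &
      forall x y, g (J x) (J y) = g x y].

Definition fundamental_form (J : 'End(V)) (g : V -> V -> R) : V -> V -> R :=
  fun x y => g (J x) y.

(* The exterior derivative of left-invariant 2-forms and 3-forms: the terms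
   differentiating a (constant) function drop out. *)
Definition ext_d2 (b : V -> V -> R) : V -> V -> V -> R := fun x y z =>
  - b (br x y) z + b (br x z) y - b (br y z) x.

Definition ext_d3 (h : V -> V -> V -> R) : V -> V -> V -> V -> R :=
  fun x y z w =>
  - h (br x y) z w + h (br x z) y w - h (br x w) y z
  - h (br y z) x w + h (br y w) x z - h (br z w) x y.

(* J^-1 d J on 2-forms, with J^-1 = - J on vectors. *)
Definition ext_dc2 (J : 'End(V)) (b : V -> V -> R) : V -> V -> V -> R :=
  fun x y z =>
  ext_d2 (fun u v => b (J u) (J v)) (- J x) (- J y) (- J z).

Definition SKT (J : 'End(V)) (g : V -> V -> R) : Prop :=
  forall x y z w, ext_d3 (ext_dc2 J (fundamental_form J g)) x y z w = 0.

Definition bilinear_op (N : V -> V -> V) : Prop :=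
  (forall a x y z, N (a *: x + y) z = a *: N x z + N y z) /\
  (forall a x y z, N x (a *: y + z) = a *: N x y + N x z).

Definition torsion (N : V -> V -> V) : V -> V -> V := fun x y =>
  N x y - N y x - br x y.

(* The last clause says T^{1,1} = 0: the (1,1)-part of a vector-valued 2-form
   [T] is half of [T x y + T (J x) (J y)]. *)
Definition chern_connection (J : 'End(V)) (g : V -> V -> R)
    (N : V -> V -> V) : Prop :=
  [/\ bilinear_op N,
      forall x y z, g (N x y) z + g y (N x z) = 0,
      forall x y, N x (J y) = J (N x y) &
      forall x y, torsion N x y + torsion N (J x) (J y) = 0].

(* The pair (x, y) stands for the vector x + iy of the complexification of [V];
   real tensors are extended complex-multilinearly. *)
Local Notation VC := (V * V)%type.

Definition formC (b : V -> V -> R) (X Y : VC) : R[i] :=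
  ((b X.1 Y.1 - b X.2 Y.2) +i* (b X.1 Y.2 + b X.2 Y.1))%C.

Definition opC (b : V -> V -> V) (X Y : VC) : VC :=
  (b X.1 Y.1 - b X.2 Y.2, b X.1 Y.2 + b X.2 Y.1).

Definition conjV (X : VC) : VC := (X.1, - X.2).

(* The (1,0)-part (x - iJx)/2 of [x]. *)
Definition part10 (J : 'End(V)) (x : V) : VC :=
  (2^-1 *: x, - (2^-1 *: J x)).

(* [e] is a complex basis of (V, J), so that the vectors
   [part10 J (tnth e i)] form a basis of V^{1,0}. *)
Definition complex_frame (J : 'End(V)) (m : nat) (e : m.-tuple V) : Prop :=
  basis_of fullv (e ++ map J e).

Section Components.
Context (J : 'End(V)) (g : V -> V -> R) (N : V -> V -> V).
Context (m : nat) (e : m.-tuple V).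

Let Z (i : 'I_m) : VC := part10 J (tnth e i).
Let Zbar (i : 'I_m) : VC := conjV (part10 J (tnth e i)).

(* b_{i \bar j} *)
Definition herm_comp (b : V -> V -> R) : 'M[R[i]]_m :=
  \matrix_(i, j) formC b (Z i) (Zbar j).

(* g^{k \bar l}, normalised by \sum_l g^{k \bar l} g_{j \bar l} = (j == k) *)
Definition inv_comp (k l : 'I_m) : R[i] := invmx (herm_comp g) l k.

Definition curvC (X Y W : VC) : VC :=
  opC N X (opC N Y W) - opC N Y (opC N X W) - opC N (opC br X Y) W.

(* R_{k \bar l i \bar j} *)
Definition curv_comp (k l i j : 'I_m) : R[i] :=
  formC g (curvC (Z k) (Zbar l) (Z i)) (Zbar j).

(* T_{i k \bar n} *)
Definition tors_comp (i k n : 'I_m) : R[i] :=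
  formC g (opC (torsion N) (Z i) (Z k)) (Zbar n).

(* T_{\bar j \bar l m} *)
Definition tors_comp_bar (j l n : 'I_m) : R[i] :=
  formC g (opC (torsion N) (Zbar j) (Zbar l)) (Z n).

Definition S_comp : 'M[R[i]]_m :=
  \matrix_(i, j) \sum_k \sum_l inv_comp k l * curv_comp k l i j.

Definition Q_comp : 'M[R[i]]_m :=
  \matrix_(i, j) \sum_k \sum_l \sum_p \sum_q
    inv_comp k l * inv_comp p q * tors_comp i k q * tors_comp_bar j l p.

End Components.

(* The derivative at [t] of a function defined on [I]; one-sided when [t] is an
   end point of [I]. *)
Definition has_derivative_on (I : set R) (f : R -> R) (t l : R) : Prop :=
  (fun h => h^-1 * (f (t + h) - f t)) @ within [set h | I (t + h)] 0^' --> l.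

(* [g t], for [t] in the interval [I], is a left-invariant solution of
   dg/dt = - S + Q; [dg] is the tensor dg/dt at time [t]. *)
Definition pluriclosed_flow_on (I : set R) (J : 'End(V))
    (g : R -> V -> V -> R) : Prop :=
  forall t, I t ->
    hermitian_metric J (g t) /\
    exists dg : V -> V -> R, exists N : V -> V -> V,
      [/\ forall x y, has_derivative_on I (fun s => g s x y) t (dg x y),
          chern_connection J (g t) N &
          forall m (e : m.-tuple V), complex_frame J e ->
            herm_comp J e dg = - S_comp J (g t) N e + Q_comp J (g t) N e].

End InvariantGeometry.

(* Main.v *)
(* For an SKT metric the tensor - S + Q is, up to J, the (1,1)-part of the Ricci
   form of the Bismut connection B. That form traces the last two arguments of
   the curvature while S traces the first two; the pair symmetry between the
   curvatures of the connections of torsion H and - H, where H = - d^c omega is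
   closed, exchanges them.

   In an orthonormal frame moving by e_i' = - 1/2 P^# e_i, with P = dg/dt, the
   flow is a polynomial ODE for the matrix of the frame and its inverse. The
   bracket and H are the structure constants of the twisted Dorfman bracket on
   V + V^* = V_+ + V_-, and its Jacobi identity splits P into the symmetrised
   gradient G of the functional f = |[+++]|^2 - 3 |[++-]|^2 and a Lie derivative
   of g. Hence f' = 6 |G|^2, and since derivations of the Lie algebra do not
   change the norm of the bracket, that norm squared grows at a rate of at most
   a constant times 1 + |G|^2. For a solvable Lie algebra f <= 0, so the
   integral of |G|^2 over time is bounded. The bracket, then P, and then the
   frame stay bounded on bounded time intervals. *)
From HB Require Import structures.
From mathcomp Require Import all_boot all_order all_algebra.
From mathcomp Require Import all_classical all_reals all_analysis.
From mathcomp Require Import complex ring lra zify.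
Require Import Defs.

Set Implicit Arguments.
Unset Strict Implicit.
Unset Printing Implicit Defensive.

Import Order.TTheory GRing.Theory Num.Theory.
Import numFieldNormedType.Exports.

Local Open Scope classical_set_scope.
Local Open Scope ring_scope.

(** * Picard's theorem *)

(** The identities for f' and for the bracket need [hermitian_metric] and [SKT] at every time, but
    the frame equation enforces neither. Both are recovered along a solution as conserved
    quantities: [velocityJJ] and [tors3_velocity] hold for any bilinear form in place of the metric,
    and the second one says that H moves by an exact form, so that dH stays 0.

    The weight 3 in f does two things. In f' it cancels the products of [+++] with [++-]; in f
    itself it cancels the products of the bracket with H. What is left is - 3/2 |C|^2 - 1/2 |H|^2
    minus three times the metric trace of the Killing form, with C the structure constants. In a
    frame adapted to the derived series that trace is at least - 1/2 |C|^2, whence f <= 0.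

    The argument controls the time integral of |G|^2, not its value at a given time. The growth of
    the bracket is therefore estimated by a Gronwall inequality with variable rate, whose primitive
    is a multiple of t + f / 6. *)

Section Calculus.
Context {R : realType}.
Implicit Types (f g : R -> R) (a b c t s : R).

Lemma derN f t l : is_derive t 1 f l -> is_derive t 1 (fun s => - f s) (- l).
Proof. by move=> ?; exact: is_deriveN. Qed.

Lemma derD f g t k l : is_derive t 1 f k -> is_derive t 1 g l ->
  is_derive t 1 (fun s => f s + g s) (k + l).
Proof. by move=> ? ?; exact: is_deriveD. Qed.

Lemma derB f g t k l : is_derive t 1 f k -> is_derive t 1 g l ->
  is_derive t 1 (fun s => f s - g s) (k - l).
Proof. by move=> ? ?; exact: is_deriveB. Qed.

Lemma derM f g t k l : is_derive t 1 f k -> is_derive t 1 g l ->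
  is_derive t 1 (fun s => f s * g s) (k * g t + f t * l).
Proof.
move=> ? ?; apply: is_derive_eq (is_deriveM _ _) _.
by rewrite /GRing.scale /= addrC [k * _]mulrC.
Qed.

Lemma derC c t : is_derive t 1 (fun=> c) 0.
Proof. exact: is_derive_cst. Qed.

Lemma derZ c f t l : is_derive t 1 f l -> is_derive t 1 (fun s => c * f s) (c * l).
Proof. by move=> ?; exact: is_deriveZ. Qed.

Lemma der_id t : is_derive t 1 (fun s : R => s) 1.
Proof. exact: is_derive_id. Qed.

Lemma der_sum (I : Type) (r : seq I) (P : pred I) (h : I -> R -> R) t (l : I -> R) :
  (forall i, P i -> is_derive t 1 (h i) (l i)) ->
  is_derive t 1 (fun s => \sum_(i <- r | P i) h i s) (\sum_(i <- r | P i) l i).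
Proof.
move=> hl; elim: r => [|i r IH].
  under eq_fun do rewrite big_nil.
  by rewrite big_nil; exact: derC.
under eq_fun do rewrite big_cons.
rewrite big_cons; case: (boolP (P i)) => // Pi.
by apply: derD => //; exact: hl.
Qed.

Lemma der_comp f g t k l : is_derive (g t) 1 f k -> is_derive t 1 g l ->
  is_derive t 1 (fun s => f (g s)) (l * k).
Proof. by move=> ? ?; rewrite mulrC; exact: is_derive1_comp. Qed.

Lemma is_derive_continuous f t l : is_derive t 1 f l -> {for t, continuous f}.
Proof. by move=> [df _]; apply/differentiable_continuous/derivable1_diffP. Qed.

Lemma is_derive_ndecr f (f' : R -> R) a b :
  (forall t, a <= t <= b -> is_derive t 1 f (f' t)) ->
  (forall t, a <= t <= b -> 0 <= f' t) -> a <= b -> f a <= f b.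
Proof.
move=> df f'0 ab.
have H : forall x, x \in `]a, b[%R -> a <= x <= b.
  by move=> x; rewrite in_itv /= => /andP[/ltW -> /ltW ->].
apply: (@ger0_derive1_le_cc R f a b) => //.
- by move=> x /H /df [].
- by move=> x /H xab; rewrite derive1E; have [_ ->] := df x xab; exact: f'0.
- apply: continuous_in_subspaceT => x; rewrite inE /= in_itv /= => xab.
  exact: is_derive_continuous (df x xab).
- by rewrite in_itv /= lexx ab.
- by rewrite in_itv /= lexx ab.
Qed.

Lemma is_derive0_eq f a b :
  (forall t, a <= t <= b -> is_derive t 1 f 0) -> a <= b -> f a = f b.
Proof.
move=> df ab; apply/eqP; rewrite eq_le; apply/andP; split.
  by apply: (is_derive_ndecr (f' := fun=> 0)).
rewrite -lerN2; apply: (is_derive_ndecr (f := fun x => - f x) (f' := fun=> 0)) => //.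
by move=> t tab; have := derN (df t tab); rewrite oppr0.
Qed.

Lemma lipschitz_continuous f c :
  (forall s t, `|f s - f t| <= c * `|s - t|) -> continuous f.
Proof.
move=> fc t; apply/cvgrPdist_le => e e0.
have c1 : 0 < `|c| + 1 by rewrite ltr_wpDl.
near=> s; apply: le_trans (fc _ _) _.
have st : `|t - s| <= e / (`|c| + 1).
  near: s; have := @cvgrPdist_le _ _ _ (nbhs t) _ id t.
  by move=> [H _]; apply: (H (@cvg_id _ _)); rewrite divr_gt0.
apply: (@le_trans _ _ ((`|c| + 1) * `|t - s|)).
  by rewrite ler_wpM2r // (le_trans (ler_norm c)) // lerDl.
by rewrite -ler_pdivlMl // mulrC.
Unshelve. all: by end_near. Qed.

(* The base point -1 makes the derivative at 0 two-sided. *)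
Definition primitive f t : R :=
  (\int[@lebesgue_measure R]_(s in `[-1, t]) f s -
   \int[@lebesgue_measure R]_(s in `[-1, 0]) f s)%R.

Lemma primitive0 f : primitive f 0 = 0.
Proof. exact: subrr. Qed.

Lemma is_derive_primitive f t :
  continuous f -> -1 < t -> is_derive t 1 (primitive f) (f t).
Proof.
move=> cf t1.
have int : (@lebesgue_measure R).-integrable `[-1, t + 1] (EFin \o f).
  apply: continuous_compact_integrable; first exact: segment_compact.
  by apply: continuous_subspaceT.
have t1' : t < t + 1 by rewrite ltrDl.
have [d1 d2] := continuous_FTC1_closed t1' int t1 (cf t).
have dF : is_derive t 1
   (fun t => \int[@lebesgue_measure R]_(s in `[-1, t]) f s)%R (f t).
  by split; [exact: d1 | rewrite -derive1E; exact: d2].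
have := derB dF (derC (\int[@lebesgue_measure R]_(s in `[-1, 0]) f s)%R t).
by rewrite subr0.
Qed.

Lemma is_derive_bound (u u' v v' : R -> R) a b :
  (forall t, a <= t <= b -> is_derive t 1 u (u' t)) ->
  (forall t, a <= t <= b -> is_derive t 1 v (v' t)) ->
  (forall t, a <= t <= b -> `|u' t| <= v' t) ->
  a <= b -> `|u b - u a| <= v b - v a.
Proof.
move=> du dv uv ab; rewrite ler_norml; apply/andP; split.
- have : v a + u a <= v b + u b.
    apply: (is_derive_ndecr (f := v \+ u) (f' := v' \+ u')) => // t tab.
      exact: derD (dv t tab) (du t tab).
    by have := uv t tab; rewrite ler_norml => /andP[? _] /=; lra.
  lra.
- have : v a - u a <= v b - u b.
    apply: (is_derive_ndecr (f := v \- u) (f' := v' \- u')) => // t tab.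
      exact: derB (dv t tab) (du t tab).
    by have := uv t tab; rewrite ler_norml => /andP[_ ?] /=; lra.
  lra.
Qed.

Lemma lipschitz_of_derivative f (f' : R -> R) c :
  (forall t, 0 <= t -> is_derive t 1 f (f' t)) ->
  (forall t, 0 <= t -> `|f' t| <= c) ->
  forall s t, 0 <= s -> 0 <= t -> `|f s - f t| <= c * `|s - t|.
Proof.
move=> df f'c.
have H s t : 0 <= s -> s <= t -> `|f t - f s| <= c * `|t - s|.
  move=> s0 st.
  have := @is_derive_bound f f' (fun x => c * x) (fun=> c) s t.
  rewrite -mulrBr => H; rewrite [X in _ * X]ger0_norm ?subr_ge0 //.
  apply: H => //.
  - by move=> x /andP[sx _]; apply: df; lra.
  - by move=> x _; rewrite -[X in is_derive _ _ _ X]mulr1; exact: derZ (der_id x).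
  - by move=> x /andP[sx _]; apply: f'c; lra.
move=> s t s0 t0; case: (leP s t) => [|/ltW] st; last exact: H.
by rewrite distrC [in X in _ <= X]distrC; exact: H.
Qed.

Lemma is_derive_expM c t :
  is_derive t 1 (fun s => expR (c * s)) (c * expR (c * t)).
Proof.
have H : is_derive t 1 (fun s : R => c * s) c.
  by rewrite -[X in is_derive _ _ _ X]mulr1; exact: derZ (der_id t).
exact: der_comp (is_derive_expR _) H.
Qed.

(** The estimate behind the weighted norm of the Picard iteration: the derivative of
    [a * expR (k * t)] dominates [u'], and its value at 0 is nonnegative. *)
Lemma growth_bound (u u' : R -> R) a k t :
  (forall t, 0 <= t -> is_derive t 1 u (u' t)) -> u 0 = 0 ->
  (forall t, 0 <= t -> `|u' t| <= a * (k * expR (k * t))) -> 0 <= t -> 0 <= a ->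
  `|u t| <= a * expR (k * t).
Proof.
move=> du u0 ub t0 a0.
have := @is_derive_bound u u' (fun x => a * expR (k * x))
   (fun x => a * (k * expR (k * x))) 0 t.
rewrite u0 subr0 mulr0 expR0 mulr1 => H.
apply: le_trans (_ : a * expR (k * t) - a <= _); last by rewrite gerBl.
apply: H => //.
- by move=> x /andP[x0 _]; exact: du.
- by move=> x _; exact: derZ (is_derive_expM k x).
- by move=> x /andP[x0 _]; exact: ub.
Qed.

Lemma lt_half_pow c e : 0 < e -> exists k, c / 2 ^+ k < e.
Proof.
move=> e0; exists (Num.truncn (`|c| / e)).+1.
rewrite ltr_pdivrMr ?exprn_gt0 //.
apply: le_lt_trans (ler_norm c) _.
have: `|c| / e < (Num.truncn (`|c| / e)).+1%:R by rewrite truncnS_gt.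
rewrite ltr_pdivrMr // => /lt_le_trans; apply.
rewrite mulrC ler_wpM2l // ?(ltW e0) //.
by rewrite -natrX ler_nat ltnW // ltn_expl.
Qed.

Lemma le_half_pow a b c : (forall k, a <= b + c / 2 ^+ k) -> a <= b.
Proof.
move=> H; case: leP => // ba.
have [|k hk] := @lt_half_pow c (a - b); first by rewrite subr_gt0.
by have := H k; lra.
Qed.

(** The intervals of radius [2 * c / 2 ^+ k] around [u k] are nested, because the radius drops by
    [c / 2 ^+ k] at each step; the limit is the supremum of their left ends. *)
Lemma dyadic_limit (u : nat -> R) c :
  (forall k, `|u k.+1 - u k| <= c / 2 ^+ k) ->
  exists l, forall k, `|l - u k| <= 2 * c / 2 ^+ k.
Proof.
move=> du; pose A k := u k - 2 * c / 2 ^+ k; pose B k := u k + 2 * c / 2 ^+ k.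
have c0 : 0 <= c by have := du 0%N; rewrite expr0 divr1; apply: le_trans.
have step k : 2 * c / 2 ^+ k.+1 = c / 2 ^+ k.
  by rewrite exprS; field; rewrite expf_neq0.
have AS k : A k <= A k.+1.
  by have := du k; rewrite ler_norml /A step -!mulrA => /andP[? _]; lra.
have BS k : B k.+1 <= B k.
  by have := du k; rewrite ler_norml /B step -!mulrA => /andP[_ ?]; lra.
have Amono : {homo A : m n / (m <= n)%N >-> m <= n}.
  by apply: homo_leq => // x y z; exact: le_trans.
have Bmono : {homo B : m n / (m <= n)%N >-> n <= m}.
  by apply: homo_leq => // x y z H1 H2; exact: le_trans H2 H1.
have AB m n : A m <= B n.
  apply: (le_trans (Amono _ _ (leq_maxl m n))).
  apply: (le_trans _ (Bmono _ _ (leq_maxr m n))).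
  have : 0 <= 2 * c / 2 ^+ maxn m n by rewrite divr_ge0 ?exprn_ge0 // mulr_ge0.
  by rewrite /A /B; lra.
exists (sup (range A)) => k.
have h1 : A k <= sup (range A).
  apply: ub_le_sup; last by exists k.
  by exists (B k) => _ [m _ <-].
have h2 : sup (range A) <= B k.
  by apply: ge_sup; [exists (A 0%N); exists 0%N | move=> _ [m _ <-]].
by rewrite ler_norml; move: h1 h2; rewrite /A /B; lra.
Qed.

End Calculus.

Section Picard.
Context {R : realType} (I : finType) (F : I -> (I -> R) -> R) (y0 : I -> R).
Context (L B : R).
Hypothesis L0 : 0 < L.
Hypothesis F_lip : forall i y z (c : R),
  (forall j, `|y j - z j| <= c) -> `|F i y - F i z| <= L * c.
Hypothesis F_bound : forall i y, `|F i y| <= B.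

(** Before time 0 the field is frozen at its value at 0, so that the iterates have a two-sided
    derivative there. *)
Let field (y : R -> I -> R) i (s : R) := F i (y (Num.max s 0)).

Let step (y : R -> I -> R) : R -> I -> R :=
  fun t i => y0 i + primitive (field y i) t.

Let lip (y : R -> I -> R) := forall i (s t : R), 0 <= s -> 0 <= t ->
  `|y s i - y t i| <= B * `|s - t|.

Let B_ge0 (i : I) : 0 <= B.
Proof. exact: le_trans (F_bound i y0). Qed.

Let field_continuous y i : lip y -> continuous (field y i).
Proof.
move=> yl; apply: (@lipschitz_continuous _ _ (L * B)) => s t.
have max0 (x : R) : 0 <= Num.max x 0 by rewrite le_max lexx orbT.
apply: le_trans (F_lip (c := B * `|s - t|) _ _) _; last by rewrite mulrA.
move=> j; apply: le_trans (yl _ _ _ (max0 _) (max0 _)) _.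
rewrite ler_wpM2l ?(B_ge0 i) //.
rewrite /Num.max; case: ifP => h1; case: ifP => h2 //.
- by rewrite subrr normr0.
- have /ltW := h1; move/negbT: h2; rewrite -leNgt => t0 s0.
  rewrite sub0r normrN (ger0_norm t0) ler_normr; apply/orP; right; lra.
- have /ltW := h2; move/negbT: h1; rewrite -leNgt => t0 s0.
  by rewrite subr0 (ger0_norm t0) ler_normr; apply/orP; left; lra.
Qed.

Let step_derive y i (t : R) : lip y -> -1 < t ->
  is_derive t 1 (step y ^~ i) (field y i t).
Proof.
move=> yl t1; have dP := is_derive_primitive (@field_continuous y i yl) t1.
by have := derD (derC (y0 i) t) dP; rewrite add0r.
Qed.

Let step_lip y : lip y -> lip (step y).
Proof.
move=> yl i; apply: (lipschitz_of_derivative (f' := field y i)) => // t t0.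
  by apply: step_derive => //; lra.
exact: F_bound.
Qed.

Let iterate k := iter k step (fun=> y0).

Let iterate_lip k : lip (iterate k).
Proof.
elim: k => [|k]; last exact: step_lip.
by move=> i s t _ _; rewrite subrr normr0 mulr_ge0 // (B_ge0 i).
Qed.

(** Chosen so that [B <= M * (2 * L * weight t)] for nonnegative [t], which bounds the first
    increment of the iteration. *)
Let M := B / (2 * L).

Let M_ge0 (i : I) : 0 <= M.
Proof. by rewrite divr_ge0 ?(B_ge0 i) // mulr_ge0 // ltW. Qed.

(** In the supremum norm divided by this weight [step] halves distances: integrating
    [L * (2 * a * weight s)] gives at most [a * weight t]. The iteration thus converges on the whole
    half-line at once. *)
Let weight (t : R) := expR (2 * L * t).

Let step_contract y z (a : R) i (t : R) : lip y -> lip z -> 0 <= a ->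
  (forall (t : R) i, 0 <= t -> `|y t i - z t i| <= 2 * a * weight t) ->
  0 <= t -> `|step y t i - step z t i| <= a * weight t.
Proof.
move=> yl zl a0 yz t0.
have := @growth_bound R (fun s => step y s i - step z s i)
  (fun s => field y i s - field z i s) a (2 * L) t.
apply => //; last 2 first.
- by rewrite /step !primitive0 subrr.
- move=> s s0; apply: le_trans (F_lip (c := 2 * a * weight s) _ _) _.
    by move=> j; rewrite (max_idPl s0); exact: yz.
  by rewrite [leLHS](_ : _ = a * (2 * L * expR (2 * L * s))) // /weight; ring.
move=> s s0; have s1 : -1 < s by lra.
exact: derB (@step_derive y i s yl s1) (@step_derive z i s zl s1).
Qed.

Let iterate_diff k i (t : R) : 0 <= t ->
  `|iterate k.+1 t i - iterate k t i| <= M * weight t / 2 ^+ k.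
Proof.
move=> t0; elim: k => [|k IH] in i t t0 *.
  rewrite expr0 divr1.
  have := @growth_bound R (fun s => step (fun=> y0) s i - y0 i)
    (field (fun=> y0) i) M (2 * L) t; apply => //.
  - move=> s s0; have s1 : -1 < s by lra.
    have := derB (@step_derive (fun=> y0) i s (@iterate_lip 0) s1) (derC (y0 i) s).
    by rewrite subr0.
  - by rewrite /step primitive0 addr0 subrr.
  - move=> s s0; apply: le_trans (F_bound _ _) _.
    rewrite /M mulrA divfK ?mulf_neq0 ?gt_eqF // ler_peMr ?(B_ge0 i) //.
    by rewrite -expR0 ler_expR mulr_ge0 // mulr_ge0 // ltW.
  - exact: M_ge0.
rewrite mulrAC.
apply: (@step_contract (iterate k.+1) (iterate k) _ i t _ _ _ _ t0).
- exact: (@iterate_lip k.+1).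
- exact: (@iterate_lip k).
- by rewrite divr_ge0 ?(M_ge0 i) ?exprn_ge0.
move=> s j s0; have e : 2 * (M / 2 ^+ k.+1) * weight s = M * weight s / 2 ^+ k.
  by rewrite exprS; field; rewrite expf_neq0.
by rewrite e; exact: IH.
Qed.

Lemma picard : exists y : R -> I -> R,
  (forall i, y 0 i = y0 i) /\
  forall i (t : R), -1 < t -> is_derive t 1 (y ^~ i) (F i (y (Num.max t 0))).
Proof.
have lim t i : {l | 0 <= t ->
    forall k, `|l - iterate k t i| <= 2 * (M * weight t) / 2 ^+ k}.
  apply: cid; case: (leP 0 t) => [t0|]; last by exists 0.
  have [l hl] := @dyadic_limit R (fun k => iterate k t i) (M * weight t)
    (fun k => iterate_diff k i t0).
  by exists l.
pose y t i := sval (lim t i).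
have yE t i k : 0 <= t ->
    `|y t i - iterate k t i| <= 2 * (M * weight t) / 2 ^+ k.
  by move=> t0; exact: (svalP (lim t i)).
have yl : lip y.
  move=> i s t s0 t0; apply: (@le_half_pow _ _ _
    (2 * (M * weight s) + 2 * (M * weight t))) => k.
  have := yE s i k s0; have := yE t i k t0; have := iterate_lip k i s0 t0.
  rewrite mulrDl; set p := iterate k t i; set q := iterate k s i => h1 h2 h3.
  have -> : y s i - y t i = (y s i - q) + (q - p) - (y t i - p) by ring.
  apply: le_trans (ler_normB _ _) _.
  apply: le_trans (lerD (ler_normD _ _) (lexx _)) _; lra.
have yS t i : 0 <= t -> step y t i = y t i.
  move=> t0; apply/eqP; rewrite -subr_eq0 -normr_le0.
  apply: (@le_half_pow _ _ _ (2 * (M * weight t))) => k.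
  have h := yE t i k.+1 t0.
  have h' : `|step y t i - iterate k.+1 t i| <= M / 2 ^+ k * weight t.
    apply: (@step_contract y (iterate k) _ i t yl (@iterate_lip k) _ _ t0).
      by rewrite divr_ge0 ?(M_ge0 i) ?exprn_ge0.
    move=> s j s0; apply: le_trans (yE s j k s0) _.
    rewrite [leLHS](_ : _ = 2 * (M / 2 ^+ k) * weight s) //.
    by field; rewrite expf_neq0.
  have -> : step y t i - y t i =
    (step y t i - iterate k.+1 t i) - (y t i - iterate k.+1 t i).
    by rewrite opprB addrA subrK.
  apply: le_trans (ler_normB _ _) _.
  have e1 : M / 2 ^+ k * weight t = M * weight t / 2 ^+ k by rewrite mulrAC.
  have e2 : 2 * (M * weight t) / 2 ^+ k.+1 = M * weight t / 2 ^+ k.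
    by rewrite exprS; field; rewrite expf_neq0.
  move: h h'; rewrite e1 e2 -mulrA; lra.
exists (step y); split=> [i|i t t1]; first by rewrite /step primitive0 addr0.
have -> : step y (Num.max t 0) = y (Num.max t 0).
  by apply/funext => j; rewrite yS // le_max lexx orbT.
exact: step_derive.
Qed.

End Picard.

(** * Global solutions from a priori bounds *)

Section LocallyLipschitz.
Context {R : realType} {I : finType}.
Implicit Types f g : (I -> R) -> R.

Definition loc_lipschitz f := forall r : R, exists2 L : R, 0 <= L &
  forall (y z : I -> R) (c : R), 0 <= c ->
    (forall i, `|y i| <= r) -> (forall i, `|z i| <= r) ->
    (forall i, `|y i - z i| <= c) -> `|f y - f z| <= L * c.

Lemma loc_lipschitz_bounded f (r : R) : loc_lipschitz f ->
  exists2 B : R, 0 <= B & forall y, (forall i, `|y i| <= r) -> `|f y| <= B.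
Proof.
move=> /(_ `|r|)[L L0 Lf]; exists (`|f (fun=> 0)| + L * `|r|) => [|y yr].
  by rewrite addr_ge0 // mulr_ge0.
rewrite -[f y](subrK (f (fun=> 0))) addrC.
apply: le_trans (ler_normD _ _) _; rewrite lerD2l.
have yr' i : `|y i| <= `|r| by apply: le_trans (yr i) (ler_norm r).
by apply: Lf => // i; rewrite ?normr0 ?subr0.
Qed.

Lemma loc_lipschitz_cst (a : R) : loc_lipschitz (fun=> a).
Proof. by move=> r; exists 0 => // y z c *; rewrite subrr normr0 mul0r. Qed.

Lemma loc_lipschitz_proj (i : I) : loc_lipschitz (fun y => y i).
Proof. by move=> r; exists 1 => // y z c c0 yr zr yz; rewrite mul1r. Qed.

Lemma loc_lipschitzD f g : loc_lipschitz f -> loc_lipschitz g ->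
  loc_lipschitz (fun y => f y + g y).
Proof.
move=> hf hg r; have [K K0 Kf] := hf r; have [L L0 Lg] := hg r.
exists (K + L) => [|y z c c0 yr zr yz]; first exact: addr_ge0.
have -> : f y + g y - (f z + g z) = (f y - f z) + (g y - g z) by ring.
by apply: le_trans (ler_normD _ _) _; rewrite mulrDl lerD ?Kf ?Lg.
Qed.

Lemma loc_lipschitzM f g : loc_lipschitz f -> loc_lipschitz g ->
  loc_lipschitz (fun y => f y * g y).
Proof.
move=> hf hg r; have [K K0 Kf] := hf r; have [L L0 Lg] := hg r.
have [A A0 fA] := loc_lipschitz_bounded r hf.
have [B B0 gB] := loc_lipschitz_bounded r hg.
exists (A * L + K * B) => [|y z c c0 yr zr yz].
  by rewrite addr_ge0 // mulr_ge0.
have -> : f y * g y - f z * g z = f y * (g y - g z) + (f y - f z) * g z by ring.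
apply: le_trans (ler_normD _ _) _; rewrite [leRHS]mulrDl !normrM lerD //.
  by rewrite -mulrA ler_pM // ?fA ?Lg.
by rewrite mulrAC ler_pM // ?gB ?Kf.
Qed.

Lemma loc_lipschitzZ (a : R) f : loc_lipschitz f ->
  loc_lipschitz (fun y => a * f y).
Proof. by apply: loc_lipschitzM; exact: loc_lipschitz_cst. Qed.

Lemma loc_lipschitzN f : loc_lipschitz f -> loc_lipschitz (fun y => - f y).
Proof. by move/(loc_lipschitzZ (-1)); under eq_fun do rewrite mulN1r. Qed.

Lemma loc_lipschitz_sum (T : Type) (s : seq T) (P : pred T) (F : T -> (I -> R) -> R) :
  (forall k, loc_lipschitz (F k)) ->
  loc_lipschitz (fun y => \sum_(k <- s | P k) F k y).
Proof.
move=> hF; elim: s => [|k s IH].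
  by under eq_fun do rewrite big_nil; exact: loc_lipschitz_cst.
under eq_fun do rewrite big_cons.
by case: (P k) => //; exact: loc_lipschitzD.
Qed.

Lemma loc_lipschitz_uniform (F : I -> (I -> R) -> R) (r : R) :
  (forall i, loc_lipschitz (F i)) ->
  exists2 L : R, 0 < L & forall i (y z : I -> R) (c : R), 0 <= c ->
    (forall j, `|y j| <= r) -> (forall j, `|z j| <= r) ->
    (forall j, `|y j - z j| <= c) -> `|F i y - F i z| <= L * c.
Proof.
move=> hF; pose L i := sval (cid2 (hF i r)).
have L0 i : 0 <= L i by rewrite /L; case: cid2.
exists (1 + \sum_i L i) => [|i y z c c0 yr zr yz].
  by rewrite ltr_wpDr // sumr_ge0.
apply: (@le_trans _ _ (L i * c)); first by rewrite /L; case: cid2 => /= *; auto.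
by rewrite ler_wpM2r // (bigD1 i) //= addrCA lerDl addr_ge0 // sumr_ge0.
Qed.

End LocallyLipschitz.

Section Gronwall.
Context {R : realType}.
Implicit Types (u h : R -> R).

(** [u * expR (- h)] is nonincreasing. The rate enters through its primitive [h], because the rate
    for the norm of the bracket is controlled only through its time integral. *)
Lemma gronwall u (u' : R -> R) h (h' : R -> R) (T : R) :
  (forall t : R, 0 <= t <= T -> is_derive t 1 u (u' t)) ->
  (forall t : R, 0 <= t <= T -> is_derive t 1 h (h' t)) ->
  (forall t : R, 0 <= t <= T -> u' t <= h' t * u t) ->
  0 <= T -> u T <= u 0 * expR (h T - h 0).
Proof.
move=> du dh uh T0.
pose v t := - (u t * expR (- h t)).
have dv t : 0 <= t <= T ->
    is_derive t 1 v (- (u' t * expR (- h t) + u t * (- h' t * expR (- h t)))).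
  move=> tT; apply: derN; apply: derM; first exact: du.
  exact: der_comp (is_derive_expR _) (derN (dh t tT)).
have := is_derive_ndecr dv _ T0.
rewrite /v lerN2 => H.
have {}H : u T * expR (- h T) <= u 0 * expR (- h 0).
  apply: H => t tT; have := uh t tT; have := expR_gt0 (- h t).
  set E := expR _ => E0 Ht.
  rewrite (_ : - _ = (h' t * u t - u' t) * E); last by ring.
  by rewrite mulr_ge0 ?subr_ge0 // ltW.
have := ler_wpM2r (expR_ge0 (h T)) H.
rewrite -mulrA -expRD addNr expR0 mulr1 -mulrA -expRD.
by rewrite [- _ + _]addrC.
Qed.

End Gronwall.

Section GlobalSolution.
Context {R : realType} (I : finType) (F : I -> (I -> R) -> R) (y0 : I -> R).
Hypothesis F_lip : forall i, loc_lipschitz (F i).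

Definition solution_on (T : R) (y : R -> I -> R) :=
  (forall i, y 0 i = y0 i) /\
  (forall i (t : R), 0 <= t <= T -> is_derive t 1 (y ^~ i) (F i (y t))).

(** Gronwall for the sum of squares [u] of the coordinate differences. Each difference is at most
    the square root of [u], so the Lipschitz bound turns every product into at most [L * u]. *)
Lemma solution_unique (T r : R) (y z : R -> I -> R) :
  solution_on T y -> solution_on T z ->
  (forall i (t : R), 0 <= t <= T -> `|y t i| <= r) ->
  (forall i (t : R), 0 <= t <= T -> `|z t i| <= r) ->
  forall t : R, 0 <= t <= T -> y t = z t.
Proof.
move=> [yi dy] [zi dz] yr zr t /andP[t0 tT].
have [L L0 hL] := loc_lipschitz_uniform r F_lip.
pose u s := \sum_i (y s i - z s i) * (y s i - z s i).
pose K := \sum_(i : I) 2 * L.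
have sT s : 0 <= s <= t -> 0 <= s <= T by case/andP => -> /le_trans; apply.
have sq0 (x : R) : 0 <= x * x by rewrite -expr2 sqr_ge0.
have u0 s : 0 <= u s by apply: sumr_ge0 => i _; exact: sq0.
have : u t <= u 0 * expR (K * t - K * 0).
  apply: (@gronwall _ u (fun s => \sum_i
     ((F i (y s) - F i (z s)) * (y s i - z s i) +
      (y s i - z s i) * (F i (y s) - F i (z s)))) (fun s => K * s) (fun=> K)) => //.
  - move=> s /sT hs; apply: der_sum => i _.
    by apply: derM; apply: derB; [exact: dy | exact: dz | exact: dy | exact: dz].
  - by move=> s _; rewrite -[X in is_derive _ _ _ X]mulr1; exact: derZ (der_id s).
  - move=> s /sT hs; rewrite mulr_suml; apply: ler_sum => i _.
    have bound j : `|y s j - z s j| <= Num.sqrt (u s).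
      rewrite -sqrtr_sqr ler_sqrt // expr2 /u (bigD1 j) //= lerDl.
      by apply: sumr_ge0 => k _; exact: sq0.
    have Fb : `|F i (y s) - F i (z s)| <= L * Num.sqrt (u s).
      by apply: (hL i _ _ _ (sqrtr_ge0 _) _ _ bound) => j; [exact: yr | exact: zr].
    have : (y s i - z s i) * (F i (y s) - F i (z s)) <= L * u s.
      rewrite -(sqr_sqrtr (u0 s)) expr2 mulrCA.
      by apply: le_trans (ler_norm _) _; rewrite normrM ler_pM.
    by lra.
rewrite {2}/u big1 ?mul0r => [ut|i _]; last by rewrite yi zi subrr mulr0.
have {ut} : u t = 0 by apply/eqP; rewrite eq_le ut u0.
move=> /eqP; rewrite psumr_eq0 => [/allP ut|i _]; last exact: sq0.
apply/funext => i; have := ut i (mem_index_enum i).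
by rewrite /= mulf_eq0 orbb subr_eq0 => /eqP.
Qed.

Hypothesis a_priori : forall T : R, 0 <= T -> exists r : R, forall y (t : R),
  0 <= t <= T -> solution_on t y -> forall i (s : R), 0 <= s <= t -> `|y s i| <= r.

Let clamp (r x : R) := Num.max (- r) (Num.min x r).

Let clamp_le (r x : R) : 0 <= r -> `|clamp r x| <= r.
Proof.
move=> r0; rewrite /clamp ler_norml le_max lexx /= ge_max ge_min lexx orbT andbT.
lra.
Qed.

Let clamp_id r x : `|x| <= r -> clamp r x = x.
Proof.
rewrite ler_norml => /andP[rx xr].
by rewrite /clamp (min_idPl xr); exact/max_idPr.
Qed.

Let clamp_lip (r x y : R) : 0 <= r -> `|clamp r x - clamp r y| <= `|x - y|.
Proof.
move=> r0.
have H u v : u <= v -> `|clamp r v - clamp r u| <= `|v - u|.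
  move=> uv; rewrite [leRHS]ger0_norm ?subr_ge0 // ler_norml /clamp.
  by case: (leP v r) => ?; case: (leP u r) => ?; case: (leP (- r) v) => ?;
    case: (leP (- r) u) => ?; case: (leP (- r) r) => ?; apply/andP; split; lra.
by case: (leP y x) => [|/ltW] xy; [|rewrite distrC [leRHS]distrC]; exact: H.
Qed.

(** Picard's theorem is applied to the field truncated at radius [r + 1]; the a priori bound keeps
    the solution where the truncation has no effect. The last clause serves to glue solutions for
    different [T] near time 0. *)
Let exists_on (T : R) : 0 <= T -> exists y (r : R),
  [/\ solution_on T y, forall i (t : R), 0 <= t <= T -> `|y t i| <= r &
      forall i (t : R), -1 < t <= 0 -> is_derive t 1 (y ^~ i) (F i y0)].
Proof.
move=> T0; have [r0 hr0] := a_priori T0.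
pose r : R := `|r0| + \sum_i `|y0 i|.
have r_ge0 : 0 <= r by rewrite addr_ge0 // sumr_ge0.
have r0r : r0 <= r by rewrite (le_trans (ler_norm r0)) // lerDl sumr_ge0.
have y0r i : `|y0 i| <= r.
  by rewrite /r (bigD1 i) //= addrCA lerDl addr_ge0 // sumr_ge0.
have r1 : 0 <= r + 1 by rewrite addr_ge0.
have [L L0 hL] := loc_lipschitz_uniform (r + 1) F_lip.
pose F' i y := F i (fun j => clamp (r + 1) (y j)).
have F'E i y : (forall j, `|y j| <= r + 1) -> F' i y = F i y.
  by move=> yr; congr F; apply/funext => j; exact: clamp_id.
pose Fb i := sval (cid2 (loc_lipschitz_bounded (r + 1) (F_lip i))).
have Fb0 i : 0 <= Fb i by rewrite /Fb; case: cid2.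
pose B : R := \sum_i Fb i.
have F'B i y : `|F' i y| <= B.
  apply: (@le_trans _ _ (Fb i)).
    by rewrite /Fb; case: cid2 => /= b _; apply => j; exact: clamp_le.
  by rewrite /B (bigD1 i) //= lerDl sumr_ge0.
have F'L i y z (c : R) : (forall j, `|y j - z j| <= c) ->
    `|F' i y - F' i z| <= L * c.
  move=> yz; apply: (hL i) => [|j|j|j]; rewrite ?clamp_le //.
    by apply: le_trans (normr_ge0 _) (yz i).
  by apply: le_trans (clamp_lip _ _ r1) (yz j).
have [y [yi dy]] := picard y0 L0 F'L F'B.
have dy' i (t : R) : 0 <= t -> is_derive t 1 (y ^~ i) (F' i (y t)).
  by move=> t0; rewrite -[t in y t](max_idPl t0); apply: dy; lra.
have yL i := lipschitz_of_derivative (dy' i) (fun t _ => F'B i (y t)).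
(* In time [d] a coordinate moves by at most [B * d <= 1]. A curve bounded by [r] up to time
   [k%:R * d] is thus bounded by [r + 1] one step later, where it solves the original equation; the
   a priori bound then brings it back under [r]. *)
pose d := (B + 1)^-1.
have B1 : 0 < B + 1 by rewrite ltr_wpDl // sumr_ge0.
have d0 : 0 < d by rewrite invr_gt0.
have inside (k : nat) : forall i (t : R), 0 <= t <= T -> t <= k%:R * d -> `|y t i| <= r.
  elim: k => [|k IH] i t /andP[t0 tT].
    rewrite mul0r => t0'; have -> : t = 0 by apply/le_anti; rewrite t0'.
    by rewrite yi.
  rewrite -natr1 mulrDl mul1r => tk.
  have near_inside (s : R) j : 0 <= s <= t -> `|y s j| <= r + 1.
    move=> /andP[s0 st].
    case: (leP s (k%:R * d)) => [sk|/ltW ks].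
      by have := IH j s _ sk; rewrite s0 (le_trans st) // => /(_ isT); lra.
    have k0 : 0 <= k%:R * d by rewrite mulr_ge0 // ltW.
    have := IH j (k%:R * d); rewrite k0 (le_trans ks) ?(le_trans st) // lexx.
    move=> /(_ isT isT) h1; have h2 := yL j s (k%:R * d) s0 k0.
    have h3 : B * `|s - k%:R * d| <= 1.
      rewrite ger0_norm ?subr_ge0 //.
      apply: (@le_trans _ _ (B * d)).
        by rewrite ler_wpM2l ?sumr_ge0 //; lra.
      by rewrite ler_pdivrMr // mul1r lerDl.
    rewrite -[y s j](subrK (y (k%:R * d) j)).
    by apply: le_trans (ler_normD _ _) _; lra.
  apply: le_trans r0r; apply: (hr0 y t) => //; last by rewrite t0 lexx.
    by rewrite t0.
  split=> // j s hs; rewrite -F'E => [|l]; last exact: near_inside.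
  by apply: dy'; case/andP: hs.
have [k hk] : exists k : nat, T <= k%:R * d.
  exists (Num.truncn (T / d)).+1; rewrite -ler_pdivrMr // ltW //.
  by rewrite truncnS_gt.
have yr i (t : R) : 0 <= t <= T -> `|y t i| <= r.
  by move=> tT; apply: (inside k) => //; case/andP: tT => _ /le_trans; apply.
have r_le : r <= r + 1 by rewrite lerDl.
exists y, r; split => // [|i t /andP[t1 t0]].
  split=> // i t tT; rewrite -F'E => [|j]; last exact: le_trans (yr _ _ tT) _.
  by apply: dy'; case/andP: tT.
rewrite -F'E => [|j]; last exact: le_trans (y0r j) _.
have -> : y0 = y 0 by apply/funext => j; rewrite yi.
by rewrite -[0](max_idPr t0); exact: dy.
Qed.

Lemma global_solution : exists y, (forall i, y 0 i = y0 i) /\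
  forall i (t : R), 0 <= t -> is_derive t 1 (y ^~ i) (F i (y t)).
Proof.
have ex (k : nat) : {z : R -> I -> R | exists r : R,
  [/\ solution_on k.+1%:R z, forall i (t : R), 0 <= t <= k.+1%:R -> `|z t i| <= r &
      forall i (t : R), -1 < t <= 0 -> is_derive t 1 (z ^~ i) (F i y0)]}.
  apply: cid; have [|z [r H]] := @exists_on k.+1%:R; first exact: ler0n.
  by exists z, r.
pose z k := sval (ex k).
(* The derivative of the glued curve at 0 needs agreement on a full neighbourhood, hence also at
   negative times; there both curves have the constant derivative [F i y0]. *)
have agree k l (t : R) : (k <= l)%N -> -1 < t <= k.+1%:R -> z k t = z l t.
  move=> kl /andP[t1 tk]; rewrite /z.
  case: (ex k) => zk [r [[si sd] sr sn]]; case: (ex l) => zl [r' [[si' sd'] sr' sn']] /=.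
  have kl' : k.+1%:R <= l.+1%:R :> R by rewrite ler_nat.
  case: (leP 0 t) => t0.
    have tkk : 0 <= t <= k.+1%:R by rewrite t0.
    have kl_itv (s : R) : 0 <= s <= k.+1%:R -> 0 <= s <= l.+1%:R.
      by case/andP => -> /le_trans; apply.
    apply: (@solution_unique k.+1%:R (Num.max r r')) tkk.
    - by split.
    - by split=> // i s /kl_itv; exact: sd'.
    - by move=> i s hs; rewrite le_max sr.
    - by move=> i s /kl_itv hs; rewrite le_max sr' // orbT.
  apply/funext => i; apply/eqP; rewrite -subr_eq0.
  have -> : zk t i - zl t i = zk 0 i - zl 0 i; last by rewrite si si' subrr.
  apply: (@is_derive0_eq _ (fun s => zk s i - zl s i)); last exact: ltW.
  move=> s /andP[ts s0].
  have hs : -1 < s <= 0 by rewrite s0 (lt_le_trans t1 ts).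
  by rewrite -(subrr (F i y0)); apply: derB; [exact: sn | exact: sn'].
pose tr (t : R) := Num.truncn t.
have tr_lt t : t < (tr t).+1%:R by exact: truncnS_gt.
exists (fun t => z (tr t) t); split=> [i|i t t0].
  by rewrite /z; case: (ex _) => /= zk [r [[si _] _ _]].
have dz : is_derive t 1 (z (tr t) ^~ i) (F i (z (tr t) t)).
  rewrite /z; case: (ex (tr t)) => /= zk [r [[si sd] _ _]].
  by apply: sd; rewrite t0 ltW.
apply: near_eq_is_derive dz.
have t1 : -1 < t by lra.
near=> s.
have s1 : -1 < s by near: s; exact: lt_nbhsr.
have s2 : s < (tr t).+1%:R by near: s; exact: lt_nbhsl.
case: (leqP (tr t) (tr s)) => h; first by rewrite (agree _ _ _ h) // s1 ltW.
by rewrite (agree _ _ _ (ltnW h)) // s1 ltW.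
Unshelve. all: by end_near. Qed.

End GlobalSolution.

(** * Orthonormal frames *)

Section LinearForms.
Context {R : realType} {V : vectType R}.
Implicit Types (f : V -> R) (g : V -> V -> R).

Definition linform f := forall a u v, f (a *: u + v) = a * f u + f v.

Lemma linform0 f : linform f -> f 0 = 0.
Proof.
move=> lf; have := lf 1 0 0; rewrite scaler0 addr0 mul1r => h; lra.
Qed.

Lemma linformD f u v : linform f -> f (u + v) = f u + f v.
Proof. by move=> lf; rewrite -[u]scale1r lf scale1r mul1r. Qed.

Lemma linformZ f a u : linform f -> f (a *: u) = a * f u.
Proof. by move=> lf; rewrite -[_ *: _]addr0 lf linform0 // addr0. Qed.

Lemma linformN f u : linform f -> f (- u) = - f u.
Proof. by move=> lf; rewrite -scaleN1r linformZ // mulN1r. Qed.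

Lemma linformB f u v : linform f -> f (u - v) = f u - f v.
Proof. by move=> lf; rewrite linformD // linformN. Qed.

Lemma linform_sum f (I : Type) (s : seq I) (P : pred I) (u : I -> V) :
  linform f -> f (\sum_(i <- s | P i) u i) = \sum_(i <- s | P i) f (u i).
Proof.
move=> lf; elim: s => [|i s IH]; first by rewrite !big_nil linform0.
by rewrite !big_cons; case: (P i); rewrite ?linformD // IH.
Qed.

Definition orthonormal_frame g n (e : 'I_n -> V) :=
  (forall i j, g (e i) (e j) = (i == j)%:R) /\
  (forall x, x = \sum_i g x (e i) *: e i).

Lemma frame_contract g n (e : 'I_n -> V) f v : orthonormal_frame g e ->
  linform f -> \sum_i g v (e i) * f (e i) = f v.
Proof.
move=> [_ ee] lf; rewrite {2}(ee v) linform_sum //.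
by apply: eq_bigr => i _; rewrite linformZ.
Qed.

Lemma frame_trace g n m (e : 'I_n -> V) (e' : 'I_m -> V) (phi : V -> V -> R) :
  (forall x y, g x y = g y x) ->
  orthonormal_frame g e -> orthonormal_frame g e' ->
  (forall y, linform (phi ^~ y)) -> (forall x, linform (phi x)) ->
  \sum_i phi (e' i) (e' i) = \sum_i phi (e i) (e i).
Proof.
move=> gC ee ee' l1 l2.
under eq_bigr => i _ do
  rewrite -(frame_contract (f := phi ^~ (e' i)) (e' i) ee (l1 _)).
rewrite exchange_big /=; apply: eq_bigr => k _.
rewrite -[RHS](frame_contract _ ee' (l2 _)).
by apply: eq_bigr => i _; rewrite gC.
Qed.

End LinearForms.

Section Frames.
Context {R : realType} {V : vectType R} (J : 'End(V)) (g : V -> V -> R).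
Hypothesis g_herm : hermitian_metric J g.
Hypothesis JJ : forall x, J (J x) = - x.

Lemma metricC x y : g x y = g y x. Proof. by case: g_herm. Qed.

Lemma metric_lin1 y : linform (g ^~ y).
Proof. by move=> a u v; case: g_herm => -[]. Qed.

Lemma metric_lin2 x : linform (g x).
Proof. by move=> a u v; case: g_herm => -[]. Qed.

Lemma metricDl x y z : g (x + y) z = g x z + g y z.
Proof. exact: (linformD _ _ (metric_lin1 z)). Qed.
Lemma metricDr x y z : g z (x + y) = g z x + g z y.
Proof. exact: (linformD _ _ (metric_lin2 z)). Qed.
Lemma metricNl x y : g (- x) y = - g x y.
Proof. exact: (linformN _ (metric_lin1 y)). Qed.
Lemma metricNr x y : g x (- y) = - g x y.
Proof. exact: (linformN _ (metric_lin2 x)). Qed.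
Lemma metricZl a x y : g (a *: x) y = a * g x y.
Proof. exact: (linformZ _ _ (metric_lin1 y)). Qed.
Lemma metricZr a x y : g x (a *: y) = a * g x y.
Proof. exact: (linformZ _ _ (metric_lin2 x)). Qed.
Lemma metricJJ x y : g (J x) (J y) = g x y. Proof. by case: g_herm. Qed.

Lemma metric_J x y : g (J x) y = - g x (J y).
Proof. by rewrite -[LHS]metricJJ JJ metricNl. Qed.

Lemma metric_ext x y : (forall z, g x z = g y z) -> x = y.
Proof.
move=> xy; apply/eqP; rewrite -subr_eq0; apply: contraT.
case: g_herm => _ _ pos _ /pos.
by rewrite {1}metricDl metricNl xy subrr ltxx.
Qed.

Lemma orthonormal_frameJ n (e : 'I_n -> V) :
  orthonormal_frame g e -> orthonormal_frame g (fun i => J (e i)).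
Proof.
move=> [ort x]; split=> [i j|v]; first by rewrite metricJJ.
have /(congr1 J) := x (J v); rewrite JJ linear_sum => /(congr1 -%R).
rewrite opprK -sumrN => {1}->.
by apply: eq_bigr => i _; rewrite linearZ /= metric_J scaleNr opprK.
Qed.

(** Used to move [J] from one factor of a contraction to the other. *)
Lemma frame_traceJ n (e : 'I_n -> V) (phi : V -> V -> R) :
  orthonormal_frame g e ->
  (forall y, linform (phi ^~ y)) -> (forall x, linform (phi x)) ->
  \sum_i phi (J (e i)) (J (e i)) = \sum_i phi (e i) (e i).
Proof.
move=> ee l1 l2.
exact: (frame_trace metricC ee (orthonormal_frameJ ee) l1 l2).
Qed.

End Frames.

(** * The generalised torsion and the velocity of the flow *)

Section BilinearOp.
Context {R : realType} {V : vectType R} (N : V -> V -> V).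
Hypothesis N_bil : bilinear_op N.

Lemma opDl x y z : N (x + y) z = N x z + N y z.
Proof. by case: N_bil => N1 _; rewrite -[x]scale1r N1 !scale1r. Qed.
Lemma opDr x y z : N z (x + y) = N z x + N z y.
Proof. by case: N_bil => _ N2; rewrite -[x]scale1r N2 !scale1r. Qed.
Lemma op0l x : N 0 x = 0.
Proof. by apply: (addrI (N 0 x)); rewrite -opDl !addr0. Qed.
Lemma op0r x : N x 0 = 0.
Proof. by apply: (addrI (N x 0)); rewrite -opDr !addr0. Qed.
Lemma opZl a x y : N (a *: x) y = a *: N x y.
Proof. by case: N_bil => N1 _; rewrite -[a *: x]addr0 N1 op0l addr0. Qed.
Lemma opZr a x y : N x (a *: y) = a *: N x y.
Proof. by case: N_bil => _ N2; rewrite -[a *: y]addr0 N2 op0r addr0. Qed.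
Lemma opNl x y : N (- x) y = - N x y.
Proof. by rewrite -scaleN1r opZl scaleN1r. Qed.
Lemma opNr x y : N x (- y) = - N x y.
Proof. by rewrite -scaleN1r opZr scaleN1r. Qed.

End BilinearOp.

Section LieBracket.
Context {R : realType} {V : vectType R}.

Definition lie_bracket (br : V -> V -> V) :=
  [/\ bilinear_op br, forall x y, br x y = - br y x &
      forall x y z, br (br x y) z + br (br y z) x + br (br z x) y = 0].

Context (br : V -> V -> V) (br_lie : lie_bracket br).

Lemma brC x y : br x y = - br y x. Proof. by case: br_lie. Qed.
Lemma br_lin1 a x y z : br (a *: x + y) z = a *: br x z + br y z.
Proof. by case: br_lie => -[]. Qed.
Lemma br_lin2 a x y z : br z (a *: x + y) = a *: br z x + br z y.
Proof. by case: br_lie => -[]. Qed.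
Let br_bil : bilinear_op br. Proof. by case: br_lie. Qed.

Lemma brDl x y z : br (x + y) z = br x z + br y z.
Proof. exact: opDl. Qed.
Lemma brDr x y z : br z (x + y) = br z x + br z y.
Proof. exact: opDr. Qed.
Lemma br0l x : br 0 x = 0. Proof. exact: op0l. Qed.
Lemma br0r x : br x 0 = 0. Proof. exact: op0r. Qed.
Lemma brZl a x y : br (a *: x) y = a *: br x y. Proof. exact: opZl. Qed.
Lemma brZr a x y : br x (a *: y) = a *: br x y. Proof. exact: opZr. Qed.
Lemma brNl x y : br (- x) y = - br x y. Proof. exact: opNl. Qed.
Lemma brNr x y : br x (- y) = - br x y. Proof. exact: opNr. Qed.

End LieBracket.

Section Torsion.
Context {R : realType} {V : vectType R} (br : V -> V -> V) (J : 'End(V)).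
Context (g : V -> V -> R).

(* H is - d^c omega, written out with g(Jx, Jy) = g(x, y). *)
Definition tors3 (x y z : V) : R :=
  - (g (br (J x) (J y)) z + g (br (J y) (J z)) x + g (br (J z) (J x)) y).

(* The structure constants of the Dorfman bracket twisted by H on V + V^*, in
   the eigenspaces V_+ and V_- of the generalised metric: the sign s_i tells
   to which eigenspace the i-th argument belongs. *)
Definition gtors (s1 s2 s3 : R) (x y z : V) : R :=
  2^-1 * (s3 * g (br x y) z + s2 * g (br z x) y + s1 * g (br y z) x
          + tors3 x y z).

Context {n : nat} (e : 'I_n -> V).

Definition ricci_trace (z : V) : R :=
  2^-1 * \sum_i gtors 1 1 (-1) (e i) (J (e i)) z.

(* This is - S + Q for an SKT metric (velocity_comp): ricci_trace (z) is half
   the trace of - J B_z for the Bismut connection B, and the velocity is the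
   (1,1)-part of the Bismut Ricci form, read as a symmetric tensor. *)
Definition velocity (x y : V) : R :=
  - 2^-1 * (ricci_trace (br x (J y)) + ricci_trace (br y (J x))).

(** By [gradient_sum], [functional] changes along an array [Phi] at 6 times the pairing of [Phi]
    with this one. The first argument lies in V_-, the second in V_+; of the contracted indices one
    runs through V_+ and one through V_-. *)
Definition gradient (x y : V) : R :=
  \sum_j \sum_k gtors (-1) 1 (-1) x (e j) (e k) * gtors 1 1 (-1) y (e j) (e k).

(* The velocity is the symmetrised gradient minus half of the Lie derivative
   of g along this vector (velocity_gradient). *)
Definition gauge_field : V := 2^-1 *: J (\sum_i br (e i) (J (e i))).

End Torsion.

Section GeneralisedGeometry.
Context {R : realType} {V : vectType R} (br : V -> V -> V) (J : 'End(V)).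
Context (g : V -> V -> R).
Hypothesis br_lie : lie_bracket br.
Hypothesis J_cplx : complex_structure br J.
Hypothesis g_herm : hermitian_metric J g.

Local Notation C x y z := (g (br x y) z).
Local Notation H := (tors3 br J g).
Local Notation F := (gtors br J g).

Lemma JJ x : J (J x) = - x. Proof. by case: J_cplx. Qed.

Let gDl := metricDl g_herm.
Let gDr := metricDr g_herm.
Let gNl := metricNl g_herm.
Let gNr := metricNr g_herm.
Let gZl := metricZl g_herm.
Let gZr := metricZr g_herm.
Let bDl := brDl br_lie.
Let bDr := brDr br_lie.
Let bNl := brNl br_lie.
Let bNr := brNr br_lie.
Let bZl := brZl br_lie.
Let bZr := brZr br_lie.
Let JD x y : J (x + y) = J x + J y. Proof. exact: linearD. Qed.
Let JN x : J (- x) = - J x. Proof. exact: linearN. Qed.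
Let JZ a x : J (a *: x) = a *: J x. Proof. exact: linearZ. Qed.
Definition linE := (JD, JN, JZ, bDl, bDr, bNl, bNr, bZl, bZr,
  gDl, gDr, gNl, gNr, gZl, gZr).

Lemma nijenhuis x y : br (J x) (J y) = br x y + J (br (J x) y) + J (br x (J y)).
Proof.
case: J_cplx => _ /(_ x y) /eqP; rewrite subr_eq0 => /eqP {1}<-.
by rewrite addrAC !subrK.
Qed.

Lemma bracketC x y z : C x y z = - C y x z.
Proof. by rewrite (brC br_lie) gNl. Qed.

Lemma jacobiC x y z w : C (br z x) y w = - C (br x y) z w - C (br y z) x w.
Proof.
case: br_lie => _ _ /(_ x y z) /(congr1 (g ^~ w)).
by rewrite !gDl (linform0 (metric_lin1 g_herm w)) => h; lra.
Qed.

Lemma tors3_anti x y z : H x y z = - H y x z.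
Proof.
rewrite /tors3 (bracketC (J y) (J x)) (bracketC (J x) (J z)).
by rewrite (bracketC (J z) (J y)); ring.
Qed.

Lemma tors3_cyc x y z : H x y z = H y z x.
Proof. by rewrite /tors3; ring. Qed.

Lemma gtors_anti s1 s2 s3 x y z : F s1 s2 s3 x y z = - F s2 s1 s3 y x z.
Proof.
rewrite /gtors (bracketC y x) (bracketC z y) (bracketC x z) (tors3_anti y).
by ring.
Qed.

Lemma gtors_cyc s1 s2 s3 x y z : F s1 s2 s3 x y z = F s2 s3 s1 y z x.
Proof. by rewrite /gtors tors3_cyc; ring. Qed.

Lemma tors3_lin3 x y : linform (H x y).
Proof. by move=> a u v; rewrite /tors3 !linE /=; ring. Qed.

Lemma gtors_lin3 s1 s2 s3 x y : linform (F s1 s2 s3 x y).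
Proof. by move=> a u v; rewrite /gtors tors3_lin3 !linE; ring. Qed.

Lemma gtors_lin2 s1 s2 s3 x z : linform (fun y => F s1 s2 s3 x y z).
Proof.
by move=> a u v /=; rewrite !(gtors_cyc s1 s2 s3 x _ z) !(gtors_cyc s2 s3 s1 _ z x);
  exact: gtors_lin3.
Qed.

Lemma gtors_lin1 s1 s2 s3 y z : linform (fun x => F s1 s2 s3 x y z).
Proof. by move=> a u v /=; rewrite !(gtors_cyc s1 s2 s3 _ y z); exact: gtors_lin3. Qed.


(* The Bismut connection g(B_x y, z) = F(-,+,+; x, y, z) preserves J. *)
Lemma bismut_JJ x y z : F (-1) 1 1 x (J y) (J z) = F (-1) 1 1 x y z.
Proof.
rewrite /gtors /tors3 !JJ !linE.
rewrite (nijenhuis x y) (nijenhuis y z) (nijenhuis z x) !linE.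
rewrite !(metric_J g_herm JJ) ?JJ ?linE.
rewrite ?(bracketC (J z) x) ?(bracketC z (J x)) ?(bracketC z x).
rewrite ?(bracketC (J y) x) ?(bracketC (J z) y).
ring.
Qed.

End GeneralisedGeometry.

(** * Consequences of the Jacobi identity of the Dorfman bracket *)

Section QuadraticIdentities.
Context {R : realType} {V : vectType R} (br : V -> V -> V) (J : 'End(V)).
Context (g : V -> V -> R) (n : nat) (e : 'I_n -> V).
Hypothesis br_lie : lie_bracket br.
Hypothesis J_cplx : complex_structure br J.
Hypothesis g_herm : hermitian_metric J g.
Hypothesis e_orth : orthonormal_frame g e.

Local Notation C x y z := (g (br x y) z).
Local Notation H := (tors3 br J g).
Local Notation F := (gtors br J g).
Local Notation eta := (ricci_trace br J g e).
Local Notation G := (gradient br J g e).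
Local Notation X := (gauge_field br J e).

Let linE := (linE br_lie g_herm).
Let JJ := (JJ J_cplx).
Let bC := (bracketC br_lie g_herm).
Let Fanti := (gtors_anti br_lie g_herm).
Let Fcyc := (gtors_cyc br J g).
Let F1 := (gtors_lin1 br_lie g_herm).
Let F2 := (gtors_lin2 br_lie g_herm).
Let F3 := (gtors_lin3 br_lie g_herm).

Let U s t x y z := t * C z x y + s * C y z x + H x y z.

Let U_lin s t x y : linform (U s t x y).
Proof.
by move=> a u v; rewrite /U (tors3_lin3 br_lie g_herm) !linE; ring.
Qed.

Let contract (sa sb sc sd : R) (a b c d : V) :=
  \sum_k (F sa sb 1 a b (e k) * F sc sd 1 c d (e k)
        - F sa sb (-1) a b (e k) * F sc sd (-1) c d (e k)).

(** The minus sign in [contract] is there because the pairing is negative on V_-. Each [F] is half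
    of [U] plus or minus the bracket term of the summed slot, so in the difference only the products
    of a bracket term with a [U] survive; summing over [k] puts the brackets into [U]. *)
Let contractE sa sb sc sd a b c d : contract sa sb sc sd a b c d =
  2^-1 * (U sc sd c d (br a b) + U sa sb a b (br c d)).
Proof.
rewrite -(frame_contract (br a b) e_orth (U_lin sc sd c d)).
rewrite -(frame_contract (br c d) e_orth (U_lin sa sb a b)).
rewrite -big_split mulr_sumr; apply: eq_bigr => k _.
by rewrite /gtors /U /=; field.
Qed.

Lemma ext_d3_tors3 x y z w : ext_d3 br H x y z w =
  - ext_d3 br (ext_dc2 br J (fundamental_form J g)) x y z w.
Proof.
have E a b c : ext_dc2 br J (fundamental_form J g) a b c = - H a b c.
  rewrite /ext_dc2 /ext_d2 /fundamental_form /tors3 !JJ !linE !JJ !linE.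
  by rewrite (bC (J c) (J a)); ring.
by rewrite /ext_d3 !E; ring.
Qed.

Hypothesis g_SKT : SKT br J g.

Lemma tors3_closed x y z w : ext_d3 br H x y z w = 0.
Proof. by rewrite ext_d3_tors3 (g_SKT x y z w) oppr0. Qed.

(* The Jacobi identity of the Dorfman bracket: s_i is the sign of x_i, and k
   runs through V_+ and V_-. *)
Lemma gtors_jacobi (s1 s2 s3 s4 : R) x1 x2 x3 x4 :
  contract s1 s2 s3 s4 x1 x2 x3 x4 + contract s2 s3 s1 s4 x2 x3 x1 x4 +
  contract s3 s1 s2 s4 x3 x1 x2 x4 = 0.
Proof.
rewrite !contractE /U !(bC _ (br _ _)).
(* Closedness of H, solved for one of its six terms, removes H from the identity; what remains is
   the Jacobi identity of [br]. *)
have D : H x3 x4 (br x1 x2) = - H x1 x4 (br x2 x3) - H x2 x4 (br x3 x1)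
    - H x2 x3 (br x1 x4) - H x3 x1 (br x2 x4) - H x1 x2 (br x3 x4).
  have := tors3_closed x1 x2 x3 x4.
  rewrite /ext_d3 !(tors3_cyc br J g (br _ _)) (brC br_lie x1 x3).
  rewrite (linformN _ (tors3_lin3 br_lie g_herm _ _)).
  rewrite (tors3_anti br_lie g_herm x1 x3) => h; lra.
have J4 := jacobiC br_lie g_herm.
have A x y z w : g (br (br x y) z) w = - g (br (br y x) z) w.
  by rewrite (brC br_lie x y) !linE.
rewrite D (J4 x1 x2 x3 x4) (J4 x2 x4 x1 x3) (J4 x4 x3 x1 x2) (J4 x4 x2 x3 x1).
rewrite (A x4 x1) (A x4 x2) (A x4 x3).
ring.
Qed.

Let FJJ := (bismut_JJ br_lie J_cplx g_herm).

Let F_skew s x y z : F s 1 1 x y z = - F s 1 1 x z y.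
Proof. by rewrite Fcyc Fanti -[in RHS]Fcyc Fcyc. Qed.


(* Sum gtors_jacobi over x1 = e_i, x2 = J e_i in V_+, with x in V_- and J y in
   V_+. *)
Lemma gauge_identity x y :
  - eta (br x (J y)) = G x y - F (-1) 1 1 x y X.
Proof.
have T1 : \sum_i contract 1 1 (-1) 1 (e i) (J (e i)) x (J y) =
    2 * eta (br x (J y)) - 2 * F (-1) 1 1 x y X.
  have JX : J X = - (2^-1 *: \sum_i br (e i) (J (e i))).
    by rewrite /gauge_field linearZ /= JJ scalerN.
  rewrite -(FJJ x y) JX (linformN _ (F3 _ _ _ _ _)).
  rewrite (linformZ _ _ (F3 _ _ _ _ _)) (linform_sum _ _ _ (F3 _ _ _ _ _)).
  have rearr (a b : R) : 2 * (2^-1 * a) - 2 * - (2^-1 * b) = a + b by field.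
  rewrite /ricci_trace rearr -big_split; apply: eq_bigr => i _ /=.
  by rewrite contractE /gtors /U (metricC g_herm (br x (J y)) (br _ _)); field.
(* Replacing [e i] by [J (e i)] exchanges the last two of the three Jacobi terms, so they have the
   same trace. *)
have T3 : \sum_i contract (-1) 1 1 1 x (e i) (J (e i)) (J y) =
    \sum_i contract 1 (-1) 1 1 (J (e i)) x (e i) (J y).
  rewrite -(frame_traceJ g_herm JJ (phi := fun a b =>
    contract (-1) 1 1 1 x a (J b) (J y)) e_orth); last 2 first.
  - move=> b a u v; rewrite /contract mulr_sumr -big_split.
    by apply: eq_bigr => k _; rewrite !(F2 _ _ _ _ _ a) /=; ring.
  - move=> a b u v; rewrite /contract mulr_sumr -big_split linearP.
    by apply: eq_bigr => k _; rewrite !(F1 _ _ _ _ _ b) /=; ring.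
  apply: eq_bigr => i _; apply: eq_bigr => k _.
  rewrite JJ !(linformN _ (F1 _ _ _ _ _)).
  by rewrite (Fanti 1 (-1) 1) (Fanti 1 (-1) (-1)); ring.
(* The Bismut connection commutes with [J], so the first factor is symmetric in [i] and [k], while
   the second is skew. *)
have S1 : \sum_i \sum_k F (-1) 1 1 x (J (e i)) (e k) *
    F 1 1 1 (e i) (J y) (e k) = 0.
  suff : forall a : R, a = - a -> a = 0 by apply; rewrite {1}exchange_big -sumrN /=;
    apply: eq_bigr => i _; rewrite -sumrN; apply: eq_bigr => k _;
    rewrite -(FJJ x (J (e k))) JJ (linformN _ (F2 _ _ _ _ _)) (F_skew (-1) x (e k))
      opprK (Fcyc 1 1 1 (e k)) (Fanti 1 1 1 (J y)) mulrN.
  by move=> a ?; lra.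
have S2 : \sum_i \sum_k F (-1) 1 (-1) x (J (e i)) (e k) *
    F 1 1 (-1) (e i) (J y) (e k) = G x y.
  rewrite -(frame_traceJ g_herm JJ (phi := fun a b =>
    \sum_k F (-1) 1 (-1) x (J a) (e k) * F 1 1 (-1) b (J y) (e k)) e_orth); last 2 first.
  - move=> b a u v; rewrite mulr_sumr -big_split linearP.
    by apply: eq_bigr => k _; rewrite F2 /=; ring.
  - move=> a b u v; rewrite mulr_sumr -big_split.
    by apply: eq_bigr => k _; rewrite F1 /=; ring.
  apply: eq_bigr => i _; apply: eq_bigr => k _.
  rewrite JJ (linformN _ (F2 _ _ _ _ _)) -(Fcyc (-1) 1 1) FJJ (Fcyc (-1) 1 1 (e k)) (Fanti 1 1 (-1) y).
  by rewrite mulrN mulNr.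
have : \sum_i (contract 1 1 (-1) 1 (e i) (J (e i)) x (J y) +
  contract 1 (-1) 1 1 (J (e i)) x (e i) (J y) +
  contract (-1) 1 1 1 x (e i) (J (e i)) (J y)) = 0.
  by apply: big1 => i _; exact: gtors_jacobi.
rewrite !big_split /= T1 T3.
have -> : \sum_i contract 1 (-1) 1 1 (J (e i)) x (e i) (J y) = G x y.
  transitivity (\sum_i \sum_k F (-1) 1 (-1) x (J (e i)) (e k) *
      F 1 1 (-1) (e i) (J y) (e k) -
    \sum_i \sum_k F (-1) 1 1 x (J (e i)) (e k) * F 1 1 1 (e i) (J y) (e k));
    last by rewrite S1 S2 subr0.
  rewrite -sumrB; apply: eq_bigr => i _.
  rewrite -sumrB; apply: eq_bigr => k _.
  by rewrite (Fanti 1 (-1) 1) (Fanti 1 (-1) (-1)); ring.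
by move=> ?; lra.
Qed.

End QuadraticIdentities.

(** d d = 0 on left-invariant 2-forms, which amounts to the Jacobi identity. *)
Lemma ext_d3_ext_d2 (R : realType) (V : vectType R) (br : V -> V -> V)
    (b : V -> V -> R) x y z w : lie_bracket br ->
  (forall v, linform (b ^~ v)) -> (forall u v, b u v = - b v u) ->
  ext_d3 br (ext_d2 br b) x y z w = 0.
Proof.
move=> bl b1 bC; rewrite /ext_d3 /ext_d2.
have jac u v w' c : b (br (br u w') v) c =
    b (br (br u v) w') c + b (br (br v w') u) c.
  case: (bl) => _ _ /(_ u v w') /(congr1 (b ^~ c)).
  rewrite (brC bl w' u) (brNl bl) !(linformD _ _ (b1 _)).
  by rewrite (linformN _ (b1 _)) (linform0 (b1 _)) => h; lra.
rewrite (jac x y z w) (jac x y w z) (jac x z w y) (jac y z w x).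
rewrite (bC (br z w)) (bC (br y w)) (bC (br y z)).
ring.
Qed.

(** * Symmetries of the velocity and its effect on H *)

Section Velocity.
Context {R : realType} {V : vectType R} (br : V -> V -> V) (J : 'End(V)).
Context (g : V -> V -> R) (n : nat) (e : 'I_n -> V).
Hypothesis br_lie : lie_bracket br.
Hypothesis J_cplx : complex_structure br J.
Hypothesis g_bil : bilinear_form g.

Local Notation eta := (ricci_trace br J g e).
Local Notation P := (velocity br J g e).

Let g1 z : linform (g ^~ z). Proof. by move=> a u v; case: g_bil. Qed.
Let g2 z : linform (g z). Proof. by move=> a u v; case: g_bil. Qed.
Let gDl x y z : g (x + y) z = g x z + g y z.
Proof. exact: (linformD _ _ (g1 z)). Qed.
Let gDr x y z : g z (x + y) = g z x + g z y.
Proof. exact: (linformD _ _ (g2 z)). Qed.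
Let gNl x y : g (- x) y = - g x y. Proof. exact: (linformN _ (g1 y)). Qed.
Let gNr x y : g x (- y) = - g x y. Proof. exact: (linformN _ (g2 x)). Qed.
Let gZl a x y : g (a *: x) y = a * g x y. Proof. exact: (linformZ _ _ (g1 y)). Qed.
Let gZr a x y : g x (a *: y) = a * g x y. Proof. exact: (linformZ _ _ (g2 x)). Qed.
Let JD x y : J (x + y) = J x + J y. Proof. exact: linearD. Qed.
Let JN x : J (- x) = - J x. Proof. exact: linearN. Qed.
Let JZ a x : J (a *: x) = a *: J x. Proof. exact: linearZ. Qed.
Let linE := (JD, JN, JZ, brDl br_lie, brDr br_lie, brNl br_lie, brNr br_lie,
  brZl br_lie, brZr br_lie, gDl, gDr, gNl, gNr, gZl, gZr).
Let JJ := (JJ J_cplx).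

Lemma ricci_trace_lin : linform eta.
Proof.
move=> a u v; rewrite /ricci_trace.
have lin3 x y : linform (gtors br J g 1 1 (-1) x y).
  by move=> b w z; rewrite /gtors /tors3 !linE; ring.
under eq_bigr do rewrite lin3.
by rewrite big_split -mulr_sumr /=; ring.
Qed.

Lemma velocityC x y : P x y = P y x.
Proof. by rewrite /velocity addrC. Qed.

Lemma velocity_lin1 y : linform (P ^~ y).
Proof.
move=> a u v; rewrite /velocity !linE !(linformD _ _ ricci_trace_lin).
by rewrite !(linformZ _ _ ricci_trace_lin); ring.
Qed.

Lemma velocity_lin2 x : linform (P x).
Proof. by move=> a u v; rewrite !(velocityC x) velocity_lin1. Qed.

(** Available for any bilinear [g], hence before [g] is known to be J-orthogonal; this is what keeps
    the metric J-orthogonal along the frame equation. *)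
Lemma velocityJJ x y : P (J x) (J y) = P x y.
Proof.
rewrite /velocity !JJ !linE !(linformN _ ricci_trace_lin).
by rewrite (brC br_lie (J x)) (brC br_lie (J y)) !(linformN _ ricci_trace_lin); ring.
Qed.

(** The skew part of [eta (br x (J y))], whose symmetric part is minus the velocity. Equivalently,
    the part of type (2,0) + (0,2) of the closed 2-form [eta (br x y)], with [J] inserted in the
    second argument. *)
Definition ricci_potential (x y : V) : R :=
  2^-1 * (eta (br x (J y)) - eta (br y (J x))).

Lemma ricci_potential_lin1 y : linform (ricci_potential ^~ y).
Proof.
move=> a u v; rewrite /ricci_potential !linE !(linformD _ _ ricci_trace_lin).
by rewrite !(linformZ _ _ ricci_trace_lin); ring.
Qed.

Lemma ricci_potentialC x y : ricci_potential x y = - ricci_potential y x.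
Proof. by rewrite /ricci_potential; ring. Qed.

(** [tors3] is linear in the metric, so the left side is the velocity of H. Since the 2-form
    [eta (br x y)] is closed, d^c of its (1,1)-part can be traded for d of the remaining part,
    rotated by [J]. Hence H moves by an exact form. *)
Lemma tors3_velocity x y z :
  tors3 br J P x y z = ext_d2 br ricci_potential x y z.
Proof.
have jac u v w :
    eta (br (br w u) v) = - eta (br (br u v) w) - eta (br (br v w) u).
  case: br_lie => _ _ /(_ u v w) /(congr1 eta).
  rewrite !(linformD _ _ ricci_trace_lin) (linform0 ricci_trace_lin) => h; lra.
have JbrJ u v : J (br (J u) (J v)) = J (br u v) - br (J u) v - br u (J v).
  by rewrite (nijenhuis J_cplx) !linE !JJ.
have eC u v : eta (br u v) = - eta (br v u).
  by rewrite (brC br_lie) (linformN _ ricci_trace_lin).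
have eD u v := linformD u v ricci_trace_lin.
have eN u := linformN u ricci_trace_lin.
have bxz : br x z = - br z x by exact: brC.
rewrite /tors3 /velocity /ext_d2 /ricci_potential !JbrJ bxz !linE !(eD, eN).
rewrite !(eC z) !(eC y) !(eC x).
rewrite (jac (J x) (J y) (J z)) (jac (J x) y z) (jac x (J y) z) (jac x y (J z)).
ring.
Qed.

Hypothesis g_herm : hermitian_metric J g.
Hypothesis e_orth : orthonormal_frame g e.
Hypothesis g_SKT : SKT br J g.

Local Notation G := (gradient br J g e).
Local Notation X := (gauge_field br J e).

(** On symmetrising [gauge_identity], the terms of [F (-1) 1 1 x y X] that are skew in [x] and [y]
    drop out, and the other two form the Lie derivative. *)
Lemma velocity_gradient x y : P x y =
  2^-1 * (G x y + G y x) - 2^-1 * (g (br X x) y + g (br X y) x).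
Proof.
have h := gauge_identity br_lie J_cplx g_herm e_orth g_SKT.
have := h x y; have := h y x; rewrite /velocity /gtors.
rewrite (tors3_anti br_lie g_herm y x) (bracketC br_lie g_herm y x).
rewrite (bracketC br_lie g_herm y X) (bracketC br_lie g_herm x X).
by move=> *; lra.
Qed.

End Velocity.

(** * Monotonicity of the functional *)

Section Arrays.
Context {R : realType} {n : nat}.
Implicit Types f h : 'I_n -> 'I_n -> 'I_n -> 'I_n -> R.

Definition sum4 f : R := \sum_i \sum_j \sum_k \sum_s f i j k s.

Lemma sum4_ext f h : (forall i j k s, f i j k s = h i j k s) -> sum4 f = sum4 h.
Proof.
move=> fh; apply: eq_bigr => i _; apply: eq_bigr => j _.
by apply: eq_bigr => k _; apply: eq_bigr => s _.
Qed.

Lemma sum4D f h : sum4 (fun i j k s => f i j k s + h i j k s) = sum4 f + sum4 h.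
Proof.
rewrite /sum4 -big_split; apply: eq_bigr => i _ /=.
rewrite -big_split; apply: eq_bigr => j _ /=.
by rewrite -big_split; apply: eq_bigr => k _ /=; rewrite -big_split.
Qed.

Lemma sum4Z a f : sum4 (fun i j k s => a * f i j k s) = a * sum4 f.
Proof.
rewrite /sum4 mulr_sumr; apply: eq_bigr => i _ /=.
rewrite mulr_sumr; apply: eq_bigr => j _ /=.
by rewrite mulr_sumr; apply: eq_bigr => k _ /=; rewrite mulr_sumr.
Qed.

Lemma sum4_swap12 f : sum4 f = sum4 (fun i j k s => f j i k s).
Proof. exact: exchange_big. Qed.

Lemma sum4_swap23 f : sum4 f = sum4 (fun i j k s => f i k j s).
Proof. by apply: eq_bigr => i _; exact: exchange_big. Qed.

Lemma sum4_swap34 f : sum4 f = sum4 (fun i j k s => f i j s k).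
Proof. by apply: eq_bigr => i _; apply: eq_bigr => j _; exact: exchange_big. Qed.

Lemma sum4_cyc f : sum4 f = sum4 (fun i j k s => f j k i s).
Proof. by rewrite sum4_swap23 sum4_swap12. Qed.

Lemma sum4_swap24 f : sum4 f = sum4 (fun i j k s => f i s k j).
Proof. by rewrite sum4_swap34 sum4_swap23 sum4_swap34. Qed.

Lemma sum4_swap14 f : sum4 f = sum4 (fun i j k s => f s j k i).
Proof. by rewrite sum4_swap12 sum4_swap24 sum4_swap12. Qed.

Lemma sum4_anti34 f : (forall i j k s, f i j k s = - f i j s k) -> sum4 f = 0.
Proof.
move=> fA; have : sum4 f = - sum4 f; last by move=> h; lra.
rewrite {1}sum4_swap34 -[RHS]mulN1r -sum4Z; apply: sum4_ext => i j k s.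
by rewrite mulN1r fA.
Qed.

Lemma sum4_anti24 f : (forall i j k s, f i j k s = - f i s k j) -> sum4 f = 0.
Proof.
by move=> fA; rewrite sum4_swap23; apply: sum4_anti34 => i j k s; exact: fA.
Qed.

Lemma sum4_mulr f (u : 'I_n -> 'I_n -> 'I_n -> R) :
  \sum_i \sum_j \sum_k u i j k * (\sum_s f i j k s) =
  sum4 (fun i j k s => u i j k * f i j k s).
Proof.
apply: eq_bigr => i _; apply: eq_bigr => j _; apply: eq_bigr => k _.
by rewrite mulr_sumr.
Qed.

(* p, m, K are gtors with signs (+,+,+), (+,+,-), (-,+,-) in a frame, B is
   gtors with signs (-,+,+) and last argument X; I and II are cases of
   gtors_jacobi with X among the arguments. *)
Lemma gauge_orthogonal (p m K : 'I_n -> 'I_n -> 'I_n -> R)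
    (a c B : 'I_n -> 'I_n -> R) :
  (forall i j k, p i j k = p j k i) -> (forall i j k, p i j k = - p j i k) ->
  (forall i j k, m i j k = - m j i k) ->
  (forall i j, a i j = - a j i) -> (forall i j, c i j = - c j i) ->
  (forall i j k, \sum_s (p i j s * B k s - m i j s * c k s - a j s * m i s k
     - B s j * K s i k + a i s * m j s k + B s i * K s j k) = 0) ->
  (forall i j k, \sum_s (p i j s * a k s - m i j s * B s k
     + (p j k s * a i s - m j k s * B s i)
     + (p k i s * a j s - m k i s * B s j)) = 0) ->
  \sum_s \sum_i B s i * (\sum_j \sum_k K s j k * m i j k) = 0.
Proof.
move=> pcyc pA mA aA cA I II.
have zero (u : 'I_n -> 'I_n -> 'I_n -> R) f :
    (forall i j k, \sum_s f i j k s = 0) ->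
    sum4 (fun i j k s => u i j k * f i j k s) = 0.
  move=> f0; rewrite -sum4_mulr; apply: big1 => i _; apply: big1 => j _.
  by apply: big1 => k _; rewrite f0 mulr0.
pose T := sum4 (fun i j k s => B s i * K s j k * m i j k).
have -> : \sum_s \sum_i B s i * (\sum_j \sum_k K s j k * m i j k) = T.
  rewrite /T (sum4_swap34 (fun i j k s => _)) sum4_swap23 sum4_swap12.
  apply: eq_bigr => s _; apply: eq_bigr => i _; rewrite mulr_sumr.
  by apply: eq_bigr => j _; rewrite mulr_sumr; apply: eq_bigr => k _; rewrite mulrA.
have e1 := zero m _ I; have e2 := zero p _ II.
have h2 : sum4 (fun i j k s => p i j k * m i j s * B s k) = 0.
  have A0 : sum4 (fun i j k s => p i j k * p i j s * a k s) = 0.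
    by apply: sum4_anti34 => i j k s; rewrite (aA s k); ring.
  have E f : sum4 (fun i j k s => f i j k s + f j k i s + f k i j s) = 3 * sum4 f.
    have c1 : sum4 (fun i j k s => f j k i s) = sum4 f by rewrite -sum4_cyc.
    have c2 : sum4 (fun i j k s => f k i j s) = sum4 f.
      by rewrite (sum4_cyc (fun i j k s => f k i j s)).
    by rewrite !sum4D c1 c2; ring.
  have : sum4 (fun i j k s => p i j k * p i j s * a k s) +
      -1 * sum4 (fun i j k s => p i j k * m i j s * B s k) = 0.
    apply: (mulfI (x := 3)); first by rewrite pnatr_eq0.
    rewrite mulr0 -sum4Z -sum4D -E -[RHS]e2; apply: sum4_ext => i j k s.
    by rewrite -(pcyc i j k) (pcyc k i j); ring.
  by rewrite A0 => ?; lra.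
have h1 : sum4 (fun i j k s => p i j s * B k s * m i j k) = 0.
  by rewrite -[RHS]h2 sum4_swap34; apply: sum4_ext => i j k s; ring.
have h3 : sum4 (fun i j k s => m i j k * m i j s * c k s) = 0.
  by apply: sum4_anti34 => i j k s; rewrite (cA s k); ring.
have h4 : sum4 (fun i j k s => m i j k * (a j s * m i s k)) = 0.
  by apply: sum4_anti24 => i j k s; rewrite (aA s j); ring.
have h5 : sum4 (fun i j k s => m i j k * (a i s * m j s k)) = 0.
  rewrite -[RHS]oppr0 -h4 -mulN1r -sum4Z sum4_swap12.
  by apply: sum4_ext => i j k s; rewrite (mA j i); ring.
have h6 : sum4 (fun i j k s => m i j k * (B s j * K s i k)) = - T.
  rewrite -mulN1r -sum4Z sum4_swap12.
  by apply: sum4_ext => i j k s; rewrite (mA j i); ring.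
have : sum4 (fun i j k s => p i j s * B k s * m i j k) +
  (-1 * sum4 (fun i j k s => m i j k * m i j s * c k s) +
  (-1 * sum4 (fun i j k s => m i j k * (a j s * m i s k)) +
  (-1 * sum4 (fun i j k s => m i j k * (B s j * K s i k)) +
  (sum4 (fun i j k s => m i j k * (a i s * m j s k)) + T)))) = 0.
  rewrite -!sum4Z -!sum4D -[RHS]e1; apply: sum4_ext => i j k s; ring.
by rewrite h1 h3 h4 h5 h6 => ?; lra.
Qed.

Definition gtors_array (C H : 'I_n -> 'I_n -> 'I_n -> R) (s1 s2 s3 : R) i j k : R :=
  2^-1 * (s3 * C i j k + s2 * C k i j + s1 * C j k i + H i j k).

(* C' and H' are the derivatives of C and H in a frame with
   e_i' = - 1/2 P^# e_i, where P is the symmetric part of Phi and - b its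
   skew part, when H moves by db. *)
Lemma gradient_sum (C H Phi : _) (P b : 'I_n -> 'I_n -> R)
    (C' H' : 'I_n -> 'I_n -> 'I_n -> R) :
  (forall i j k, C i j k = - C j i k) ->
  (forall i j k, H i j k = H j k i) -> (forall i j k, H i j k = - H j i k) ->
  (forall i j, P i j = 2^-1 * (Phi i j + Phi j i)) ->
  (forall i j, b i j = 2^-1 * (Phi j i - Phi i j)) ->
  (forall i j k, C' i j k = \sum_s (- 2^-1 * (P i s * C s j k)
     - 2^-1 * (P j s * C i s k) + 2^-1 * (P k s * C i j s))) ->
  (forall i j k, H' i j k = \sum_s (- 2^-1 *
     (P i s * H s j k + P j s * H i s k + P k s * H i j s)
     - (C i j s * b s k + C j k s * b s i + C k i s * b s j))) ->
  \sum_i \sum_j \sum_k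
     (2 * (gtors_array C H 1 1 1 i j k * gtors_array C' H' 1 1 1 i j k) -
      6 * (gtors_array C H 1 1 (-1) i j k * gtors_array C' H' 1 1 (-1) i j k)) =
  6 * \sum_s \sum_j Phi s j * (\sum_i \sum_k
     gtors_array C H (-1) 1 (-1) s i k * gtors_array C H 1 1 (-1) j i k).
Proof.
move=> CA Hcyc HA PE bE C'E H'E.
pose p := gtors_array C H 1 1 1; pose m := gtors_array C H 1 1 (-1).
pose K := gtors_array C H (-1) 1 (-1).
have pcyc i j k : p i j k = p j k i by rewrite /p /gtors_array Hcyc; ring.
have mA i j k : m i j k = - m j i k.
  by rewrite /m /gtors_array (CA j i) (CA k j) (CA i k) HA; field.
have Hp x y z : (H y z x = H x y z) * (H z x y = H x y z) *
    (H y x z = - H x y z) * (H x z y = - H x y z) * (H z y x = - H x y z).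
  by rewrite -(Hcyc x y z) -(Hcyc z x y) (HA y x) (HA x z y) (HA z y x) -!(Hcyc x y z) -(Hcyc z x y).
(* [Phi - P] is skew and merely rotates the slots of [p]; the rest of [Phi] trades [p] for [m].
   Likewise [m] is traded for [p] and [K] below. *)
have p'E i j k : gtors_array C' H' 1 1 1 i j k = \sum_s (
    (2^-1 * (Phi s k - P k s) * p i j s - 2^-1 * (Phi s k * m i j s)) +
    (2^-1 * (Phi s i - P i s) * p j k s - 2^-1 * (Phi s i * m j k s)) +
    (2^-1 * (Phi s j - P j s) * p k i s - 2^-1 * (Phi s j * m k i s))).
  rewrite {1}/gtors_array !C'E H'E !mul1r -!big_split mulr_sumr /=.
  apply: eq_bigr => s _; rewrite /p /m /gtors_array !PE !bE.
  by rewrite (Hcyc s j k) -(Hcyc k i s); field.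
have m'E i j k : gtors_array C' H' 1 1 (-1) i j k = \sum_s (
    (2^-1 * (Phi k s - P k s) * m i j s - 2^-1 * (Phi k s * p i j s)) +
    (2^-1 * (Phi s j - P j s) * m i s k - 2^-1 * (Phi s j * K k i s)) -
    (2^-1 * (Phi s i - P i s) * m j s k - 2^-1 * (Phi s i * K k j s))).
  rewrite {1}/gtors_array !C'E H'E mulN1r !mul1r -sumrN -!big_split mulr_sumr /=.
  apply: eq_bigr => s _; rewrite /p /m /K /gtors_array !PE !bE.
  rewrite ?(Hp i j s) ?(Hp i k s) ?(Hp j k s) ?(CA j i) ?(CA k i) ?(CA k j).
  by rewrite ?(CA s i) ?(CA s j) ?(CA s k); field.
have E f : sum4 (fun i j k s => f i j k s + f j k i s + f k i j s) = 3 * sum4 f.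
  have c1 : sum4 (fun i j k s => f j k i s) = sum4 f by rewrite -sum4_cyc.
  have c2 : sum4 (fun i j k s => f k i j s) = sum4 f.
    by rewrite (sum4_cyc (fun i j k s => f k i j s)).
  by rewrite !sum4D c1 c2; ring.
have skew i j : Phi i j - P j i = - (Phi j i - P i j) by rewrite !PE; field.
(* The pairings that survive: the rotations drop out by skewness, [Q] couples [p] with [m], and [T]
   couples [m] with [K]. *)
pose Q := sum4 (fun i j k s => Phi s k * (p i j k * m i j s)).
pose T := sum4 (fun i j k s => Phi s j * (m i j k * K k i s)).
have pp : \sum_i \sum_j \sum_k p i j k * gtors_array C' H' 1 1 1 i j k =
    - (3 / 2) * Q.
  under eq_bigr => i _ do under eq_bigr => j _ do under eq_bigr => k _ do rewrite p'E.
  rewrite sum4_mulr.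
  have z : sum4 (fun i j k s => (Phi s k - P k s) * (p i j k * p i j s)) = 0.
    by apply: sum4_anti34 => i j k s; rewrite skew; ring.
  transitivity (3 * sum4 (fun i j k s =>
      2^-1 * ((Phi s k - P k s) * (p i j k * p i j s)) +
      - 2^-1 * (Phi s k * (p i j k * m i j s)))).
    rewrite -E; apply: sum4_ext => i j k s.
    by rewrite -(pcyc i j k) (pcyc k i j); ring.
  by rewrite sum4D !sum4Z z -/Q; field.
have mm : \sum_i \sum_j \sum_k m i j k * gtors_array C' H' 1 1 (-1) i j k =
    - 2^-1 * Q - T.
  under eq_bigr => i _ do under eq_bigr => j _ do under eq_bigr => k _ do rewrite m'E.
  rewrite sum4_mulr.
  have z1 : sum4 (fun i j k s => (Phi k s - P k s) * (m i j k * m i j s)) = 0.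
    by apply: sum4_anti34 => i j k s; rewrite !PE; field.
  have z2 : sum4 (fun i j k s => (Phi s j - P j s) * (m i j k * m i s k)) = 0.
    by apply: sum4_anti24 => i j k s; rewrite skew; ring.
  have z3 : sum4 (fun i j k s => (Phi s i - P i s) * (m i j k * m j s k)) = 0.
    rewrite -[RHS]oppr0 -z2 -mulN1r -sum4Z sum4_swap12.
    by apply: sum4_ext => i j k s; rewrite (mA j i); ring.
  have z4 : sum4 (fun i j k s => Phi k s * (m i j k * p i j s)) = Q.
    by rewrite /Q sum4_swap34; apply: sum4_ext => i j k s; ring.
  have z5 : sum4 (fun i j k s => Phi s i * (m i j k * K k j s)) = - T.
    rewrite -mulN1r -sum4Z sum4_swap12.
    by apply: sum4_ext => i j k s; rewrite (mA j i); ring.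
  transitivity (2^-1 * sum4 (fun i j k s => (Phi k s - P k s) * (m i j k * m i j s))
    + (- 2^-1 * sum4 (fun i j k s => Phi k s * (m i j k * p i j s))
    + (2^-1 * sum4 (fun i j k s => (Phi s j - P j s) * (m i j k * m i s k))
    + (- 2^-1 * T
    + (- 2^-1 * sum4 (fun i j k s => (Phi s i - P i s) * (m i j k * m j s k))
    + 2^-1 * sum4 (fun i j k s => Phi s i * (m i j k * K k j s))))))).
    by rewrite -!sum4Z -!sum4D; apply: sum4_ext => i j k s; ring.
  by rewrite z1 z2 z3 z4 z5; field.
have TE : T = \sum_s \sum_j Phi s j * (\sum_i \sum_k K s i k * m j i k).
  rewrite /T (sum4_swap34 (fun i j k s => _)) sum4_swap23 sum4_swap12.
  apply: eq_bigr => s _; rewrite [LHS]exchange_big; apply: eq_bigr => j _ /=.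
  rewrite mulr_sumr; apply: eq_bigr => i _; rewrite mulr_sumr.
  apply: eq_bigr => k _.
  have -> : K s i k = - K k i s.
    by rewrite /K /gtors_array (CA s i) (CA k s) (CA i k) ?(Hp k i s); field.
  by rewrite (mA j i); ring.
rewrite -TE.
transitivity (2 * (\sum_i \sum_j \sum_k p i j k * gtors_array C' H' 1 1 1 i j k) -
  6 * (\sum_i \sum_j \sum_k m i j k * gtors_array C' H' 1 1 (-1) i j k)).
  rewrite !mulr_sumr -sumrB; apply: eq_bigr => i _.
  rewrite !mulr_sumr -sumrB; apply: eq_bigr => j _.
  by rewrite !mulr_sumr -sumrB.
(* The total is - 3 Q + 3 Q + 6 T: the weight 3 of the [++-] part is the one that cancels [Q]. *)
by rewrite pp mm; field.
Qed.

End Arrays.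

Section Growth.
Context {R : realType} {V : vectType R} (br : V -> V -> V) (J : 'End(V)).
Context (g : V -> V -> R) (n : nat) (e : 'I_n -> V).
Hypothesis br_lie : lie_bracket br.
Hypothesis J_cplx : complex_structure br J.
Hypothesis g_herm : hermitian_metric J g.
Hypothesis e_orth : orthonormal_frame g e.
Hypothesis g_SKT : SKT br J g.

Local Notation F := (gtors br J g).
Local Notation G := (gradient br J g e).

Let linE := (linE br_lie g_herm).
Let Fanti := (gtors_anti br_lie g_herm).
Let Fcyc := (gtors_cyc br J g).

(** Gauge invariance of [functional]: bracketing with [X] in V_+ is a derivation of the Dorfman
    bracket, and the gradient is orthogonal to the motion of V_- against V_+ which this derivation
    induces. The two relations fed to [gauge_orthogonal] express the derivation on arguments of
    signs (+,+,-) and (+,+,+). *)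
Lemma gauge_trace X :
  \sum_s \sum_i F (-1) 1 1 (e s) (e i) X * G (e s) (e i) = 0.
Proof.
have jac := gtors_jacobi br_lie J_cplx g_herm e_orth g_SKT.
rewrite /gradient.
apply: (gauge_orthogonal (p := fun i j k => F 1 1 1 (e i) (e j) (e k))
  (m := fun i j k => F 1 1 (-1) (e i) (e j) (e k))
  (K := fun i j k => F (-1) 1 (-1) (e i) (e j) (e k))
  (a := fun i j => F 1 1 1 (e i) X (e j))
  (c := fun i j => F 1 (-1) (-1) X (e i) (e j))
  (B := fun i j => F (-1) 1 1 (e i) (e j) X)).
- by move=> i j k; exact: Fcyc.
- by move=> i j k; exact: Fanti.
- by move=> i j k; exact: Fanti.
- by move=> i j; rewrite Fanti (Fcyc 1 1 1 X) Fcyc.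
- by move=> i j; rewrite (Fcyc 1 (-1) (-1) X (e i)) Fanti -(Fcyc 1 (-1) (-1) X).
- move=> i j k; rewrite -[RHS](jac 1 1 1 (-1) (e i) (e j) X (e k)) -!big_split /=.
  apply: eq_bigr => s _.
  rewrite (Fcyc 1 (-1) 1 X (e k)) -(Fcyc (-1) 1 1 (e s) (e j) X).
  rewrite (Fanti 1 1 (-1) X) -(Fcyc (-1) 1 1 (e s) (e i) X) (Fanti 1 1 1 X).
  rewrite -(Fcyc (-1) 1 (-1) (e s) (e i)) -(Fcyc (-1) 1 (-1) (e s) (e j)).
  have sw i' : F 1 (-1) 1 (e i') (e k) (e s) = - F 1 1 (-1) (e i') (e s) (e k).
    by rewrite Fcyc Fanti (Fcyc 1 1 (-1) (e i')).
  by rewrite !sw; ring.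
- move=> i j k; rewrite -[RHS](jac 1 1 1 1 (e i) (e j) (e k) X) -!big_split /=.
  apply: eq_bigr => s _.
  by rewrite -!(Fcyc (-1) 1 1 (e s) _ X); ring.
Qed.

Local Notation C i j k := (g (br (e i) (e j)) (e k)).
Local Notation P := (velocity br J g e).

(** Half of the derivative of the squared norm of the bracket when the metric has velocity [A], the
    frame moving by - 1/2 [A]. *)
Let pairing (A : 'I_n -> 'I_n -> R) :=
  \sum_i \sum_j \sum_k C i j k * (\sum_s (- 2^-1 * (A i s * C s j k)
    - 2^-1 * (A j s * C i s k) + 2^-1 * (A k s * C i j s))).

Let pairing_lin (a b : R) A B D : (forall i j, D i j = a * A i j + b * B i j) ->
  pairing D = a * pairing A + b * pairing B.
Proof.
move=> DE; rewrite /pairing !sum4_mulr -!sum4Z -sum4D.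
by apply: sum4_ext => i j k s; rewrite !DE; ring.
Qed.

(** Hence [pairing] sees only the symmetric part of its argument, and [gradient] may replace its
    symmetrisation. *)
Let pairing_tr A : pairing (fun i j => A j i) = pairing A.
Proof.
rewrite /pairing !sum4_mulr.
transitivity (- 2^-1 * sum4 (fun i j k s => A s i * (C i j k * C s j k)) +
  (- 2^-1 * sum4 (fun i j k s => A s j * (C i j k * C i s k)) +
   2^-1 * sum4 (fun i j k s => A s k * (C i j k * C i j s)))).
  by rewrite -!sum4Z -!sum4D; apply: sum4_ext => i j k s; ring.
rewrite [X in _ * X + _]sum4_swap14 [X in _ + (_ * X + _)]sum4_swap24.
rewrite [X in _ + (_ + _ * X)]sum4_swap34.
by rewrite -!sum4Z -!sum4D; apply: sum4_ext => i j k s; ring.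
Qed.

Let u := \sum_i \sum_j \sum_k C i j k ^+ 2.

(** The majorant is quadratic in [A] because the integral of the squared gradient is what will be
    controlled; [|A i j|] is at most [1 + A i j ^+ 2]. Each of the three terms contributes
    [n%:R / 2], the factor [n%:R] coming from the index that a square leaves free. *)
Let pairing_bound A :
  pairing A <= (3%:R * n%:R / 2) * (1 + \sum_i \sum_j A i j ^+ 2) * u.
Proof.
set a := 1 + _.
have Aa i j : `|A i j| <= a.
  apply: (@le_trans _ _ (1 + A i j ^+ 2)).
    rewrite -(real_normK (num_real (A i j))).
    have := sqr_ge0 (`|A i j| - 2^-1); rewrite sqrrB => h; lra.
  rewrite lerD2l (bigD1 i) //= (bigD1 j) //= -addrA lerDl addr_ge0 //.
    by apply: sumr_ge0 => *; exact: sqr_ge0.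
  by apply: sumr_ge0 => *; apply: sumr_ge0 => *; exact: sqr_ge0.
have prodb (x y z : R) i j : z = - 2^-1 * A i j \/ z = 2^-1 * A i j ->
    z * (x * y) <= 4^-1 * a * (x ^+ 2 + y ^+ 2).
  move=> zA; apply: le_trans (ler_norm _) _.
  have -> : `|z * (x * y)| = 2^-1 * (`|A i j| * `|x * y|).
    have h2 : `|2^-1| = 2^-1 :> R by rewrite ger0_norm.
    by case: zA => ->; rewrite !normrM ?normrN ?mulrA h2 //.
  have xy : `|x * y| <= 2^-1 * (x ^+ 2 + y ^+ 2).
    by rewrite ler_norml; have := sqr_ge0 (x - y); have := sqr_ge0 (x + y);
      rewrite sqrrB sqrrD => *; apply/andP; split; lra.
  have := ler_pM (normr_ge0 _) (normr_ge0 _) (Aa i j) xy => h; lra.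
rewrite /pairing sum4_mulr.
have E : sum4 (fun i j k s => C i j k ^+ 2) = n%:R * u.
  rewrite /sum4 mulr_sumr; apply: eq_bigr => i _; rewrite mulr_sumr.
  apply: eq_bigr => j _; rewrite mulr_sumr; apply: eq_bigr => k _.
  by rewrite sumr_const card_ord mulr_natl.
apply: (@le_trans _ _ (sum4 (fun i j k s => 4^-1 * a * (C i j k ^+ 2 + C s j k ^+ 2 +
   (C i j k ^+ 2 + C i s k ^+ 2) + (C i j k ^+ 2 + C i j s ^+ 2))))).
  apply: ler_sum => i _; apply: ler_sum => j _; apply: ler_sum => k _.
  apply: ler_sum => s _.
  have h1 := @prodb (C i j k) (C s j k) (- 2^-1 * A i s) i s (or_introl erefl).
  have h2 := @prodb (C i j k) (C i s k) (- 2^-1 * A j s) j s (or_introl erefl).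
  have h3 := @prodb (C i j k) (C i j s) (2^-1 * A k s) k s (or_intror erefl).
  by lra.
rewrite sum4Z !sum4D -(sum4_swap14 (fun i j k s => C i j k ^+ 2)).
rewrite -(sum4_swap24 (fun i j k s => C i j k ^+ 2)).
rewrite -(sum4_swap34 (fun i j k s => C i j k ^+ 2)) E.
by lra.
Qed.

(* The gauge part of the velocity acts on the bracket through the derivation
   ad X, which annihilates it. *)
Lemma bracket_growth :
  2 * \sum_i \sum_j \sum_k C i j k * (\sum_s
    (- 2^-1 * (P (e i) (e s) * C s j k) - 2^-1 * (P (e j) (e s) * C i s k)
     + 2^-1 * (P (e k) (e s) * C i j s))) <=
  3%:R * n%:R * (1 + \sum_i \sum_j G (e i) (e j) ^+ 2) * u.
Proof.
have A0 X : pairing (fun i s => g (br X (e i)) (e s)) = 0.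
  pose A i s := g (br X (e i)) (e s).
  (* Exchanging [k] and [s] transposes [A] in the last term. Then every inner sum is a Jacobi
     identity for [X], [e i], [e j] and vanishes by itself. *)
  transitivity (\sum_i \sum_j \sum_k C i j k * (\sum_s
    (- 2^-1 * (A i s * C s j k) - 2^-1 * (A j s * C i s k)
     + 2^-1 * (C i j s * A s k)))).
    rewrite /pairing !sum4_mulr.
    transitivity (sum4 (fun i j k s => C i j k * (- 2^-1 * (A i s * C s j k)
        - 2^-1 * (A j s * C i s k))) +
      2^-1 * sum4 (fun i j k s => C i j k * (A k s * C i j s))).
      by rewrite -!sum4Z -!sum4D; apply: sum4_ext => i j k s; rewrite /A; ring.
    rewrite (sum4_swap34 (fun i j k s => C i j k * (A k s * C i j s))).
    by rewrite -!sum4Z -!sum4D; apply: sum4_ext => i j k s; ring.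
  apply: big1 => i _; apply: big1 => j _; apply: big1 => k _.
  have lin1 f : linform (fun v => g (br v f) (e k)) by move=> a x y; rewrite !linE.
  have lin2 f : linform (fun v => g (br f v) (e k)) by move=> a x y; rewrite !linE.
  rewrite big_split sumrB -!mulr_sumr /A /=.
  rewrite (frame_contract _ e_orth (lin1 (e j))) (frame_contract _ e_orth (lin2 (e i))).
  rewrite (frame_contract _ e_orth (lin2 X)).
  rewrite (brC br_lie (e i) (br X (e j))) (brC br_lie X (br _ _)) !linE.
  rewrite (jacobiC br_lie g_herm (e i) (e j) X) (brC br_lie X (e j)) !linE.
  by ring.
pose A i s := g (br (gauge_field br J e) (e i)) (e s).
have -> : (\sum_i \sum_j \sum_k C i j k * (\sum_s
    (- 2^-1 * (P (e i) (e s) * C s j k) - 2^-1 * (P (e j) (e s) * C i s k)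
     + 2^-1 * (P (e k) (e s) * C i j s)))) = pairing (fun i j => G (e i) (e j)).
  rewrite -[LHS]/(pairing (fun i j => P (e i) (e j))).
  rewrite (@pairing_lin 1 (-1) (fun i j => 2^-1 * G (e i) (e j) + 2^-1 * G (e j) (e i))
    (fun i j => 2^-1 * A i j + 2^-1 * A j i)); last first.
    move=> i j; rewrite (velocity_gradient br_lie J_cplx g_herm e_orth g_SKT).
    by rewrite /A; ring.
  have A0' : pairing A = 0 := A0 _.
  have sym B : pairing (fun i j => 2^-1 * B i j + 2^-1 * B j i) = pairing B.
    rewrite (@pairing_lin 2^-1 2^-1 B (fun i j => B j i)) //.
    by rewrite (pairing_tr B); field.
  by rewrite (sym (fun i j => G (e i) (e j))) (sym A) A0'; ring.
have := pairing_bound (fun i j => G (e i) (e j)).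
by move=> ?; lra.
Qed.

End Growth.

(** * The sign of the functional on solvable Lie algebras *)

Section FunctionalArrays.
Context {R : realType} {n : nat}.
Implicit Types C H : 'I_n -> 'I_n -> 'I_n -> R.

Let sum3 (f : 'I_n -> 'I_n -> 'I_n -> R) := \sum_i \sum_j \sum_k f i j k.

Let sum3_cyc f : sum3 f = sum3 (fun i j k => f j k i).
Proof.
rewrite /sum3 [RHS]exchange_big /=.
by apply: eq_bigr => i _; rewrite [RHS]exchange_big.
Qed.

Let sum3_cyc3 f : 3 * sum3 f = sum3 (fun i j k => f i j k + f j k i + f k i j).
Proof.
have D f1 f2 : sum3 (fun i j k => f1 i j k + f2 i j k) = sum3 f1 + sum3 f2.
  rewrite /sum3 -big_split; apply: eq_bigr => i _ /=.
  by rewrite -big_split; apply: eq_bigr => j _ /=; rewrite -big_split.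
rewrite !D -(sum3_cyc f) (sum3_cyc (fun i j k => f k i j)); ring.
Qed.

(** Averaging over cyclic permutations cancels the products of [C] with [H], thanks to the weight 3.
    For structure constants in an orthonormal frame the sum of [C i j k * C k i j] is minus the
    metric trace of the Killing form. *)
Lemma functional_sum C H : (forall i j k, H i j k = H j k i) ->
  \sum_i \sum_j \sum_k (gtors_array C H 1 1 1 i j k ^+ 2 -
    3 * gtors_array C H 1 1 (-1) i j k ^+ 2) =
  \sum_i \sum_j \sum_k (- (3 / 2) * C i j k ^+ 2 + 3 * (C i j k * C k i j)
    - 2^-1 * H i j k ^+ 2).
Proof.
move=> Hcyc; apply: (mulfI (x := 3)); first by rewrite pnatr_eq0.
rewrite [LHS]sum3_cyc3 [RHS]sum3_cyc3.
apply: eq_bigr => i _; apply: eq_bigr => j _; apply: eq_bigr => k _.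
by rewrite /gtors_array -(Hcyc k i j) (Hcyc j k i); field.
Qed.

(* C i j k * C k i j vanishes unless deg i < deg j = deg k, and then C i j k
   and C k i j stand at different places in the sum of squares. *)
Lemma graded_bound C (deg : 'I_n -> nat) :
  (forall i j k, C i j k = - C j i k) ->
  (forall i j k, C i j k != 0 -> (deg i <= deg k)%N) ->
  (forall i j k, C i j k != 0 -> deg i = deg j -> (deg i < deg k)%N) ->
  2 * \sum_i \sum_j \sum_k C i j k * C k i j <= \sum_i \sum_j \sum_k C i j k ^+ 2.
Proof.
move=> CA deg1 deg2.
pose chi i j k : R := ((deg i < deg j)%N && (deg j == deg k))%:R.
have chi1 i j k : chi i j k + chi j k i <= 1.
  rewrite /chi; case: ltngtP => ij; case: ltngtP => jk; case: ltngtP => ki //=;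
    rewrite ?addr0 ?add0r ?lexx ?ler01 //; lia.
have deg3 i j k : C i j k != 0 -> (deg j <= deg k)%N.
  by move=> c; apply: (deg1 j i); rewrite CA oppr_eq0.
have bound i j k : 2 * (C i j k * C k i j) <=
    chi i j k * C i j k ^+ 2 + chi i j k * C k i j ^+ 2.
  rewrite -mulrDr.
  have chi0 : 0 <= chi i j k by exact: ler0n.
  have sq : 2 * (C i j k * C k i j) <= C i j k ^+ 2 + C k i j ^+ 2.
    by have := sqr_ge0 (C i j k - C k i j); rewrite sqrrB => h; lra.
  have sq0 : 0 <= C i j k ^+ 2 + C k i j ^+ 2 by rewrite addr_ge0 ?sqr_ge0.
  have [->|c1] := eqVneq (C i j k) 0.
    by rewrite mul0r mulr0 mulr_ge0 // addr_ge0 ?sqr_ge0.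
  have [->|c2] := eqVneq (C k i j) 0.
    by rewrite !mulr0 mulr_ge0 // addr_ge0 ?sqr_ge0.
  have d1 := deg1 _ _ _ c1; have d2 := deg3 _ _ _ c1; have d3 := deg2 _ _ _ c1.
  have d4 := deg1 _ _ _ c2; have d5 := deg3 _ _ _ c2.
  suff -> : chi i j k = 1 by rewrite mul1r.
  rewrite /chi (_ : (_ && _) = true) //.
  by apply/andP; split; [case: ltngtP (d3); lia | lia].
have -> : \sum_i \sum_j \sum_k C i j k ^+ 2 = sum3 (fun i j k => C i j k ^+ 2) by [].
have D f1 f2 : sum3 (fun i j k => f1 i j k + f2 i j k) = sum3 f1 + sum3 f2.
  rewrite /sum3 -big_split; apply: eq_bigr => i _ /=.
  by rewrite -big_split; apply: eq_bigr => j _ /=; rewrite -big_split.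
apply: (@le_trans _ _ (sum3 (fun i j k =>
    chi i j k * C i j k ^+ 2 + chi i j k * C k i j ^+ 2))).
  rewrite mulr_sumr; apply: ler_sum => i _; rewrite mulr_sumr.
  apply: ler_sum => j _; rewrite mulr_sumr; apply: ler_sum => k _; exact: bound.
rewrite D (sum3_cyc (fun i j k => chi i j k * C k i j ^+ 2)) -D.
apply: ler_sum => i _; apply: ler_sum => j _; apply: ler_sum => k _.
rewrite -mulrDl -[leRHS]mul1r ler_wpM2r ?sqr_ge0 //.
Qed.

End FunctionalArrays.

(** * Gram-Schmidt orthonormalisation *)

Section OrthonormalExtension.
Context {R : realType} {V : vectType R} (J : 'End(V)) (g : V -> V -> R).
Hypothesis g_herm : hermitian_metric J g.

Definition orthonormal_seq (s : seq V) :=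
  forall i j, (i < size s)%N -> (j < size s)%N -> g s`_i s`_j = (i == j)%:R.

Lemma orthonormal_seq_expand s x : orthonormal_seq s -> x \in span s ->
  x = \sum_(i < size s) g x s`_i *: s`_i.
Proof.
move=> os /(@coord_span _ _ _ (in_tuple s)) xE.
rewrite {1}xE; apply: eq_bigr => i _; congr (_ *: _).
rewrite [in RHS]xE (linform_sum _ _ _ (metric_lin1 g_herm _)) /= (bigD1 i) //= big1.
  by rewrite (metricZl g_herm) os // eqxx mulr1 addr0.
move=> j ji; rewrite (metricZl g_herm) os //.
by rewrite (_ : (_ == _) = false) ?mulr0 //; exact: negbTE ji.
Qed.

Lemma orthonormal_seq_rcons s (U : {vspace V}) : orthonormal_seq s ->
  ~~ (U <= span s)%VS -> (span s <= U)%VS -> exists v,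
  [/\ v \in U, v \notin span s, forall i, (i < size s)%N -> g v s`_i = 0 &
      orthonormal_seq (rcons s v)].
Proof.
move=> os /subvPn[x xU xs] sU.
pose w := x - \sum_(i < size s) g x s`_i *: s`_i.
have sumS : \sum_(i < size s) g x s`_i *: s`_i \in span s.
  by apply: memv_suml => i _; apply: memvZ; apply: memv_span; exact: mem_nth.
have ws : w \notin span s.
  by apply: contra xs => /memvD /(_ sumS); rewrite subrK.
have w0 : w != 0 by apply: contraNneq ws => ->; exact: mem0v.
have wU : w \in U by rewrite memvB // (subvP sU).
have worth i : (i < size s)%N -> g w s`_i = 0.
  move=> si; rewrite /w (linformB _ _ (metric_lin1 g_herm _)).
  rewrite (linform_sum _ _ _ (metric_lin1 g_herm _)) /= (bigD1 (Ordinal si)) //= big1.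
    by rewrite (metricZl g_herm) os // eqxx mulr1 addr0 subrr.
  move=> j ji; rewrite (metricZl g_herm) os //.
  by rewrite (_ : (_ == _) = false) ?mulr0 //; exact: negbTE ji.
have gw : 0 < g w w by case: g_herm => _ _ + _; exact.
pose v := (Num.sqrt (g w w))^-1 *: w.
have sq0 : Num.sqrt (g w w) != 0 by rewrite gt_eqF // sqrtr_gt0.
have vv : g v v = 1.
  rewrite /v (metricZl g_herm) (metricZr g_herm) mulrA -{3}(sqr_sqrtr (ltW gw)).
  by field.
have vorth i : (i < size s)%N -> g v s`_i = 0.
  by move=> si; rewrite /v (metricZl g_herm) worth // mulr0.
exists v; split=> //.
- by rewrite memvZ.
- apply: contra ws => /(memvZ (Num.sqrt (g w w))).
  by rewrite /v scalerA mulfV // scale1r.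
move=> i j; rewrite size_rcons !ltnS !nth_rcons => si sj.
case: (ltnP i (size s)) si => [si _|si' si]; case: (ltnP j (size s)) sj => [sj _|sj' sj].
- exact: os.
- have -> : j = size s by apply/eqP; rewrite eqn_leq sj.
  by rewrite eqxx (metricC g_herm) vorth // ltn_eqF.
- have -> : i = size s by apply/eqP; rewrite eqn_leq si.
  by rewrite eqxx vorth // gtn_eqF.
have -> : j = size s by apply/eqP; rewrite eqn_leq sj.
have -> : i = size s by apply/eqP; rewrite eqn_leq si.
by rewrite eqxx vv.
Qed.

(** Induction on the codimension of [span s] in [U]. The last clause records that the new vectors
    are orthogonal to the smaller space, as the frame adapted to the derived series requires. *)
Lemma orthonormal_seq_extend s (U : {vspace V}) : orthonormal_seq s ->
  (span s <= U)%VS -> exists s', [/\ orthonormal_seq (s ++ s'),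
    span (s ++ s') = U, all (fun v => v \in U) s' &
    forall v, v \in s' -> forall i, (i < size s)%N -> g v s`_i = 0].
Proof.
move=> os sU.
have [m] : exists m, (\dim U - \dim (span s) <= m)%N by exists (\dim U - \dim (span s))%N.
elim: m s os sU => [|m IH] s os sU h.
  exists [::]; rewrite cats0; split=> //.
  apply/eqP; rewrite eqEdim sU /=; move: h; rewrite leqn0 subn_eq0; exact.
case: (boolP (U <= span s)%VS) => [Us|nUs].
  exists [::]; rewrite cats0; split=> //; apply/eqP.
  by rewrite eqEsubv sU.
have [v [vU vs vorth ov]] := orthonormal_seq_rcons os nUs sU.
have spanE : <<rcons s v>>%VS = (span s + <[v]>)%VS.
  by rewrite -cats1 span_cat span_seq1.
have svU : (<<rcons s v>> <= U)%VS by rewrite spanE subv_add sU -memvE.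
have [|s' [os' s'U s'all s'orth]] := IH _ ov svU.
  rewrite -ltnS; apply: leq_trans _ h; rewrite ltn_sub2l //.
    rewrite ltn_neqAle dimvS // andbT; apply: contraNneq nUs => /eqP e.
    by move: e; rewrite eq_sym => /eqP e; rewrite (_ : U = span s) //; apply/esym/eqP; rewrite eqEdim sU /= e.
  rewrite ltn_neqAle dimvS ?andbT; last by rewrite spanE addvSl.
  apply: contra vs => /eqP e.
  have /eqP -> : (span s) == <<rcons s v>>%VS.
    by rewrite eqEdim spanE addvSl /= -spanE e.
  by apply: memv_span; rewrite mem_rcons mem_head.
exists (v :: s'); rewrite -cat_rcons; split=> //=; first by rewrite vU.
move=> x; rewrite inE => /predU1P[-> //|xs' i si].
have := s'orth x xs' i; rewrite size_rcons nth_rcons si; apply.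
exact: ltnW.
Qed.

Lemma orthonormal_seq_frame s : orthonormal_seq s -> span s = fullv ->
  orthonormal_frame g (fun i : 'I_(size s) => s`_i).
Proof.
move=> os sV; split=> [i j|x]; first by rewrite os.
by apply: orthonormal_seq_expand; rewrite // sV memvf.
Qed.

Lemma ex_orthonormal_frame : exists n (e : 'I_n -> V), orthonormal_frame g e.
Proof.
have [|s [os sV _ _]] := @orthonormal_seq_extend [::] fullv _ (subvf _) => //.
by exists (size s), (fun i => s`_i); exact: orthonormal_seq_frame os sV.
Qed.

End OrthonormalExtension.

(** * The derived series and frames adapted to it *)

Section Solvable.
Context {R : realType} {V : vectType R} (br : V -> V -> V) (J : 'End(V)).
Context (g : V -> V -> R).
Hypothesis br_lie : lie_bracket br.
Hypothesis g_herm : hermitian_metric J g.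

Local Notation D := (derived_algebra br).

Lemma br_suml (I : Type) (s : seq I) (P : pred I) (u : I -> V) y :
  br (\sum_(i <- s | P i) u i) y = \sum_(i <- s | P i) br (u i) y.
Proof.
by apply: (big_morph (br ^~ y)) => [a b|]; [exact: brDl | exact: br0l].
Qed.

Lemma br_sumr (I : Type) (s : seq I) (P : pred I) (u : I -> V) y :
  br y (\sum_(i <- s | P i) u i) = \sum_(i <- s | P i) br y (u i).
Proof.
by apply: (big_morph (br y)) => [a b|]; [exact: brDr | exact: br0r].
Qed.

Lemma derived_bracket k x y : x \in D k -> y \in D k -> br x y \in D k.+1.
Proof.
move=> xD yD; rewrite (coord_vbasis xD) (coord_vbasis yD) br_suml.
apply: memv_suml => i _; rewrite br_sumr; apply: memv_suml => j _.
rewrite (brZl br_lie) (brZr br_lie) !memvZ //; apply: memv_span.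
by apply: allpairs_f; apply: mem_nth; rewrite size_tuple.
Qed.

(** Yields the first degree condition of [graded_bound]: a bracket lies at least as deep in the
    series as each of its factors. The strict condition comes from [derived_bracket]. *)
Lemma derived_ideal k x y : y \in D k -> br x y \in D k.
Proof.
elim: k => [|k IH] in x y *; first by rewrite !memvf.
rewrite /=; set B := [seq br _ _ | _ <- _, _ <- _].
move=> /(@coord_span _ _ _ (in_tuple B)) ->.
rewrite br_sumr; apply: memv_suml => i _; rewrite (brZr br_lie) memvZ //=.
have /allpairsP[[a b] /= [/vbasis_mem aD /vbasis_mem bD ->]] : B`_i \in B.
  by rewrite mem_nth.
have -> : br x (br a b) = br (br x a) b + br (br b x) a.
  case: br_lie => _ _ /(_ x a b) /eqP; rewrite addrAC addr_eq0 => /eqP ->.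
  by rewrite (brC br_lie x).
have in_next u v : u \in D k -> v \in D k -> br u v \in span B.
  exact: (@derived_bracket k).
apply: memvD; apply: in_next => //; first exact: IH.
by rewrite (brC br_lie) memvN IH.
Qed.

Lemma derived_sub k l : (k <= l)%N -> (D l <= D k)%VS.
Proof.
move=> /subnK <-; elim: (l - k)%N => [|m IH]; first exact: subvv.
apply: subv_trans IH; apply/span_subvP => z /allpairsP[[a b] /= [aB bB ->]].
exact/derived_ideal/vbasis_mem.
Qed.

(** The frame is built from the deep end of the series: an orthonormal basis of [D k.+1] is extended
    to one of [D k], and the added vectors get degree [k]. *)
Lemma ex_adapted_frame : solvable_lie br ->
  exists n (e : 'I_n -> V) (deg : 'I_n -> nat), [/\ orthonormal_frame g e,
    forall i, e i \in D (deg i) &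
    forall i x, x \in D (deg i).+1 -> g x (e i) = 0].
Proof.
move=> [K DK].
(* [K - K] is 0, written so that the induction can replace it by [K - k], starting from
   [D K = 0]. *)
suff [s [d [os sD dD]]] : exists (s : seq V) (d : nat -> nat),
    [/\ orthonormal_seq g s, span s = D (K - K) &
     forall i, (i < size s)%N -> s`_i \in D (d i) /\
       forall x, x \in D (d i).+1 -> g x s`_i = 0].
  exists (size s), (fun i => s`_i), (fun i => d i); split=> [|i|i].
  - by apply: (orthonormal_seq_frame g_herm os); rewrite sD subnn.
  - by case: (dD i).
  - by case: (dD i).
have : (K <= K)%N by []; move: {1 4}K => k.
elim: k => [_|k IH kK].
  by exists [::], (fun=> 0%N); split=> //; rewrite subn0 DK span_nil.
have [s [d [os sD dD]]] := IH (ltnW kK).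
have eK : (K - k)%N = (K - k.+1).+1 by lia.
have sub : (span s <= D (K - k.+1))%VS by rewrite sD eK; exact: derived_sub.
have [s' [os' s'D /allP s'in s'orth]] := orthonormal_seq_extend g_herm os sub.
exists (s ++ s'), (fun i => if (i < size s)%N then d i else (K - k.+1)%N).
split=> // i; rewrite size_cat nth_cat => hi.
case: ltnP => si; first exact: dD.
have mem : s'`_(i - size s) \in s' by rewrite mem_nth // ltn_subLR.
split=> [|x]; first exact: s'in.
rewrite -eK -sD => /(@coord_span _ _ _ (in_tuple s)) ->.
rewrite (linform_sum _ _ _ (metric_lin1 g_herm _)) big1 // => j _.
by rewrite (metricZl g_herm) (metricC g_herm) (s'orth _ mem) // mulr0.
Qed.

Context (n : nat) (e : 'I_n -> V).
Hypothesis e_orth : orthonormal_frame g e.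
Local Notation F := (gtors br J g).
Local Notation C i j k := (g (br (e i) (e j)) (e k)).

Definition functional : R := \sum_i \sum_j \sum_k
  (F 1 1 1 (e i) (e j) (e k) ^+ 2 - 3 * F 1 1 (-1) (e i) (e j) (e k) ^+ 2).

Let linE := (linE br_lie g_herm).

Let trace3 (phi psi : V -> V -> V -> R) m (e' : 'I_m -> V) : orthonormal_frame g e' ->
  (forall y z, linform (fun x => phi x y z)) -> (forall y z, linform (fun x => psi x y z)) ->
  (forall x z, linform (fun y => phi x y z)) -> (forall x z, linform (fun y => psi x y z)) ->
  (forall x y, linform (phi x y)) -> (forall x y, linform (psi x y)) ->
  \sum_i \sum_j \sum_k phi (e i) (e j) (e k) * psi (e i) (e j) (e k) =
  \sum_i \sum_j \sum_k phi (e' i) (e' j) (e' k) * psi (e' i) (e' j) (e' k).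
Proof.
move=> e'o f1 h1 f2 h2 f3 h3.
have tr (a b : V -> R) : linform a -> linform b ->
    \sum_k a (e k) * b (e k) = \sum_k a (e' k) * b (e' k).
  move=> la lb; apply: (frame_trace (phi := fun x y => a x * b y) (metricC g_herm) e'o e_orth).
    by move=> y c u v; rewrite la; ring.
  by move=> x c u v; rewrite lb; ring.
under eq_bigr => i _ do under eq_bigr => j _ do rewrite tr //.
transitivity (\sum_i \sum_k \sum_j phi (e i) (e' j) (e' k) * psi (e i) (e' j) (e' k)).
  apply: eq_bigr => i _; rewrite exchange_big /=; apply: eq_bigr => k _.
  exact: (tr (fun y => phi (e i) y (e' k)) (fun y => psi (e i) y (e' k))).
rewrite exchange_big [RHS]exchange_big /=.
under [RHS]eq_bigr => j _ do rewrite exchange_big /=.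
rewrite [RHS]exchange_big /=; apply: eq_bigr => k _.
rewrite exchange_big /=; apply: eq_bigr => j _.
exact: (tr (fun x => phi x (e' j) (e' k)) (fun x => psi x (e' j) (e' k))).
Qed.

(** The given frame need not be adapted to the derived series, so the two sums in the structure
    constants are first carried to an adapted frame by [trace3], one index at a time. The H term is
    nonpositive in any frame. *)
Lemma solvable_functional_le0 : solvable_lie br -> functional <= 0.
Proof.
move=> /ex_adapted_frame[m [e' [deg [e'o e'D e'orth]]]].
rewrite /functional (functional_sum (fun i j k => C i j k)
  (H := fun i j k => tors3 br J g (e i) (e j) (e k))); last first.
  by move=> i j k; exact: tors3_cyc.
pose S (f : 'I_n -> 'I_n -> 'I_n -> R) : R := \sum_i \sum_j \sum_k f i j k.
have c2 : S (fun i j k => C i j k ^+ 2) =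
    \sum_i \sum_j \sum_k g (br (e' i) (e' j)) (e' k) ^+ 2.
  rewrite /S; under eq_bigr do under eq_bigr do under eq_bigr do rewrite expr2.
  under [RHS]eq_bigr do under eq_bigr do under eq_bigr do rewrite expr2.
  by apply: (trace3 (phi := fun x y z => g (br x y) z)
    (psi := fun x y z => g (br x y) z) e'o) => x y a u v; rewrite !linE.
have mu : S (fun i j k => C i j k * C k i j) = \sum_i \sum_j \sum_k
    g (br (e' i) (e' j)) (e' k) * g (br (e' k) (e' i)) (e' j).
  by apply: (trace3 (phi := fun x y z => g (br x y) z)
    (psi := fun x y z => g (br z x) y) e'o) => x y a u v; rewrite !linE.
have H2 : 0 <= S (fun i j k => tors3 br J g (e i) (e j) (e k) ^+ 2).
  by apply: sumr_ge0 => *; apply: sumr_ge0 => *; apply: sumr_ge0 => *; exact: sqr_ge0.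
have bound := @graded_bound R m (fun i j k => g (br (e' i) (e' j)) (e' k)) deg.
have {bound} : 2 * S (fun i j k => C i j k * C k i j) <= S (fun i j k => C i j k ^+ 2).
  rewrite c2 mu; apply: bound => [i j k|i j k|i j k].
  - exact: (bracketC br_lie g_herm).
  - apply: contraNT; rewrite -ltnNge => ki; apply/eqP/e'orth.
    apply: (subvP (derived_sub ki)); rewrite (brC br_lie) memvN.
    exact: derived_ideal.
  - move=> c ij; move: c; apply: contraNT; rewrite -leqNgt => ki.
    apply/eqP/e'orth; apply: (subvP (derived_sub (l := (deg i).+1) _)) => //.
    by apply: derived_bracket; rewrite // ij.
rewrite (_ : \sum_i _ = - (3 / 2) * S (fun i j k => C i j k ^+ 2) +
   3 * S (fun i j k => C i j k * C k i j) -
   2^-1 * S (fun i j k => tors3 br J g (e i) (e j) (e k) ^+ 2)).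
  by move=> ?; lra.
rewrite /S !mulr_sumr -big_split -sumrB; apply: eq_bigr => i _ /=.
rewrite !mulr_sumr -big_split -sumrB; apply: eq_bigr => j _ /=.
by rewrite !mulr_sumr -big_split -sumrB.
Qed.

End Solvable.

(** * The Chern connection *)

Section Chern.
Context {R : realType} {V : vectType R} (br : V -> V -> V) (J : 'End(V)).
Context (g : V -> V -> R) (n : nat) (e : 'I_n -> V).
Hypothesis br_lie : lie_bracket br.
Hypothesis J_cplx : complex_structure br J.
Hypothesis g_herm : hermitian_metric J g.
Hypothesis e_orth : orthonormal_frame g e.

Local Notation C x y z := (g (br x y) z).
Local Notation H := (tors3 br J g).
Local Notation F := (gtors br J g).
Local Notation eta := (ricci_trace br J g e).

Let linE := (linE br_lie g_herm).
Let JJ := (JJ J_cplx).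
Let bC := (bracketC br_lie g_herm).
Let nij := (nijenhuis J_cplx).
Let gJ := (metric_J g_herm JJ).

(* g(N_x y, z) for N_x = A_x - A_x^*, where A_x y = ([x, y] + J[Jx, y]) / 2 is
   the dbar operator of the holomorphic tangent bundle. *)
Definition chern_form (x y z : V) : R :=
  2^-1 * (C x y z - C x z y - g (br (J x) y) (J z) + g (br (J x) z) (J y)).

Local Notation N3 := chern_form.

Lemma chern_form_lin1 y z : linform (fun x => N3 x y z).
Proof. by move=> a u v; rewrite /chern_form !linE; ring. Qed.

Lemma chern_form_lin2 x z : linform (fun y => N3 x y z).
Proof. by move=> a u v; rewrite /chern_form !linE; ring. Qed.

Lemma chern_form_lin3 x y : linform (N3 x y).
Proof. by move=> a u v; rewrite /chern_form !linE; ring. Qed.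

Lemma chern_form_skew x y z : N3 x y z = - N3 x z y.
Proof. by rewrite /chern_form; ring. Qed.

Lemma chern_formJ x y z : N3 x (J y) z = - N3 x y (J z).
Proof.
rewrite /chern_form !JJ (nij x y) (nij x z) !linE !gJ ?JJ ?linE.
by ring.
Qed.

Lemma chern_form_torsion11 x y z :
  N3 x y z - N3 y x z - C x y z + (N3 (J x) (J y) z - N3 (J y) (J x) z - C (J x) (J y) z) = 0.
Proof.
rewrite /chern_form !JJ !linE (nij x y) (nij y x) !linE !gJ ?JJ ?linE.
rewrite (bC y x) (bC (J y) x) (bC y (J x)).
by field.
Qed.

(* The difference between the Chern connection and the Bismut connection of
   torsion - H. It anticommutes with J, so that it enters the J-linear part of
   the curvature only quadratically; this quadratic term is Q. *)
Definition chern_defect (x y z : V) : R := 2^-1 * (H x y z - H x (J y) (J z)).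

Local Notation psi := chern_defect.

(** The left side is g(B_x y, z) for the Bismut connection B of torsion - H: the direction of
    differentiation is the second argument of [F]. *)
Lemma gtors_chern x y z : F (-1) 1 (-1) y x z = N3 x y z - psi x y z.
Proof.
rewrite /chern_defect /chern_form /gtors /tors3 !JJ !linE.
by rewrite (bC (J y) (J x)) (bC (J x) (J z)) (bC (J z) (J y)) (bC y x) (bC z y) (bC z (J x)); field.
Qed.

Lemma chern_defectJ x y z : psi x (J y) z = psi x y (J z).
Proof.
by rewrite /chern_defect /tors3 !JJ !linE; field.
Qed.

Lemma chern_defect_skew x y z : psi x y z = - psi x z y.
Proof.
by rewrite /chern_defect /tors3 !JJ !linE (bC (J x) (J z)) (bC (J z) (J y)) (bC (J y) (J x)) (bC z y) (bC z (J x)) (bC y (J x)); field.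
Qed.

(** The Chern torsion is the defect with its arguments rotated, which is why Q becomes the square of
    the defect. *)
Lemma chern_defect_torsion x y z : N3 x y z - N3 y x z - C x y z = - psi z x y.
Proof.
rewrite /chern_defect /chern_form /tors3 !JJ !linE.
rewrite (nij x y) (nij y z) (nij z x) !linE !gJ ?JJ ?linE.
rewrite ?(bC y x) ?(bC z x) ?(bC z y) ?(bC (J y) x) ?(bC (J z) x) ?(bC (J z) y).
rewrite ?(bC z (J x)) ?(bC y (J x)) ?(bC z (J y)).
by field.
Qed.

Lemma chern_defectJ1 x y z : psi (J x) y z = - psi x y (J z).
Proof.
rewrite /chern_defect /tors3 !JJ !linE.
rewrite ?(nij x y) ?(nij y z) ?(nij z x) ?(nij x z) !linE !gJ ?JJ ?linE.
rewrite ?(bC y x) ?(bC z x) ?(bC z y) ?(bC (J y) x) ?(bC (J z) x) ?(bC (J z) y).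
rewrite ?(bC z (J x)) ?(bC y (J x)) ?(bC z (J y)).
by field.
Qed.

Let Fanti := (gtors_anti br_lie g_herm).
Let Fcyc := (gtors_cyc br J g).
Let F2 := (gtors_lin2 br_lie g_herm).
Let F3 := (gtors_lin3 br_lie g_herm).
Let FJJ := (bismut_JJ br_lie J_cplx g_herm).
Local Notation W := (\sum_i br (e i) (J (e i))).

Let F_skew s x y z : F s 1 1 x y z = - F s 1 1 x z y.
Proof. by rewrite Fcyc Fanti -[in RHS]Fcyc Fcyc. Qed.

Hypothesis g_SKT : SKT br J g.

(* The trace over the pair (e_a, J e_a) of the identity
   g(R^+(x, y)z, w) = g(R^-(z, w)x, y) between the curvatures of the two
   Bismut connections. *)
Lemma ricci_trace_bracket x y : - eta (br x y) =
  2^-1 * F (-1) (-1) 1 x y W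
  - \sum_a \sum_k F (-1) 1 (-1) y (e a) (e k) * F (-1) 1 (-1) x (J (e a)) (e k).
Proof.
have jac := gtors_jacobi br_lie J_cplx g_herm e_orth g_SKT.
have T1 : \sum_a \sum_k (F (-1) (-1) 1 x y (e k) * F 1 1 1 (e a) (J (e a)) (e k)
    - F (-1) (-1) (-1) x y (e k) * F 1 1 (-1) (e a) (J (e a)) (e k)) =
    2 * eta (br x y) + F (-1) (-1) 1 x y W.
  rewrite (linform_sum _ _ _ (F3 _ _ _ _ _)) /ricci_trace mulrA mulfV ?mul1r //.
  rewrite -big_split; apply: eq_bigr => a _ /=.
  rewrite -(frame_contract (br x y) e_orth (F3 1 1 (-1) (e a) (J (e a)))).
  rewrite -(frame_contract (br (e a) (J (e a))) e_orth (F3 (-1) (-1) 1 x y)).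
  by rewrite -big_split; apply: eq_bigr => k _; rewrite /gtors /=; field.
(* The V_+ part of the trace vanishes: the first factor is skew in [a] and [k], the second symmetric
   because the Bismut connection commutes with [J]. *)
pose S1 := \sum_a \sum_k F (-1) 1 1 x (e a) (e k) * F (-1) 1 1 y (e a) (J (e k)).
have S10 : S1 = 0.
  have : S1 = - S1; last by move=> h; lra.
  rewrite {1}/S1 exchange_big /= -sumrN; apply: eq_bigr => a _.
  rewrite -sumrN; apply: eq_bigr => k _.
  rewrite (F_skew (-1) x) -(FJJ y (e k)) JJ (linformN _ (F3 _ _ _ _ _)).
  by rewrite (F_skew (-1) y (J (e k))); ring.
have S2 : \sum_a \sum_k F (-1) 1 1 y (e a) (e k) * F (-1) 1 1 x (J (e a)) (e k) = S1.
  rewrite /S1 -(frame_traceJ g_herm JJ (phi := fun a b =>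
    \sum_k F (-1) 1 1 x a (e k) * F (-1) 1 1 y b (J (e k))) e_orth); last 2 first.
  - move=> b a u v; rewrite mulr_sumr -big_split.
    by apply: eq_bigr => k _; rewrite F2 /=; ring.
  - move=> a b u v; rewrite mulr_sumr -big_split.
    by apply: eq_bigr => k _; rewrite F2 /=; ring.
  by apply: eq_bigr => a _; apply: eq_bigr => k _; rewrite FJJ mulrC.
have S3 : \sum_a \sum_k F (-1) 1 1 x (e a) (e k) * F (-1) 1 1 y (J (e a)) (e k) = - S1.
  rewrite -sumrN; apply: eq_bigr => a _; rewrite -sumrN; apply: eq_bigr => k _.
  by rewrite -(FJJ y (J (e a))) JJ (linformN _ (F2 _ _ _ _ _)) mulrN.
pose S4 := \sum_a \sum_k F (-1) 1 (-1) y (e a) (e k) * F (-1) 1 (-1) x (J (e a)) (e k).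
have S5 : \sum_a \sum_k F (-1) 1 (-1) x (e a) (e k) * F (-1) 1 (-1) y (J (e a)) (e k) = - S4.
  rewrite -(frame_traceJ g_herm JJ (phi := fun a b =>
    \sum_k F (-1) 1 (-1) x a (e k) * F (-1) 1 (-1) y (J b) (e k)) e_orth); last 2 first.
  - move=> b a u v; rewrite mulr_sumr -big_split.
    by apply: eq_bigr => k _; rewrite F2 /=; ring.
  - move=> a b u v; rewrite mulr_sumr -big_split linearP.
    by apply: eq_bigr => k _; rewrite F2 /=; ring.
  rewrite /S4 -sumrN; apply: eq_bigr => a _; rewrite -sumrN; apply: eq_bigr => k _.
  by rewrite JJ (linformN _ (F2 _ _ _ _ _)); ring.
have : \sum_a (\sum_k (F (-1) (-1) 1 x y (e k) * F 1 1 1 (e a) (J (e a)) (e k)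
    - F (-1) (-1) (-1) x y (e k) * F 1 1 (-1) (e a) (J (e a)) (e k)) +
  \sum_k (F (-1) 1 1 y (e a) (e k) * F (-1) 1 1 x (J (e a)) (e k)
    - F (-1) 1 (-1) y (e a) (e k) * F (-1) 1 (-1) x (J (e a)) (e k)) +
  \sum_k (F 1 (-1) 1 (e a) x (e k) * F (-1) 1 1 y (J (e a)) (e k)
    - F 1 (-1) (-1) (e a) x (e k) * F (-1) 1 (-1) y (J (e a)) (e k))) = 0.
  by apply: big1 => a _; exact: jac.
rewrite !big_split /= T1.
have -> : \sum_a \sum_k (F (-1) 1 1 y (e a) (e k) * F (-1) 1 1 x (J (e a)) (e k)
    - F (-1) 1 (-1) y (e a) (e k) * F (-1) 1 (-1) x (J (e a)) (e k)) = S1 - S4.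
  by rewrite -S2 -sumrB; apply: eq_bigr => a _; rewrite -sumrB.
have -> : \sum_a \sum_k (F 1 (-1) 1 (e a) x (e k) * F (-1) 1 1 y (J (e a)) (e k)
    - F 1 (-1) (-1) (e a) x (e k) * F (-1) 1 (-1) y (J (e a)) (e k)) = S1 - S4.
  rewrite -[S1]opprK -S3 -S5 -sumrN -big_split; apply: eq_bigr => a _ /=.
  rewrite -sumrN -big_split; apply: eq_bigr => k _ /=.
  by rewrite (Fanti 1 (-1) 1) (Fanti 1 (-1) (-1)); ring.
by rewrite S10 -/S4 => ?; lra.
Qed.

Definition chern_op (x y : V) : V := \sum_k N3 x y (e k) *: e k.

Local Notation N := chern_op.

Lemma chern_opE x y z : g (N x y) z = N3 x y z.
Proof.
rewrite /chern_op (linform_sum _ _ _ (metric_lin1 g_herm _)) /=.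
rewrite -(frame_contract z e_orth (chern_form_lin3 x y)).
by apply: eq_bigr => k _; rewrite (metricZl g_herm) mulrC (metricC g_herm z).
Qed.

Lemma chern_op_chern : chern_connection br J g N.
Proof.
have ext := metric_ext g_herm.
split.
- split=> a x y z; apply: ext => w; rewrite !linE !chern_opE.
    exact: chern_form_lin1.
  exact: chern_form_lin2.
- by move=> x y z; rewrite (metricC g_herm y) !chern_opE chern_form_skew addNr.
- by move=> x y; apply: ext => w; rewrite gJ !chern_opE chern_formJ.
- move=> x y; apply: ext => w; rewrite /torsion !linE !chern_opE.
  by rewrite (linform0 (metric_lin1 g_herm w)) chern_form_torsion11.
Qed.

Definition chern_ricci (x y : V) : R := 2^-1 * \sum_a
  g (N (e a) (N (J (e a)) (J x)) - N (J (e a)) (N (e a) (J x))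
     - N (br (e a) (J (e a))) (J x)) y.

Definition torsion_square (x y : V) : R :=
  \sum_a g (torsion br N x (e a)) (torsion br N y (e a)).

(** In the quadratic trace of [ricci_trace_bracket] each factor is Chern minus defect. The pure
    Chern products [A], with the Chern term at [W], make up the Chern curvature; the products of two
    defects make up the torsion square. The mixed products [Z] and the defect at [W] cancel on
    symmetrising in [x] and [y]. *)
Lemma velocity_chern x y :
  velocity br J g e x y = - chern_ricci x y + torsion_square x y.
Proof.
pose A (x y : V) := \sum_a \sum_k N3 (J (e a)) x (e k) * N3 (e a) y (J (e k)).
pose Z (x y : V) := \sum_a \sum_k N3 (e a) x (e k) * psi (e a) y (e k).
have psi1 y' z' : linform (fun v => psi v y' z').
  by move=> a u v; rewrite /chern_defect /tors3 !linE; ring.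
have psi3 x' y' : linform (psi x' y').
  by move=> a u v; rewrite /chern_defect /tors3 !linE; ring.
have contr (u v : V -> R) : linform u -> linform v ->
    \sum_k u (J (e k)) * v (J (e k)) = \sum_k u (e k) * v (e k).
  move=> lu lv; apply: (frame_traceJ g_herm JJ (phi := fun a b => u a * v b) e_orth).
    by move=> b a u' v'; rewrite lu; ring.
  by move=> b a u' v'; rewrite lv; ring.
have inner u v : g u v = \sum_k g u (e k) * g v (e k).
  by rewrite (frame_contract u e_orth (metric_lin2 g_herm v)) (metricC g_herm).
have q u v : torsion_square u v = \sum_a \sum_k psi (e a) u (e k) * psi (e a) v (e k).
  rewrite /torsion_square; under eq_bigr => a _ do rewrite inner.
  rewrite exchange_big; apply: eq_bigr => a _; apply: eq_bigr => k _ /=.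
  by rewrite /torsion !linE !chern_opE !chern_defect_torsion mulrNN.
have NN a b u v : g (N a (N b (J u))) v =
    - \sum_k N3 b u (e k) * N3 a v (J (e k)).
  rewrite chern_opE chern_form_skew -chern_opE inner.
  have := contr (N3 b (J u)) (N3 a v) (chern_form_lin3 _ _) (chern_form_lin3 _ _).
  move=> h; transitivity (- \sum_k N3 b (J u) (e k) * N3 a v (e k)).
    by congr (- _); apply: eq_bigr => k _; rewrite !chern_opE mulrC.
  rewrite -h; congr (- _); apply: eq_bigr => k _.
  by rewrite chern_formJ JJ (linformN _ (chern_form_lin3 _ _)) opprK.
have NN' a b u v : g (N b (N a (J u))) v =
    \sum_k N3 a u (J (e k)) * N3 b v (e k).
  rewrite chern_opE chern_form_skew -chern_opE inner -sumrN.
  by apply: eq_bigr => k _; rewrite !chern_opE chern_formJ; ring.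
have s : chern_ricci x y = - 2^-1 * (A x y + A y x) - 2^-1 * N3 W (J x) y.
  rewrite /chern_ricci mulNr -mulrN -mulrBr; congr (_ * _).
  rewrite (linform_sum _ _ _ (chern_form_lin1 _ _)) opprD -!sumrN -!big_split.
  apply: eq_bigr => a _; rewrite !linE NN NN' chern_opE /=; congr (_ - _).
  by congr (- _ - _); apply: eq_bigr => k _; rewrite mulrC.
have M u v : \sum_a \sum_k F (-1) 1 (-1) (J v) (e a) (e k) *
    F (-1) 1 (-1) u (J (e a)) (e k) = - A u v - Z v u + Z u v - torsion_square u v.
  have z1 : \sum_a \sum_k N3 (e a) v (J (e k)) * psi (e a) u (J (e k)) = Z v u.
    by apply: eq_bigr => a _; apply: contr; [exact: chern_form_lin3 | exact: psi3].
  have z2 : \sum_a \sum_k psi (e a) v (J (e k)) * N3 (J (e a)) u (e k) = - Z u v.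
    rewrite -(frame_traceJ g_herm JJ (phi := fun a b =>
      \sum_k psi a v (J (e k)) * N3 (J b) u (e k)) e_orth); last 2 first.
    - move=> b a u' v'; rewrite mulr_sumr -big_split.
      by apply: eq_bigr => k _; rewrite psi1 /=; ring.
    - move=> a b u' v'; rewrite mulr_sumr -big_split linearP.
      by apply: eq_bigr => k _; rewrite chern_form_lin1 /=; ring.
    rewrite -sumrN; apply: eq_bigr => a _; rewrite -sumrN; apply: eq_bigr => k _.
    rewrite chern_defectJ1 !JJ (linformN _ (psi3 _ _)) (linformN _ (chern_form_lin1 _ _)).
    by ring.
  have z3 : \sum_a \sum_k psi (e a) u (J (e k)) * psi (e a) v (J (e k)) =
      torsion_square u v.
    by rewrite q; apply: eq_bigr => a _; apply: contr; exact: psi3.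
  rewrite -z1 -[Z u v]opprK -z2 -z3 -!sumrN -!big_split; apply: eq_bigr => a _ /=.
  rewrite -!sumrN -!big_split; apply: eq_bigr => k _ /=.
  by rewrite !gtors_chern chern_formJ chern_defectJ chern_defectJ1; ring.
have W1 u v : F (-1) (-1) 1 u (J v) W = N3 W (J v) u - psi W (J v) u.
  by rewrite Fcyc gtors_chern.
have -> : velocity br J g e x y =
    2^-1 * (- eta (br x (J y)) - eta (br y (J x))) by rewrite /velocity; ring.
rewrite !ricci_trace_bracket !W1 !M s.
have -> : torsion_square y x = torsion_square x y.
  by rewrite !q; apply: eq_bigr => a _; apply: eq_bigr => k _; rewrite mulrC.
rewrite (chern_formJ W y) (chern_form_skew W y) opprK.
by rewrite (chern_defectJ W y) (chern_defect_skew W y); field.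
Qed.

End Chern.

(** * Components in a complex frame *)

Section ComplexSums.
Context {R : realType}.

Lemma sum_complex (I : Type) (s : seq I) (P : pred I) (a b : I -> R) :
  \sum_(i <- s | P i) (a i +i* b i)%C =
  ((\sum_(i <- s | P i) a i) +i* (\sum_(i <- s | P i) b i))%C.
Proof.
elim: s => [|i s IH]; first by rewrite !big_nil.
by rewrite !big_cons; case: (P i); rewrite IH.
Qed.

Lemma mul_complex (a b c d : R) :
  (a +i* b)%C * (c +i* d)%C = ((a * c - b * d) +i* (a * d + b * c))%C.
Proof. by []. Qed.

Lemma add_complex (a b c d : R) :
  (a +i* b)%C + (c +i* d)%C = ((a + c) +i* (b + d))%C.
Proof. by []. Qed.

End ComplexSums.

Section Sesquilinear.
Context {R : realType} {V : vectType R} (J : 'End(V)).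
Context (m : nat) (f : m.-tuple V).
Hypothesis JJ : forall x, J (J x) = - x.
Hypothesis f_frame : complex_frame J f.

Definition sesquilinear (D : V -> V -> R[i]) :=
  [/\ forall a u v y, D (a *: u + v) y = (a +i* 0)%C * D u y + D v y,
      forall a u v x, D x (a *: u + v) = (a +i* 0)%C * D x u + D x v,
      forall x y, D (J x) y = (0 +i* 1)%C * D x y &
      forall x y, D x (J y) = (0 +i* -1)%C * D x y].

Let B := [tuple of f ++ map J f].

Let B_free : free B. Proof. exact: basis_free f_frame. Qed.

Definition complex_coord (k : 'I_m) (x : V) : R[i] :=
  (coord B (lshift m k) x +i* coord B (rshift m k) x)%C.

Local Notation c := complex_coord.

Let Bl k : B`_(lshift m k) = tnth f k.
Proof. by rewrite nth_cat size_tuple /= ltn_ord -tnth_nth. Qed.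

Let Br k : B`_(rshift m k) = J (tnth f k).
Proof.
rewrite nth_cat size_tuple /= ltnNge leq_addr /= addKn.
by rewrite (nth_map 0) ?size_tuple // -tnth_nth.
Qed.

Lemma complex_coord_lin k a u v : c k (a *: u + v) = (a +i* 0)%C * c k u + c k v.
Proof.
by rewrite /c !linearP /= mul_complex add_complex !mul0r subr0 addr0.
Qed.

Lemma complex_expand x : x = \sum_k (coord B (lshift m k) x *: tnth f k +
  coord B (rshift m k) x *: J (tnth f k)).
Proof.
rewrite {1}(coord_basis f_frame (memvf x)) big_split_ord big_split /=.
by congr (_ + _); apply: eq_bigr => k _; rewrite ?Bl ?Br.
Qed.

Lemma complex_coord_frame k j : c k (tnth f j) = (k == j)%:R.
Proof.
rewrite /c -Bl !coord_free // eq_lshift eq_sym.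
rewrite (_ : (lshift m j == rshift m k) = false) ?eq_lrshift //.
by case: eqP => // _; rewrite (_ : (_ == _) = false).
Qed.

Lemma complex_coord_frameJ k j : c k (J (tnth f j)) = (0 +i* (k == j)%:R)%C.
Proof.
rewrite /c -Br !coord_free // eq_rlshift eq_sym.
by rewrite (inj_eq (@rshift_inj _ _)).
Qed.

Let linC (h : V -> R[i]) := forall a u v, h (a *: u + v) = (a +i* 0)%C * h u + h v.

Let linC_expand h x : linC h -> h x = \sum_k
  ((coord B (lshift m k) x +i* 0)%C * h (tnth f k) +
   (coord B (rshift m k) x +i* 0)%C * h (J (tnth f k))).
Proof.
move=> lh; rewrite {1}(complex_expand x).
have h0 : h 0 = 0.
  have := lh 1 0 0; rewrite scaler0 addr0 (_ : (1 +i* 0)%C = 1) // mul1r.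
  by move/eqP; rewrite -subr_eq0 opprD addNKr oppr_eq0 => /eqP.
have hD u v : h (u + v) = h u + h v.
  by rewrite -[u]scale1r lh (_ : (1 +i* 0)%C = 1) // mul1r scale1r.
have hZ a u : h (a *: u) = (a +i* 0)%C * h u by rewrite -[_ *: _]addr0 lh h0 addr0.
rewrite (big_morph h hD h0); apply: eq_bigr => k _.
by rewrite hD !hZ.
Qed.

Lemma sesquilinear_expandr D x y : sesquilinear D ->
  D x y = \sum_l (c l y)^*%C * D x (tnth f l).
Proof.
case=> _ D2 _ DJ2; rewrite (@linC_expand (D x) y (fun a v w => D2 a v w x)).
apply: eq_bigr => k _; rewrite DJ2 mulrA -mulrDl; congr (_ * _).
by rewrite /c; simpc.
Qed.

Lemma sesquilinear_expand D x y : sesquilinear D ->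
  D x y = \sum_k \sum_l c k x * (c l y)^*%C * D (tnth f k) (tnth f l).
Proof.
move=> sD; have [D1 _ DJ1 _] := sD.
rewrite (@linC_expand (fun u => D u y) x (fun a u v => D1 a u v y)).
apply: eq_bigr => k _; rewrite DJ1 mulrA -mulrDl (sesquilinear_expandr _ y sD).
rewrite mulr_sumr; apply: eq_bigr => l _; rewrite mulrA; congr (_ * _ * _).
by rewrite /c; simpc.
Qed.

Context (g : V -> V -> R) (n : nat) (e : 'I_n -> V).
Hypothesis g_herm : hermitian_metric J g.
Hypothesis e_orth : orthonormal_frame g e.

Definition hermitian_comp (b : V -> V -> R) (x y : V) : R[i] :=
  formC b (part10 J x) (conjV (part10 J y)).

Local Notation h := (hermitian_comp g).

Lemma hermitian_compE b x y : bilinear_form b -> hermitian_comp b x y =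
  ((4^-1 * (b x y + b (J x) (J y))) +i* (4^-1 * (b x (J y) - b (J x) y)))%C.
Proof.
move=> [b1 b2].
have l1 z : linform (b ^~ z) by move=> a u v; exact: b1.
have l2 z : linform (b z) by move=> a u v; exact: b2.
rewrite /hermitian_comp /formC /=.
rewrite !opprK !(linformN _ (l1 _)).
rewrite !(linformZ _ _ (l1 _)) !(linformZ _ _ (l2 _)).
by apply/eqP; rewrite eq_complex /=; apply/andP; split; apply/eqP; field.
Qed.

Let bg : bilinear_form g. Proof. by case: g_herm. Qed.
Let gJ := metric_J g_herm JJ.

Lemma hermitian_metricE x y : h x y = ((2^-1 * g x y) +i* (- 2^-1 * g (J x) y))%C.
Proof.
rewrite hermitian_compE // (metricJJ g_herm) -[g x (J y)]opprK -gJ.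
by apply/eqP; rewrite eq_complex /=; apply/andP; split; apply/eqP; field.
Qed.

Lemma hermitian_metric_sesquilinear : sesquilinear h.
Proof.
have l1 := metric_lin1 g_herm; have l2 := metric_lin2 g_herm.
split=> [a u v y|a u v x|x y|x y]; rewrite !hermitian_metricE ?linearP ?JJ.
- by rewrite !l1; simpc; congr (_ +i* _)%C; ring.
- by rewrite !l2; simpc; congr (_ +i* _)%C; ring.
- by rewrite (metricNl g_herm); simpc; congr (_ +i* _)%C; ring.
- by rewrite (metricJJ g_herm) -[g x (J y)]opprK -gJ; simpc; congr (_ +i* _)%C; ring.
Qed.

(** [h] is half of the usual Hermitian form, so its inverse carries a factor 2; this factor is
    supplied by the real frame [e], which has twice as many vectors as the complex frame. *)
Lemma inv_compE k l :
  inv_comp J g f k l = \sum_a c k (e a) * (c l (e a))^*%C.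
Proof.
pose K : 'M[R[i]]_m := \matrix_(l, k) \sum_a c k (e a) * (c l (e a))^*%C.
have inv : herm_comp J f g *m K = 1%:M.
  apply/matrixP => j k'; rewrite !mxE.
  transitivity (\sum_a c k' (e a) * h (tnth f j) (e a)).
    under eq_bigr => l' _ do rewrite !mxE mulr_sumr.
    rewrite exchange_big; apply: eq_bigr => a _ /=.
    rewrite (sesquilinear_expandr _ (e a) hermitian_metric_sesquilinear) mulr_sumr.
    by apply: eq_bigr => l' _; rewrite [LHS]mulrC mulrA.
  have lk := complex_coord_lin k'.
  have expand v : c k' v = \sum_a (g v (e a) +i* 0)%C * c k' (e a).
    have c0 : c k' 0 = 0 by rewrite /c !linear0.
    have cD u w : c k' (u + w) = c k' u + c k' w.
      by rewrite -[u]scale1r lk (_ : (1 +i* 0)%C = 1) // mul1r scale1r.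
    case: (e_orth) => _ /(_ v) {1}->.
    rewrite (big_morph _ cD c0); apply: eq_bigr => a _.
    by rewrite -[_ *: _]addr0 lk c0 addr0.
  transitivity ((2^-1 +i* 0)%C * c k' (tnth f j) +
    (0 +i* - 2^-1)%C * c k' (J (tnth f j))).
    rewrite (expand (tnth f j)) (expand (J _)) !mulr_sumr -big_split.
    apply: eq_bigr => a _ /=; rewrite hermitian_metricE [LHS]mulrC !mulrA -mulrDl.
    by congr (_ * _); simpc.
  rewrite complex_coord_frame complex_coord_frameJ eq_sym.
  by case: (j == k') => /=; simpc; congr (_ +i* _)%C; field.
have [u _] := mulmx1_unit inv.
rewrite /inv_comp; have -> : invmx (herm_comp J f g) = K.
  by rewrite -[LHS]mulmx1 -inv mulKmx.
by rewrite mxE.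
Qed.

(** Turns contractions with the inverse metric in an arbitrary complex frame into traces over the
    real orthonormal frame, where the Chern identities are stated. *)
Lemma sesquilinear_trace D : sesquilinear D ->
  \sum_k \sum_l inv_comp J g f k l * D (tnth f k) (tnth f l) = \sum_a D (e a) (e a).
Proof.
move=> sD; under [RHS]eq_bigr => a _ do rewrite (sesquilinear_expand _ _ sD).
rewrite [RHS]exchange_big; apply: eq_bigr => k _ /=.
rewrite [RHS]exchange_big; apply: eq_bigr => l _ /=.
by rewrite inv_compE mulr_suml.
Qed.

Lemma hermitian_metric_trace u v :
  \sum_a (h v (e a))^*%C * h u (e a) = h u v.
Proof.
have tr a b : \sum_k g a (e k) * g b (e k) = g a b.
  by rewrite (frame_contract _ e_orth (metric_lin2 g_herm b)) (metricC g_herm).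
transitivity (\sum_a ((4^-1 * (g v (e a) * g u (e a)) +
    4^-1 * (g (J v) (e a) * g (J u) (e a))) +i*
  (- 4^-1 * (g v (e a) * g (J u) (e a)) + 4^-1 * (g (J v) (e a) * g u (e a))))%C).
  apply: eq_bigr => a _; rewrite !hermitian_metricE; simpc.
  by congr (_ +i* _)%C; field.
rewrite sum_complex !big_split -!mulr_sumr /= !tr hermitian_metricE.
rewrite (metricJJ g_herm) gJ -[g v (J u)]opprK -gJ (metricC g_herm v).
rewrite -[g (J v) u]opprK gJ opprK (metricC g_herm (J u)).
by congr (_ +i* _)%C; field.
Qed.

End Sesquilinear.

Section TorsionTrace.
Context {R : realType} {V : vectType R} (J : 'End(V)) (g : V -> V -> R).
Context (n : nat) (e : 'I_n -> V) (m : nat) (f : m.-tuple V) (T : V -> V -> V).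
Hypothesis JJ : forall x, J (J x) = - x.
Hypothesis g_herm : hermitian_metric J g.
Hypothesis e_orth : orthonormal_frame g e.
Hypothesis f_frame : complex_frame J f.
Hypothesis T_bil : bilinear_op T.
Hypothesis T_Jr : forall x y, T x (J y) = J (T x y).
Hypothesis T_Jl : forall x y, T (J x) y = J (T x y).

Local Notation h := (hermitian_comp J).
Let gE := (metricDl g_herm, metricDr g_herm, metricNl g_herm, metricNr g_herm,
  metricZl g_herm, metricZr g_herm).
Let gJ := (metric_J g_herm JJ).
Let linT := (opDl T_bil, opDr T_bil, opZl T_bil, opZr T_bil, opNl T_bil, opNr T_bil,
  T_Jl, T_Jr).

Let part10_tors x y : opC T (part10 J x) (part10 J y) = part10 J (T x y).
Proof.
rewrite /opC /part10 /=; congr pair; apply: (metric_ext g_herm) => w;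
  rewrite ?(linT, gE, gJ, JJ); by field.
Qed.

Let tors_compE x y z : formC g (opC T (part10 J x) (part10 J y))
  (conjV (part10 J z)) = h g (T x y) z.
Proof. by rewrite part10_tors. Qed.

Let tors_comp_barE x y z : formC g (opC T (conjV (part10 J x)) (conjV (part10 J y)))
  (part10 J z) = ((h g (T x y) z)^*)%C.
Proof.
rewrite -tors_compE /formC /opC /conjV /part10 /=.
rewrite !opprK; apply/eqP; rewrite eq_complex /=; apply/andP; split; apply/eqP;
  rewrite ?(linT, gE, gJ, JJ); by ring.
Qed.

Lemma hermitian_square_trace (i j : 'I_m) :
  \sum_k \sum_l \sum_p \sum_q inv_comp J g f k l * inv_comp J g f p q *
    formC g (opC T (part10 J (tnth f i)) (part10 J (tnth f k)))
      (conjV (part10 J (tnth f q))) *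
    formC g (opC T (conjV (part10 J (tnth f j))) (conjV (part10 J (tnth f l))))
      (part10 J (tnth f p)) =
  h (fun x y => \sum_a g (T x (e a)) (T y (e a))) (tnth f i) (tnth f j).
Proof.
have sq_bil : bilinear_form (fun x y => \sum_a g (T x (e a)) (T y (e a))).
  split=> a x y z; rewrite mulr_sumr -big_split;
    apply: eq_bigr => k _ /=; rewrite !(linT, gE); ring.
have [h1 h2 h3 h4] := hermitian_metric_sesquilinear JJ g_herm.
have inner u v : \sum_p \sum_q inv_comp J g f p q *
    (((h g v (tnth f p))^*)%C * h g u (tnth f q)) = h g u v.
  have sD : sesquilinear J (fun x y => ((h g v x)^*)%C * h g u y).
    split=> [a x y z|a x y z|x y|x y].
    - by rewrite h2 rmorphD rmorphM /= oppr0 mulrDl mulrA.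
    - by rewrite h2 mulrDr mulrCA.
    - by rewrite h4 rmorphM /= opprK mulrA.
    - by rewrite h4 mulrCA.
  rewrite [LHS](sesquilinear_trace JJ f_frame g_herm e_orth sD).
  exact: (hermitian_metric_trace JJ g_herm e_orth).
have sD : sesquilinear J (fun x y => h g (T (tnth f i) x) (T (tnth f j) y)).
  split=> [a x y z|a x y z|x y|x y]; rewrite !linT.
  - by rewrite h1.
  - by rewrite h2.
  - by rewrite h3.
  - by rewrite h4.
transitivity (\sum_k \sum_l inv_comp J g f k l *
    h g (T (tnth f i) (tnth f k)) (T (tnth f j) (tnth f l))).
  apply: eq_bigr => k _; apply: eq_bigr => l _; rewrite -inner mulr_sumr.
  apply: eq_bigr => p _; rewrite mulr_sumr; apply: eq_bigr => q _.
  by rewrite tors_compE tors_comp_barE -!mulrA [h g _ _ * _]mulrC.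
rewrite [LHS](sesquilinear_trace JJ f_frame g_herm e_orth sD).
rewrite hermitian_compE // -big_split -sumrB !mulr_sumr -sum_complex.
apply: eq_bigr => a _; rewrite hermitian_compE; last by case: g_herm.
by rewrite !linT.
Qed.

End TorsionTrace.

Section Components.
Context {R : realType} {V : vectType R} (br : V -> V -> V) (J : 'End(V)).
Context (g : V -> V -> R) (n : nat) (e : 'I_n -> V).
Hypothesis br_lie : lie_bracket br.
Hypothesis J_cplx : complex_structure br J.
Hypothesis g_herm : hermitian_metric J g.
Hypothesis e_orth : orthonormal_frame g e.

Local Notation N := (chern_op br J g e).

Let N_chern := chern_op_chern br_lie J_cplx g_herm e_orth.
Let N_bil : bilinear_op N. Proof. by case: N_chern. Qed.
Let NJ x y : N x (J y) = J (N x y). Proof. by case: N_chern. Qed.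
Let linE := (linE br_lie g_herm).
Let linN := (opDl N_bil, opDr N_bil, opZl N_bil, opZr N_bil, opNl N_bil, opNr N_bil).
Let JJ := (JJ J_cplx).
Let gJ := (metric_J g_herm JJ).

Let r x y z w := g (N x (N y z) - N y (N x z) - N (br x y) z) w.

Context (m : nat) (f : m.-tuple V).
Hypothesis f_frame : complex_frame J f.
Local Notation h := (hermitian_comp J).

Let curv i j x y : R[i] := formC g (curvC br N (part10 J x) (conjV (part10 J y))
  (part10 J i)) (conjV (part10 J j)).

(** The four factors 1/2 of [part10] give 1/16; since the curvature commutes with [J], the terms
    agree in pairs, which leaves 1/8. *)
Let curvE i j x y : curv i j x y =
  ((8^-1 * (r x y i j + r (J x) (J y) i j + r x (J y) (J i) j - r (J x) y (J i) j)) +i*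
   (8^-1 * (r x (J y) i j - r (J x) y i j - r x y (J i) j - r (J x) (J y) (J i) j)))%C.
Proof.
rewrite /curv /formC /curvC /opC /part10 /conjV /r /= !opprK.
apply/eqP; rewrite eq_complex /=; apply/andP; split; apply/eqP;
  rewrite ?(linE, linN, NJ, gJ, JJ); by field.
Qed.

Let curv_sesquilinear i j : sesquilinear J (curv i j).
Proof.
by split=> *; rewrite !curvE /r; simpc; congr (_ +i* _)%C;
  rewrite ?(linE, linN, NJ, gJ, JJ); field.
Qed.

Let r_skew x y z w : r x y z w = - r y x z w.
Proof. by rewrite /r (brC br_lie x y) ?(linE, linN); ring. Qed.

Lemma S_compE i j : S_comp br J g N f i j =
  h (chern_ricci br J g e) (tnth f i) (tnth f j).
Proof.
have ricci_bil : bilinear_form (chern_ricci br J g e).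
  split=> a x y z; rewrite /chern_ricci [a * _]mulrCA -mulrDr; congr (_ * _);
    rewrite mulr_sumr -big_split; apply: eq_bigr => k _ /=;
    rewrite ?(linE, linN); ring.
rewrite mxE; transitivity (\sum_a curv (tnth f i) (tnth f j) (e a) (e a)).
  exact: (sesquilinear_trace JJ f_frame g_herm e_orth (curv_sesquilinear _ _)).
have r0 x z w : r x x z w = 0 by have := r_skew x x z w => ?; lra.
have rJ x y z w : r x y (J z) w = - r x y z (J w).
  by rewrite /r ?(linE, linN, NJ, gJ); ring.
have sE x y : chern_ricci br J g e x y = \sum_a 2^-1 * r (e a) (J (e a)) (J x) y.
  by rewrite /chern_ricci mulr_sumr.
under [LHS]eq_bigr => a _ do rewrite curvE !r0.
rewrite sum_complex hermitian_compE // !sE -sumrB -big_split !mulr_sumr /=.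
congr (_ +i* _)%C; apply: eq_bigr => a _;
  rewrite (r_skew (J (e a)) (e a)) !rJ !JJ /r ?(linE, linN, NJ, gJ, JJ); by field.
Qed.

Local Notation T := (torsion br N).

Let TJ x y : T x (J y) = J (T x y) /\ T (J x) y = J (T x y).
Proof.
have TE u v w : g (T u v) w = - chern_defect br J g w u v.
  by rewrite /torsion !linE !(chern_opE br_lie g_herm e_orth)
    (chern_defect_torsion br_lie J_cplx g_herm).
split; apply: (metric_ext g_herm) => w; rewrite gJ !TE.
  by rewrite (chern_defectJ1 br_lie J_cplx g_herm) opprK.
by rewrite (chern_defectJ1 br_lie J_cplx g_herm) (chern_defectJ br_lie J_cplx g_herm) opprK.
Qed.

Let T_bil : bilinear_op T.
Proof.
by split=> a x y z; apply: (metric_ext g_herm) => w; rewrite /torsion !(linE, linN); ring.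
Qed.

Lemma Q_compE i j : Q_comp br J g N f i j =
  h (torsion_square br J g e) (tnth f i) (tnth f j).
Proof.
rewrite mxE; apply: (hermitian_square_trace JJ g_herm e_orth f_frame T_bil).
  by move=> x y; case: (TJ x y).
by move=> x y; case: (TJ x y).
Qed.

Hypothesis g_SKT : SKT br J g.

Lemma velocity_comp :
  herm_comp J f (velocity br J g e) = - S_comp br J g N f + Q_comp br J g N f.
Proof.
apply/matrixP => i j; rewrite [RHS]mxE [X in X + _]mxE S_compE Q_compE mxE.
rewrite /hermitian_comp /formC.
rewrite !(velocity_chern br_lie J_cplx g_herm e_orth g_SKT).
by apply/eqP; rewrite eq_complex /=; apply/andP; split; apply/eqP; ring.
Qed.

End Components.

(** * The flow as an ordinary differential equation *)

(** The axioms hold for commutators of derivations and are transported back by [la_field_inj]. *)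
Lemma lie_algebra_bracket (R : realType) (n : nat) (G : lie_group R n)
  (Lie : lie_algebra_of G) : lie_bracket (@la_bracket R n G Lie).
Proof.
have smooth (u : Lie) f : smooth_fun f -> smooth_fun (la_field u f).
  by move=> sf; case: (la_fieldP u) => -[+ _ _] _; exact.
have lin (u : Lie) (a : R) f h x : smooth_fun f -> smooth_fun h ->
    la_field u (fun y => a * f y + h y) x = a * la_field u f x + la_field u h x.
  by move=> sf sh; case: (la_fieldP u) => -[_ + _] _; exact.
have linv (a : R) (u v : Lie) f : smooth_fun f ->
    la_field (a *: u + v) f = (fun x => a * la_field u f x + la_field v f x).
  by move=> sf; apply/funext => x; exact: la_field_linear.
have brE (u v : Lie) f : smooth_fun f -> la_field (la_bracket u v) f =
    (fun x => -1 * la_field v (la_field u f) x + la_field u (la_field v f) x).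
  by move=> sf; apply/funext => x; rewrite la_bracketE // mulN1r addrC.
have zero f : smooth_fun f -> la_field (0 : Lie) f = (fun=> 0).
  move=> sf; have := linv (-1) (0 : Lie) 0 f sf.
  by rewrite scaler0 addr0 => ->; apply/funext => x; ring.
split.
- split=> a x y z; apply: la_field_inj => f sf p.
  + have sz := smooth z f sf; rewrite linv // !brE // (linv _ _ _ _ sz).
    rewrite (linv _ _ _ f sf) lin; [ring | exact: smooth | exact: smooth].
  + have sz := smooth x f sf; rewrite linv // !brE // (linv _ _ _ _ sz).
    rewrite (linv _ _ _ f sf) lin; [ring | exact: smooth | exact: smooth].
- move=> x y; apply: la_field_inj => f sf p.
  have := linv (-1) (la_bracket y x) 0 f sf; rewrite scaleN1r addr0 => ->.
  by rewrite !brE // zero //; ring.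
move=> x y z; apply: la_field_inj => f sf p.
have addE (u v : Lie) : la_field (u + v) f = (fun q => 1 * la_field u f q + la_field v f q).
  by rewrite -[u]scale1r linv // scale1r.
rewrite !addE zero //.
have E (u v w : Lie) : la_field (la_bracket (la_bracket u v) w) f p =
   - (- la_field w (la_field v (la_field u f)) p + la_field w (la_field u (la_field v f)) p) +
   (- la_field v (la_field u (la_field w f)) p + la_field u (la_field v (la_field w f)) p).
  rewrite (brE _ _ _ sf) (brE _ _ _ sf) (brE _ _ _ (smooth w f sf)) lin.
  - by ring.
  - exact/smooth/smooth.
  - exact/smooth/smooth.
by rewrite !E; ring.
Qed.

Section FrameFlow.
Context {R : realType} {V : vectType R} (br : V -> V -> V) (J : 'End(V)).
Context (g0 : V -> V -> R) (n : nat) (eps : 'I_n -> V).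
Hypothesis br_lie : lie_bracket br.
Hypothesis g0_herm : hermitian_metric J g0.
Hypothesis eps_orth : orthonormal_frame g0 eps.

(* (true, i, j) indexes the entries of the matrix of a moving frame in the
   frame eps, (false, i, j) those of the inverse matrix. *)
Definition frame_index : finType := (bool * 'I_n * 'I_n)%type.

Implicit Types y : frame_index -> R.

Definition frame y (i : 'I_n) : V := \sum_j y (true, i, j) *: eps j.

Definition coframe y (i : 'I_n) (x : V) : R :=
  \sum_j g0 x (eps j) * y (false, j, i).

(** The metric for which the moving frame is orthonormal, as long as the two stored matrices are
    inverse to each other. Written with the coframe, it is polynomial in [y]. *)
Definition frame_metric y (u v : V) : R := \sum_i coframe y i u * coframe y i v.

Definition frame_velocity y (i j : 'I_n) : R :=
  velocity br J (frame_metric y) (frame y) (frame y i) (frame y j).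

(* e_i' = - 1/2 P^# e_i, and dually for the inverse matrix. *)
Definition frame_field (k : frame_index) y : R :=
  let: (b, i, j) := k in
  if b then \sum_s - 2^-1 * (frame_velocity y i s * y (true, s, j))
  else \sum_s 2^-1 * (y (false, i, s) * frame_velocity y s j).

Let vlip (u : (frame_index -> R) -> V) :=
  forall j, loc_lipschitz (fun y => g0 (u y) (eps j)).

Let g1 := metric_lin1 g0_herm.

Let vlip_sum (F : 'I_n -> (frame_index -> R) -> V) :
  (forall i, vlip (F i)) -> vlip (fun y => \sum_i F i y).
Proof.
move=> hF j; under eq_fun do rewrite (linform_sum _ _ _ (g1 _)).
by apply: loc_lipschitz_sum => i; exact: hF.
Qed.

Let vlip_frame i : vlip (fun y => frame y i).
Proof.
apply: vlip_sum => k j; under eq_fun do rewrite (metricZl g0_herm).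
by apply: loc_lipschitzM; [exact: loc_lipschitz_proj | exact: loc_lipschitz_cst].
Qed.

Let vlip_J u : vlip u -> vlip (fun y => J (u y)).
Proof.
move=> hu j.
have lJ : linform (fun v => g0 (J v) (eps j)) by move=> a v w; rewrite linearP g1.
under eq_fun do rewrite -(frame_contract (u _) eps_orth lJ).
by apply: loc_lipschitz_sum => k; apply: loc_lipschitzM => //; exact: loc_lipschitz_cst.
Qed.

Let vlip_br u v : vlip u -> vlip v -> vlip (fun y => br (u y) (v y)).
Proof.
move=> hu hv j.
have l1 w : linform (fun x => g0 (br x w) (eps j)).
  by move=> a x z; rewrite (br_lin1 br_lie) g1.
have l2 w : linform (fun x => g0 (br w x) (eps j)).
  by move=> a x z; rewrite (br_lin2 br_lie) g1.
under eq_fun do rewrite -(frame_contract (u _) eps_orth (l1 _)).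
apply: loc_lipschitz_sum => k; apply: loc_lipschitzM => //.
under eq_fun do rewrite -(frame_contract (v _) eps_orth (l2 _)).
by apply: loc_lipschitz_sum => l; apply: loc_lipschitzM => //; exact: loc_lipschitz_cst.
Qed.

Let lip_metric u v : vlip u -> vlip v ->
  loc_lipschitz (fun y => frame_metric y (u y) (v y)).
Proof.
move=> hu hv; apply: loc_lipschitz_sum => i; apply: loc_lipschitzM;
  by apply: loc_lipschitz_sum => j; apply: loc_lipschitzM => //; exact: loc_lipschitz_proj.
Qed.

Let lip_gtors (s1 s2 s3 : R) u v w : vlip u -> vlip v -> vlip w ->
  loc_lipschitz (fun y => gtors br J (frame_metric y) s1 s2 s3 (u y) (v y) (w y)).
Proof.
move=> hu hv hw; apply: loc_lipschitzZ; apply: loc_lipschitzD.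
  apply: loc_lipschitzD; first apply: loc_lipschitzD.
  - by apply: loc_lipschitzZ; apply: lip_metric => //; exact: vlip_br.
  - by apply: loc_lipschitzZ; apply: lip_metric => //; exact: vlip_br.
  - by apply: loc_lipschitzZ; apply: lip_metric => //; exact: vlip_br.
apply: loc_lipschitzN; apply: loc_lipschitzD; first apply: loc_lipschitzD.
- by apply: lip_metric => //; apply: vlip_br; exact: vlip_J.
- by apply: lip_metric => //; apply: vlip_br; exact: vlip_J.
- by apply: lip_metric => //; apply: vlip_br; exact: vlip_J.
Qed.

Lemma frame_field_loc_lipschitz k : loc_lipschitz (frame_field k).
Proof.
have lip_ricci u : vlip u ->
    loc_lipschitz (fun y => ricci_trace br J (frame_metric y) (frame y) (u y)).
  move=> hu; apply: loc_lipschitzZ; apply: loc_lipschitz_sum => i.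
  by apply: lip_gtors => //; apply: vlip_J.
have lip_vel i j : loc_lipschitz (fun y => frame_velocity y i j).
  apply: loc_lipschitzZ; apply: loc_lipschitzD; apply: lip_ricci;
    by apply: vlip_br => //; apply: vlip_J.
case: k => -[[] i] j; apply: loc_lipschitz_sum => s; apply: loc_lipschitzZ;
  by apply: loc_lipschitzM => //; exact: loc_lipschitz_proj.
Qed.

Definition frame_start (k : frame_index) : R := (k.1.2 == k.2)%:R.

Lemma frame_start_frame i : frame frame_start i = eps i.
Proof.
rewrite /frame (bigD1 i) //= big1 => [|j ji].
  by rewrite /frame_start /= eqxx scale1r addr0.
by rewrite /frame_start /= eq_sym (negPf ji) scale0r.
Qed.

Lemma frame_start_metric u v : frame_metric frame_start u v = g0 u v.
Proof.
have E i x : coframe frame_start i x = g0 x (eps i).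
  rewrite /coframe (bigD1 i) //= big1 => [|j ji].
    by rewrite /frame_start /= eqxx mulr1 addr0.
  by rewrite /frame_start /= (negPf ji) mulr0.
rewrite /frame_metric; under eq_bigr do rewrite !E.
by rewrite (frame_contract u eps_orth (metric_lin2 g0_herm v)) (metricC g0_herm).
Qed.

End FrameFlow.

(** * Frame and metric along a solution *)

Section AlongSolution.
Context {R : realType} {V : vectType R} (br : V -> V -> V) (J : 'End(V)).
Context (g0 : V -> V -> R) (n : nat) (eps : 'I_n -> V).
Hypothesis br_lie : lie_bracket br.
Hypothesis J_cplx : complex_structure br J.
Hypothesis g0_herm : hermitian_metric J g0.
Hypothesis eps_orth : orthonormal_frame g0 eps.

Context (T : R) (y : R -> @frame_index n -> R).
Hypothesis y_sol : solution_on (frame_field br J g0 eps) (@frame_start R n) T y.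

Local Notation g t := (frame_metric g0 eps (y t)).
Local Notation e t i := (frame eps (y t) i).
Local Notation cof t i x := (coframe g0 eps (y t) i x).
Local Notation P t := (velocity br J (g t) (frame eps (y t))).
Local Notation M t i j := (P t (e t i) (e t j)).

Let g1 := metric_lin1 g0_herm.

Let ydot i (t : R) : 0 <= t <= T -> is_derive t 1 (y ^~ i) (frame_field br J g0 eps i (y t)).
Proof. by case: y_sol => _; exact. Qed.

Let yE (t : R) : 0 <= t <= T -> y 0 = @frame_start R n.
Proof. by move=> _; apply/funext => i; case: y_sol. Qed.

(** With E the frame matrix and D the other one, the derivative of D E is 1/2 D P E - 1/2 D P E =
    0. *)
Lemma frame_inverse (t : R) i j : 0 <= t <= T ->
  \sum_s y t (false, i, s) * y t (true, s, j) = (i == j)%:R.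
Proof.
move=> tT; have [t0 _] := andP tT.
have -> : (i == j)%:R = \sum_s y 0 (false, i, s) * y 0 (true, s, j).
  rewrite (yE tT) (bigD1 i) //= big1 => [|k ki].
    by rewrite /frame_start /= eqxx mul1r addr0.
  by rewrite /frame_start /= eq_sym (negPf ki) mul0r.
apply/esym/(is_derive0_eq (f := fun t => \sum_s y t (false, i, s) * y t (true, s, j))) => //.
move=> r /andP[r0 rt].
have rT : 0 <= r <= T by rewrite r0; case/andP: tT => _; exact: le_trans.
have Z : \sum_s (frame_field br J g0 eps (false, i, s) (y r) * y r (true, s, j)
    + y r (false, i, s) * frame_field br J g0 eps (true, s, j) (y r)) = 0.
  rewrite big_split /=; under eq_bigr do rewrite mulr_suml.
  under [X in _ + X]eq_bigr do rewrite mulr_sumr.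
  rewrite exchange_big -big_split big1 // => k _ /=.
  by rewrite -big_split big1 // => l _ /=; ring.
by rewrite -[X in is_derive _ _ _ X]Z; apply: der_sum => s _; apply: derM; exact: ydot.
Qed.

Lemma frame_inverse' t i j : 0 <= t <= T ->
  \sum_s y t (true, i, s) * y t (false, s, j) = (i == j)%:R.
Proof.
move=> tT; pose E : 'M[R]_n := \matrix_(i, j) y t (true, i, j).
pose D : 'M[R]_n := \matrix_(i, j) y t (false, i, j).
have : D *m E = 1%:M.
  apply/matrixP => k l; rewrite !mxE -(frame_inverse k l tT).
  by apply: eq_bigr => s _; rewrite !mxE.
move=> /mulmx1C /matrixP /(_ i j); rewrite !mxE => <-.
by apply: eq_bigr => s _; rewrite !mxE.
Qed.

Lemma coframe_lin t i : linform (fun x => cof t i x).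
Proof.
move=> a u v; rewrite /coframe mulr_sumr -big_split; apply: eq_bigr => j _ /=.
by rewrite g1; ring.
Qed.

Lemma frame_coord t i j : g0 (e t i) (eps j) = y t (true, i, j).
Proof.
rewrite /frame (linform_sum _ _ _ (g1 _)) (bigD1 j) //= big1 => [|k kj].
  by rewrite (metricZl g0_herm); case: eps_orth => -> _; rewrite eqxx mulr1 addr0.
by rewrite (metricZl g0_herm); case: eps_orth => -> _; rewrite (negPf kj) mulr0.
Qed.

Lemma coframe_frame t i j : 0 <= t <= T -> cof t j (e t i) = (i == j)%:R.
Proof.
move=> tT; rewrite -(frame_inverse' i j tT); apply: eq_bigr => s _.
by rewrite frame_coord.
Qed.

Lemma frame_expand t x : 0 <= t <= T -> x = \sum_i cof t i x *: e t i.
Proof.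
move=> tT; case: eps_orth => _ /(_ x) {1}->.
transitivity (\sum_i \sum_j \sum_k
    (g0 x (eps k) * (y t (false, k, i) * y t (true, i, j))) *: eps j).
  rewrite exchange_big; apply: eq_bigr => j _ /=; rewrite exchange_big /=.
  rewrite [RHS](bigD1 j) //= [X in _ = _ + X]big1 => [|k kj].
    by rewrite addr0 -scaler_suml -mulr_sumr frame_inverse // eqxx mulr1.
  by rewrite -scaler_suml -mulr_sumr frame_inverse // (negPf kj) mulr0 scale0r.
apply: eq_bigr => i _; rewrite /frame scaler_sumr; apply: eq_bigr => j _.
rewrite /coframe scalerA mulr_suml scaler_suml; apply: eq_bigr => k _.
by rewrite mulrA.
Qed.

Lemma frame_metric_bilinear t : bilinear_form (g t).
Proof.
split=> a u v w; rewrite /frame_metric mulr_sumr -big_split;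
  by apply: eq_bigr => i _ /=; rewrite (coframe_lin t i a); ring.
Qed.

Lemma frame_metricE t x i : 0 <= t <= T -> g t x (e t i) = cof t i x.
Proof.
move=> tT; rewrite /frame_metric (bigD1 i) //= big1 => [|k ki].
  by rewrite coframe_frame // eqxx mulr1 addr0.
by rewrite coframe_frame // eq_sym (negPf ki) mulr0.
Qed.

Lemma frame_orthonormal t : 0 <= t <= T -> orthonormal_frame (g t) (frame eps (y t)).
Proof.
move=> tT; split=> [i j|x]; first by rewrite frame_metricE // coframe_frame.
rewrite {1}(frame_expand x tT); apply: eq_bigr => i _.
by rewrite frame_metricE.
Qed.

Definition vder (v : R -> V) (t : R) (v' : V) :=
  forall j, is_derive t 1 (fun s => g0 (v s) (eps j)) (g0 v' (eps j)).

Lemma vder_cst v t : vder (fun=> v) t 0.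
Proof. by move=> j; rewrite (linform0 (g1 _)); exact: derC. Qed.

Lemma vder_frame i t : 0 <= t <= T ->
  vder (fun s => e s i) t (\sum_s (- 2^-1 * M t i s) *: e t s).
Proof.
move=> tT j; under eq_fun do rewrite frame_coord.
rewrite (linform_sum _ _ _ (g1 _)) /=.
under eq_bigr do rewrite (metricZl g0_herm) frame_coord -mulrA.
exact: ydot.
Qed.

Lemma vder_bilinear (L : V -> V -> V) u v t u' v' : bilinear_op L ->
  vder u t u' -> vder v t v' ->
  vder (fun s => L (u s) (v s)) t (L u' (v t) + L (u t) v').
Proof.
move=> bL du dv j.
have l1 w : linform (fun x => g0 (L x w) (eps j)).
  by move=> a x z; rewrite (opDl bL) (opZl bL) g1.
have l2 w : linform (fun x => g0 (L w x) (eps j)).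
  by move=> a x z; rewrite (opDr bL) (opZr bL) g1.
have E u1 v1 : g0 (L u1 v1) (eps j) = \sum_k \sum_l
    g0 u1 (eps k) * (g0 v1 (eps l) * g0 (L (eps k) (eps l)) (eps j)).
  rewrite -(frame_contract u1 eps_orth (l1 v1)); apply: eq_bigr => k _.
  by rewrite -(frame_contract v1 eps_orth (l2 (eps k))) mulr_sumr.
under eq_fun do rewrite E.
rewrite (metricDl g0_herm) !E -big_split /=; apply: der_sum => k _.
rewrite -big_split /=; apply: der_sum => l _; apply: derM; first exact: du.
rewrite -[X in is_derive _ _ _ X]addr0.
rewrite -(mulr0 (g0 (v t) (eps l))).
exact: derM (dv l) (derC _ t).
Qed.

Lemma der_coframe v t v' k : 0 <= t <= T -> vder v t v' ->
  is_derive t 1 (fun s => cof s k (v s))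
    (cof t k v' + \sum_s 2^-1 * (cof t s (v t) * M t s k)).
Proof.
move=> tT dv.
have -> : cof t k v' + \sum_s 2^-1 * (cof t s (v t) * M t s k) =
    \sum_j (g0 v' (eps j) * y t (false, j, k) +
      g0 (v t) (eps j) * frame_field br J g0 eps (false, j, k) (y t)).
  rewrite big_split /=; congr (_ + _).
  under [RHS]eq_bigr do rewrite mulr_sumr.
  rewrite exchange_big; apply: eq_bigr => s _ /=.
  rewrite /coframe mulr_suml mulr_sumr; apply: eq_bigr => j _.
  by rewrite /frame_velocity; ring.
by apply: der_sum => j _; apply: derM; [exact: dv | exact: ydot].
Qed.

Let velocity_expand t u v : 0 <= t <= T ->
  P t u v = \sum_i \sum_s cof t i u * (cof t s v * M t i s).
Proof.
move=> tT; have bil := frame_metric_bilinear t.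
rewrite {1}(frame_expand u tT) (linform_sum _ _ _ (velocity_lin1 J _ br_lie bil _)).
apply: eq_bigr => i _; rewrite (linformZ _ _ (velocity_lin1 J _ br_lie bil _)).
rewrite {1}(frame_expand v tT) (linform_sum _ _ _ (velocity_lin2 J _ br_lie bil _)).
rewrite mulr_sumr; apply: eq_bigr => s _.
by rewrite (linformZ _ _ (velocity_lin2 J _ br_lie bil _)).
Qed.

(** This explains the factor 1/2 of the frame equation: each of the two coframe factors of the
    metric contributes one half of [P]. *)
Lemma frame_metric_derive (t : R) u v : 0 <= t <= T ->
  is_derive t 1 (fun s => g s u v) (P t u v).
Proof.
move=> tT.
have -> : P t u v = \sum_i
   ((cof t i 0 + \sum_s 2^-1 * (cof t s u * M t s i)) * cof t i v +
    cof t i u * (cof t i 0 + \sum_s 2^-1 * (cof t s v * M t s i))).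
  rewrite (velocity_expand u v tT).
  transitivity (\sum_i \sum_s 2^-1 * (cof t i u * (cof t s v * M t i s)) +
    \sum_i \sum_s 2^-1 * (cof t i u * (cof t s v * M t i s))).
    rewrite -big_split; apply: eq_bigr => i _ /=; rewrite -big_split.
    by apply: eq_bigr => s _ /=; field.
  rewrite [X in X + _]exchange_big -big_split; apply: eq_bigr => i _ /=.
  rewrite (linform0 (coframe_lin t i)) !add0r mulr_suml mulr_sumr -!big_split /=.
  by apply: eq_bigr => s _; rewrite (velocityC _ _ _ _ (e t s) (e t i)); ring.
apply: der_sum => i _; apply: derM.
  exact: (der_coframe i tT (vder_cst u t)).
exact: (der_coframe i tT (vder_cst v t)).
Qed.

(** Positivity comes from the expansion in the moving frame. J-orthogonality is a conserved
    quantity: by [velocityJJ], [g (J u) (J v) - g u v] has derivative 0. *)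
Lemma frame_metric_hermitian t : 0 <= t <= T -> hermitian_metric J (g t).
Proof.
move=> tT; split.
- exact: frame_metric_bilinear.
- by move=> u v; apply: eq_bigr => i _; rewrite mulrC.
- move=> u u0; rewrite lt_neqAle; apply/andP; split; last first.
    by apply: sumr_ge0 => i _; rewrite -expr2 sqr_ge0.
  apply: contra u0; rewrite eq_sym psumr_eq0 => [/allP cu|i _]; last first.
    by rewrite -expr2 sqr_ge0.
  apply/eqP; rewrite (frame_expand u tT) big1 // => i _.
  have := cu i (mem_index_enum i); rewrite /= mulf_eq0 orbb => /eqP ->.
  by rewrite scale0r.
move=> u v; apply/eqP; rewrite -subr_eq0; apply/eqP.
have [t0 _] := andP tT.
rewrite -(is_derive0_eq (f := fun s => g s (J u) (J v) - g s u v) _ t0).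
  by rewrite (yE tT) !(frame_start_metric g0_herm eps_orth) (metricJJ g0_herm) subrr.
move=> r /andP[r0 rt].
have rT : 0 <= r <= T by rewrite r0; case/andP: tT => _; exact: le_trans.
rewrite -(subrr (P r u v)); apply: derB; last exact: frame_metric_derive.
rewrite -(velocityJJ _ br_lie J_cplx (frame_metric_bilinear r)).
exact: frame_metric_derive.
Qed.

End AlongSolution.

(** * Preservation of SKT, monotonicity of the functional, bound on the bracket *)

Section APriori.
Context {R : realType} {V : vectType R} (br : V -> V -> V) (J : 'End(V)).
Context (g0 : V -> V -> R) (n : nat) (eps : 'I_n -> V).
Hypothesis br_lie : lie_bracket br.
Hypothesis J_cplx : complex_structure br J.
Hypothesis g0_herm : hermitian_metric J g0.
Hypothesis eps_orth : orthonormal_frame g0 eps.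
Hypothesis g0_SKT : SKT br J g0.

Context (T : R) (y : R -> @frame_index n -> R).
Hypothesis y_sol : solution_on (frame_field br J g0 eps) (@frame_start R n) T y.

Local Notation g t := (frame_metric g0 eps (y t)).
Local Notation e t i := (frame eps (y t) i).
Local Notation cof t i x := (coframe g0 eps (y t) i x).
Local Notation P t := (velocity br J (g t) (frame eps (y t))).
Local Notation M t i j := (P t (e t i) (e t j)).

Let herm t (tT : 0 <= t <= T) :=
  frame_metric_hermitian br_lie J_cplx g0_herm eps_orth y_sol tT.
Let orth t (tT : 0 <= t <= T) := frame_orthonormal g0_herm eps_orth y_sol tT.
Let bil t := frame_metric_bilinear eps g0_herm y t.

Let start_frame : frame eps (y 0) = eps.
Proof.
apply/funext => i; have -> : y 0 = @frame_start R n.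
  by apply/funext => k; case: y_sol.
exact: frame_start_frame.
Qed.

Let start_metric : g 0 = g0.
Proof.
apply/funext => u; apply/funext => v; have -> : y 0 = @frame_start R n.
  by apply/funext => k; case: y_sol.
exact: (frame_start_metric g0_herm eps_orth).
Qed.

Lemma tors3_derive t u v w : 0 <= t <= T ->
  is_derive t 1 (fun s => tors3 br J (g s) u v w) (tors3 br J (P t) u v w).
Proof.
move=> tT; have d a b := frame_metric_derive br_lie g0_herm eps_orth y_sol a b tT.
exact: derN (derD (derD (d _ _) (d _ _)) (d _ _)).
Qed.

Lemma frame_metric_SKT t : 0 <= t <= T -> SKT br J (g t).
Proof.
move=> tT u v w z; have [t0 _] := andP tT.
apply/eqP; rewrite -oppr_eq0; apply/eqP.
rewrite -(ext_d3_tors3 br_lie J_cplx (herm tT)).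
rewrite -(is_derive0_eq (f := fun s => ext_d3 br (tors3 br J (g s)) u v w z) _ t0).
  by rewrite start_metric (ext_d3_tors3 br_lie J_cplx g0_herm) g0_SKT oppr0.
move=> r /andP[r0 rt].
have rT : 0 <= r <= T by rewrite r0; case/andP: tT => _; exact: le_trans.
have Z : ext_d3 br (tors3 br J (P r)) u v w z = 0.
  have E a b c := tors3_velocity (frame eps (y r)) br_lie J_cplx (bil r) a b c.
  rewrite /ext_d3 !E; apply: (ext_d3_ext_d2 u v w z br_lie).
    exact: (ricci_potential_lin1 J _ br_lie (bil r)).
  exact: ricci_potentialC.
have d a b c := tors3_derive a b c rT.
rewrite -[X in is_derive _ _ _ X]Z /ext_d3.
exact: derB (derD (derB (derB (derD (derN (d _ _ _)) (d _ _ _)) (d _ _ _))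
  (d _ _ _)) (d _ _ _)) (d _ _ _).
Qed.

Let skt t (tT : 0 <= t <= T) := frame_metric_SKT tT.

(** Applied to [br] and to [brJ], from which H is assembled; both operations are fixed, so their
    components move only with the frame. *)
Let struct (L : V -> V -> V) s i j k : R := cof s k (L (e s i) (e s j)).

Let struct_derive L t i j k : bilinear_op L -> 0 <= t <= T ->
  is_derive t 1 (fun s => struct L s i j k) (\sum_p
   (- 2^-1 * (M t i p * struct L t p j k) - 2^-1 * (M t j p * struct L t i p k)
    + 2^-1 * (M t k p * struct L t i j p))).
Proof.
move=> bL tT.
have dv := vder_bilinear g0_herm eps_orth bL
  (vder_frame g0_herm eps_orth y_sol i tT) (vder_frame g0_herm eps_orth y_sol j tT).
have dc := der_coframe y_sol k tT dv.
have lc := coframe_lin eps g0_herm y t k.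
have l1 w : linform (fun x => cof t k (L x w)).
  by move=> a x z; rewrite (opDl bL) (opZl bL) lc.
have l2 w : linform (fun x => cof t k (L w x)).
  by move=> a x z; rewrite (opDr bL) (opZr bL) lc.
apply: is_derive_eq dc _; rewrite (linformD _ _ lc).
rewrite (linform_sum _ _ _ (l1 _)) (linform_sum _ _ _ (l2 _)) -!big_split /=.
apply: eq_bigr => p _; rewrite (linformZ _ _ (l1 _)) (linformZ _ _ (l2 _)) /struct.
by rewrite (velocityC _ _ _ _ (e t k)); ring.
Qed.

Let brJ u v := br (J u) (J v).

Let br_bil : bilinear_op br. Proof. by case: br_lie. Qed.

Let brJ_bil : bilinear_op brJ.
Proof. by split=> a u v w; rewrite /brJ linearP ?(br_lin1 br_lie) ?(br_lin2 br_lie). Qed.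

Let C s := struct br s.
Let H s i j k : R := - (struct brJ s i j k + struct brJ s j k i + struct brJ s k i j).

Let CE t i j k : 0 <= t <= T -> C t i j k = g t (br (e t i) (e t j)) (e t k).
Proof. by move=> tT; rewrite (frame_metricE g0_herm eps_orth y_sol). Qed.

Let HE t i j k : 0 <= t <= T -> H t i j k = tors3 br J (g t) (e t i) (e t j) (e t k).
Proof. by move=> tT; rewrite /tors3 !(frame_metricE g0_herm eps_orth y_sol). Qed.

Let gtors_arrayE t s1 s2 s3 i j k : 0 <= t <= T -> gtors_array (C t) (H t) s1 s2 s3 i j k =
  gtors br J (g t) s1 s2 s3 (e t i) (e t j) (e t k).
Proof. by move=> tT; rewrite /gtors_array /gtors !CE // HE. Qed.

Let C' t i j k : R := \sum_p
   (- 2^-1 * (M t i p * C t p j k) - 2^-1 * (M t j p * C t i p k)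
    + 2^-1 * (M t k p * C t i j p)).

Let CJ' t i j k : R := \sum_p
   (- 2^-1 * (M t i p * struct brJ t p j k) - 2^-1 * (M t j p * struct brJ t i p k)
    + 2^-1 * (M t k p * struct brJ t i j p)).

Let H' t i j k : R := - (CJ' t i j k + CJ' t j k i + CJ' t k i j).

Let gtors_array_derive t s1 s2 s3 i j k : 0 <= t <= T ->
  is_derive t 1 (fun s => gtors_array (C s) (H s) s1 s2 s3 i j k)
    (gtors_array (C' t) (H' t) s1 s2 s3 i j k).
Proof.
move=> tT.
have dC a b c : is_derive t 1 (fun s => C s a b c) (C' t a b c).
  exact: (struct_derive a b c br_bil tT).
have dJ a b c : is_derive t 1 (fun s => struct brJ s a b c) (CJ' t a b c).
  exact: (struct_derive a b c brJ_bil tT).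
have dH : is_derive t 1 (fun s => H s i j k) (H' t i j k).
  exact: derN (derD (derD (dJ _ _ _) (dJ _ _ _)) (dJ _ _ _)).
exact: derZ (derD (derD (derD (derZ s3 (dC _ _ _)) (derZ s2 (dC _ _ _)))
  (derZ s1 (dC _ _ _))) dH).
Qed.

Let pfun s i j k := gtors_array (C s) (H s) 1 1 1 i j k.
Let mfun s i j k := gtors_array (C s) (H s) 1 1 (-1) i j k.
Let Ffun s : R := \sum_i \sum_j \sum_k
  (pfun s i j k * pfun s i j k - 3 * (mfun s i j k * mfun s i j k)).

Let FfunE t : 0 <= t <= T -> Ffun t = functional br J (g t) (frame eps (y t)).
Proof.
move=> tT; apply: eq_bigr => i _; apply: eq_bigr => j _; apply: eq_bigr => k _.
by rewrite /pfun /mfun !gtors_arrayE // !expr2.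
Qed.

Local Notation G t i j := (gradient br J (g t) (frame eps (y t)) (e t i) (e t j)).

(** On fixed vectors H moves by d of [ricci_potential] ([tors3_velocity]); the moving frame adds the
    terms in [M]. This is the form that [gradient_sum] expects. *)
Let H'E t i j k : 0 <= t <= T ->
  let b := ricci_potential br J (g t) (frame eps (y t)) in
  H' t i j k = \sum_s (- 2^-1 *
     (M t i s * H t s j k + M t j s * H t i s k + M t k s * H t i j s)
     - (C t i j s * b (e t s) (e t k) + C t j k s * b (e t s) (e t i)
        + C t k i s * b (e t s) (e t j))).
Proof.
move=> tT b.
have b1 : forall v, linform (b ^~ v).
  exact: (ricci_potential_lin1 J (frame eps (y t)) br_lie (bil t)).
have cb u v : \sum_s cof t s u * b (e t s) v = b u v.
  rewrite -(frame_contract u (orth tT) (b1 v)); apply: eq_bigr => s _ /=.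
  by rewrite (frame_metricE g0_herm eps_orth y_sol).
have cP u v : \sum_s P t v (e t s) * cof t s u = P t u v.
  rewrite velocityC -(frame_contract u (orth tT) (velocity_lin2 J _ br_lie (bil t) v)).
  by apply: eq_bigr => s _; rewrite (frame_metricE g0_herm eps_orth y_sol) // mulrC.
rewrite sumrB !big_split /= /C /struct !cb.
have : tors3 br J (P t) (e t i) (e t j) (e t k) = ext_d2 br b (e t i) (e t j) (e t k).
  exact: tors3_velocity.
rewrite /ext_d2 (brC br_lie (e t i) (e t k)) (linformN _ (b1 _)) => E.
have -> : b (br (e t i) (e t j)) (e t k) + b (br (e t j) (e t k)) (e t i)
    + b (br (e t k) (e t i)) (e t j) = - tors3 br J (P t) (e t i) (e t j) (e t k).
  by rewrite E; ring.
rewrite opprK /tors3 -/(brJ _ _) -/(brJ _ _) -/(brJ _ _) -!cP.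
rewrite /H' /CJ' -!big_split -!sumrN -!big_split /=; apply: eq_bigr => s _.
by rewrite /H /struct; field.
Qed.

(** By [gauge_identity] the array [Phi] is the gradient minus a gauge motion, and [gauge_trace]
    makes the latter orthogonal to the gradient. So the pairing of [Phi] with the gradient is a sum
    of squares. *)
Lemma functional_derive t : 0 <= t <= T ->
  is_derive t 1 Ffun (6 * \sum_i \sum_j G t i j ^+ 2).
Proof.
move=> tT.
pose Phi i j := - ricci_trace br J (g t) (frame eps (y t)) (br (e t i) (J (e t j))).
have CA i j k : C t i j k = - C t j i k.
  by rewrite !CE // (bracketC br_lie (herm tT)).
have S : 6 * \sum_i \sum_j G t i j ^+ 2 = \sum_i \sum_j \sum_k
    (2 * (gtors_array (C t) (H t) 1 1 1 i j k * gtors_array (C' t) (H' t) 1 1 1 i j k) -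
     6 * (gtors_array (C t) (H t) 1 1 (-1) i j k * gtors_array (C' t) (H' t) 1 1 (-1) i j k)).
  rewrite (gradient_sum (Phi := Phi) (P := fun i j => M t i j)
    (b := fun i j => ricci_potential br J (g t) (frame eps (y t)) (e t i) (e t j))) //; first last.
  - by move=> i j k; exact: H'E.
  - by move=> i j; rewrite /ricci_potential /Phi; ring.
  - by move=> i j; rewrite /velocity /Phi; ring.
  - by move=> i j k; rewrite !HE // (tors3_anti br_lie (herm tT)).
  - by move=> i j k; rewrite !HE // tors3_cyc.
  congr (_ * _).
  have GE i j : \sum_k \sum_l gtors_array (C t) (H t) (-1) 1 (-1) i k l *
      gtors_array (C t) (H t) 1 1 (-1) j k l = G t i j.
    by apply: eq_bigr => k _; apply: eq_bigr => l _; rewrite !gtors_arrayE.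
  have tr := gauge_trace br_lie J_cplx (herm tT) (orth tT) (skt tT)
    (gauge_field br J (frame eps (y t))).
  rewrite -[LHS]subr0 -[X in _ - X]tr -sumrB; apply: eq_bigr => i _.
  rewrite -sumrB; apply: eq_bigr => j _.
  by rewrite GE /Phi (gauge_identity br_lie J_cplx (herm tT) (orth tT) (skt tT)); ring.
rewrite S; apply: der_sum => i _; apply: der_sum => j _; apply: der_sum => k _.
have dp := gtors_array_derive 1 1 1 i j k tT.
have dm := gtors_array_derive 1 1 (-1) i j k tT.
apply: is_derive_eq (derB (derM dp dp) (derZ 3 (derM dm dm))) _.
by ring.
Qed.

Let U0 : R := \sum_i \sum_j \sum_k g0 (br (eps i) (eps j)) (eps k) ^+ 2.
Let f0 := functional br J g0 eps.

Hypothesis solvable : solvable_lie br.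

(** As f' = 6 |G|^2, the growth rate of the bracket has the primitive [h], which is 3 n (s + f(s) /
    6). Since f <= 0, it increases by at most 3 n (T - f0 / 6) on [0, t]. *)
Lemma bracket_bound t : 0 <= t <= T ->
  \sum_i \sum_j \sum_k g t (br (e t i) (e t j)) (e t k) ^+ 2 <=
  U0 * expR (3 * n%:R * (T - f0 / 6)).
Proof.
move=> tT; have [t0 tT'] := andP tT.
have sub s : 0 <= s <= t -> 0 <= s <= T by case/andP => -> /le_trans; apply.
have z0 : 0 <= (0 : R) <= T by apply/andP; split=> //; exact: le_trans t0 tT'.
pose u s : R := \sum_i \sum_j \sum_k C s i j k * C s i j k.
pose u' s : R := \sum_i \sum_j \sum_k (C' s i j k * C s i j k + C s i j k * C' s i j k).
pose h s : R := 3 * n%:R * (s + 6^-1 * Ffun s).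
pose h' s : R := 3 * n%:R * (1 + 6^-1 * (6 * \sum_i \sum_j G s i j ^+ 2)).
have uE s : 0 <= s <= T -> u s =
    \sum_i \sum_j \sum_k g s (br (e s i) (e s j)) (e s k) ^+ 2.
  move=> sT; apply: eq_bigr => i _; apply: eq_bigr => j _; apply: eq_bigr => k _.
  by rewrite !CE // expr2.
have gr : u t <= u 0 * expR (h t - h 0).
  have grow := @gronwall R u u' h h' t.
  apply: (grow _ _ _ t0) => {grow} s /sub sT.
  - apply: der_sum => i _; apply: der_sum => j _; apply: der_sum => k _.
    have dC := struct_derive i j k br_bil sT.
    exact: (derM dC dC).
  - exact: (derZ _ (derD (der_id s) (derZ _ (functional_derive sT)))).
  have := bracket_growth br_lie J_cplx (herm sT) (orth sT) (skt sT).
  have -> : u' s = 2 * \sum_i \sum_j \sum_k C s i j k * C' s i j k.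
    rewrite mulr_sumr; apply: eq_bigr => i _; rewrite mulr_sumr; apply: eq_bigr => j _.
    by rewrite mulr_sumr; apply: eq_bigr => k _; ring.
  rewrite uE // /h' mulrA mulVf ?mul1r //; congr (_ <= _); congr (_ * _).
  apply: eq_bigr => i _; apply: eq_bigr => j _; apply: eq_bigr => k _.
  by rewrite /C' CE //; congr (_ * _); apply: eq_bigr => p _; rewrite !CE.
rewrite -uE //; apply: le_trans gr _.
rewrite uE // start_frame start_metric ler_wpM2l //.
  by apply: sumr_ge0 => *; apply: sumr_ge0 => *; apply: sumr_ge0 => *; exact: sqr_ge0.
rewrite ler_expR /h -mulrBr ler_wpM2l ?mulr_ge0 //.
have Ft := solvable_functional_le0 br_lie (herm tT) (orth tT) solvable.
rewrite -FfunE // in Ft; have F0 : Ffun 0 = f0 by rewrite FfunE // start_frame start_metric.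
by rewrite F0; lra.
Qed.

End APriori.

(** * From the bracket to the velocity and to the frame *)

Lemma sum_bound (R : realType) (n : nat) (f : 'I_n -> R) (a : R) :
  (forall i, `|f i| <= a) -> `|\sum_i f i| <= n%:R * a.
Proof.
move=> fa; apply: le_trans (ler_norm_sum _ _ _) _.
apply: le_trans (ler_sum _ (fun i _ => fa i)) _.
by rewrite sumr_const card_ord mulr_natl.
Qed.

Section VelocityBound.
Context {R : realType} {V : vectType R} (br : V -> V -> V) (J : 'End(V)).
Context (g : V -> V -> R) (n : nat) (e : 'I_n -> V) (k : R).
Hypothesis br_lie : lie_bracket br.
Hypothesis J_cplx : complex_structure br J.
Hypothesis g_herm : hermitian_metric J g.
Hypothesis e_orth : orthonormal_frame g e.
Hypothesis k0 : 0 <= k.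
Hypothesis bracket_le : forall i j l, `|g (br (e i) (e j)) (e l)| <= k.

Let linE := (linE br_lie g_herm).
Let N : R := n%:R.
Let N0 : 0 <= N. Proof. exact: ler0n. Qed.
Let K : R := N * (N * (N * k)).
Let K0 : 0 <= K. Proof. by rewrite !mulr_ge0. Qed.

Let small a v := forall i, `|g v (e i)| <= a.

Let norm_le1 u v : g u u = 1 -> g v v = 1 -> `|g u v| <= 1.
Proof.
move=> u1 v1.
have pos w : 0 <= g w w.
  have [->|w0] := eqVneq w 0; first by rewrite (linform0 (metric_lin1 g_herm 0)).
  by apply: ltW; case: g_herm => _ _ + _; exact.
have := pos (u + v); have := pos (u - v).
rewrite !linE u1 v1 (metricC g_herm v) ler_norml => *; apply/andP; split; lra.
Qed.

Let e1 i : g (e i) (e i) = 1. Proof. by case: e_orth => -> _; rewrite eqxx. Qed.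

Let small_e i : small 1 (e i).
Proof. by move=> j; exact: norm_le1. Qed.

Let small_Je i : small 1 (J (e i)).
Proof. by move=> j; apply: norm_le1; rewrite ?(metricJJ g_herm). Qed.

Let smallJ a v : 0 <= a -> small a v -> small (N * a) (J v).
Proof.
move=> a0 va i.
have lJ : linform (fun v => g (J v) (e i)).
  by move=> b u w; rewrite linearP (metric_lin1 g_herm).
rewrite -(frame_contract v e_orth lJ); apply: sum_bound => j.
rewrite normrM -[a]mulr1 ler_pM //; exact: small_Je.
Qed.

Let small_bracket a b c u v w : 0 <= a -> 0 <= b -> 0 <= c ->
  small a u -> small b v -> small c w -> `|g (br u v) w| <= K * (a * b * c).
Proof.
move=> a0 b0 c0 ua vb wc.
have l1 v' w' : linform (fun x => g (br x v') w') by move=> r x z; rewrite !linE.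
have l2 u' w' : linform (fun x => g (br u' x) w') by move=> r x z; rewrite !linE.
rewrite -(frame_contract u e_orth (l1 v w)).
apply: (@le_trans _ _ (N * (a * (N * (b * (N * (c * k))))))); last first.
  by rewrite /K le_eqVlt; apply/orP; left; apply/eqP; ring.
apply: sum_bound => i; rewrite normrM ler_pM //.
rewrite -(frame_contract v e_orth (l2 (e i) w)).
apply: sum_bound => j; rewrite normrM ler_pM //.
rewrite -(frame_contract w e_orth (metric_lin2 g_herm _)).
by apply: sum_bound => l; rewrite normrM ler_pM.
Qed.

(** The brackets of [e p] with [J (e q)] have coordinates at most [K], and applying [J] costs a
    factor [N]. Of the six terms in [gtors] four are at most [K * K] and two at most [N * (K * K)];
    the half in [gtors] leaves [2 + N], and the trace gives the outer [N] and [2^-1]. *)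
Definition velocity_constant : R := 2^-1 * (N * ((2 + N) * (K * K))).

Let ricci_trace_bound z : small K z ->
  `|ricci_trace br J g e z| <= velocity_constant.
Proof.
move=> zK; rewrite normrM ger0_norm // ler_pM2l //; apply: sum_bound => i.
have s1 : small 1 (J (J (e i))).
  by move=> j; rewrite (JJ J_cplx) (metricNl g_herm) normrN; exact: small_e.
have sz := smallJ K0 zK.
have NK0 : 0 <= N * K by rewrite mulr_ge0.
have b1 := small_bracket ler01 ler01 K0 (small_e i) (small_Je i) zK.
have b2 := small_bracket K0 ler01 ler01 zK (small_e i) (small_Je i).
have b3 := small_bracket ler01 K0 ler01 (small_Je i) zK (small_e i).
have b4 := small_bracket ler01 ler01 K0 (small_Je i) s1 zK.
have b5 := small_bracket ler01 NK0 ler01 s1 sz (small_e i).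
have b6 := small_bracket NK0 ler01 ler01 sz (small_Je i) (small_Je i).
move: b1 b2 b3 b4 b5 b6; rewrite !ler_norml /gtors /tors3 => b1 b2 b3 b4 b5 b6.
have E : K * (N * K) = N * (K * K) by ring.
have D : (2 + N) * (K * K) = 2 * (K * K) + N * (K * K) by ring.
by rewrite D; move: b1 b2 b3 b4 b5 b6; rewrite !mul1r !mulr1 E => *; apply/andP; split; lra.
Qed.

Lemma velocity_bound i j : `|velocity br J g e (e i) (e j)| <= velocity_constant.
Proof.
have sb p q : small K (br (e p) (J (e q))).
  move=> l; have := small_bracket ler01 ler01 ler01 (small_e p) (small_Je q) (small_e l).
  by rewrite !mulr1.
have := ricci_trace_bound (sb i j); have := ricci_trace_bound (sb j i).
by rewrite /velocity !ler_norml => *; apply/andP; split; lra.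
Qed.

End VelocityBound.

(** Gronwall for the sum of the squared entries. In [2 * n%:R * mu] the [n%:R] counts how often each
    square occurs once the products are split into squares. *)
Lemma linear_growth (R : realType) (n : nat) (T mu : R)
    (Z A : R -> 'I_n -> 'I_n -> R) : 0 <= T ->
  (forall t i j, 0 <= t <= T ->
    is_derive t 1 (fun s => Z s i j) (\sum_s A t i s * Z t s j)) ->
  (forall t i j, 0 <= t <= T -> `|A t i j| <= mu) ->
  \sum_i \sum_j Z T i j ^+ 2 <=
    \sum_i \sum_j Z 0 i j ^+ 2 * expR (2 * n%:R * mu * T).
Proof.
move=> T0 dZ Amu.
pose u t : R := \sum_i \sum_j Z t i j * Z t i j.
pose u' t : R := \sum_i \sum_j ((\sum_s A t i s * Z t s j) * Z t i j +
  Z t i j * \sum_s A t i s * Z t s j).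
pose c : R := 2 * n%:R * mu.
have uE t : \sum_i \sum_j Z t i j ^+ 2 = u t.
  by apply: eq_bigr => i _; apply: eq_bigr => j _; rewrite expr2.
have grow := @gronwall R u u' (fun t => c * t) (fun=> c) T.
suff : u T <= u 0 * expR (c * T - c * 0).
  rewrite mulr0 subr0 uE -uE mulr_suml => /le_trans; apply.
  by apply: ler_sum => i _; rewrite mulr_suml.
apply: (grow _ _ _ T0) => {grow} t tT.
- apply: der_sum => i _; apply: der_sum => j _.
  exact: (derM (dZ t i j tT) (dZ t i j tT)).
- by rewrite -[X in is_derive _ _ _ X]mulr1; exact: (derZ c (der_id t)).
have -> : c * u t = \sum_i \sum_j \sum_s (mu * (Z t i j * Z t i j) + mu * (Z t s j * Z t s j)).
  have E1 : \sum_i \sum_j \sum_(s < n) mu * (Z t i j * Z t i j) = n%:R * mu * u t.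
    rewrite /u mulr_sumr; apply: eq_bigr => i _; rewrite mulr_sumr; apply: eq_bigr => j _.
    by rewrite sumr_const card_ord -mulr_natl; ring.
  have E2 : \sum_(i < n) \sum_j \sum_s mu * (Z t s j * Z t s j) = n%:R * mu * u t.
    rewrite sumr_const card_ord exchange_big -[LHS]mulr_natl -mulrA /=; congr (_ * _).
    by rewrite /u mulr_sumr; apply: eq_bigr => i _; rewrite mulr_sumr.
  transitivity (n%:R * mu * u t + n%:R * mu * u t); first by rewrite /c; ring.
  rewrite -{1}E1 -E2 -big_split; apply: eq_bigr => i _ /=.
  by rewrite -big_split; apply: eq_bigr => j _ /=; rewrite -big_split.
apply: ler_sum => i _; apply: ler_sum => j _.
rewrite mulr_suml mulr_sumr -big_split; apply: ler_sum => s _ /=.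
have mu0 : 0 <= mu by apply: le_trans (normr_ge0 _) (Amu t i s tT).
have : A t i s * (2 * (Z t s j * Z t i j)) <=
    mu * (Z t s j * Z t s j + Z t i j * Z t i j).
  apply: le_trans (ler_norm _) _; rewrite normrM ler_pM ?Amu //.
  have := sqr_ge0 (Z t s j - Z t i j); have := sqr_ge0 (Z t s j + Z t i j).
  by rewrite sqrrB sqrrD !expr2 ler_norml => *; apply/andP; split; lra.
by lra.
Qed.

Lemma is_derive_within (R : realType) (I : set R) (f : R -> R) (t l : R) :
  is_derive t 1 f l -> has_derivative_on I f t l.
Proof.
move=> [df <-]; rewrite /has_derivative_on.
have E : (fun h => h^-1 * (f (t + h) - f t)) =
    (fun h => h^-1 *: ((f \o shift t) (h *: 1) - f t)).
  by apply/funext => h; rewrite /= /GRing.scale /= mulr1 [t + h]addrC.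
rewrite E; apply: cvg_trans df; exact/cvg_app/cvg_within.
Qed.

(** * Long-time existence *)

Section LongTime.
Context {R : realType} {V : vectType R} (br : V -> V -> V) (J : 'End(V)).
Context (g0 : V -> V -> R) (n : nat) (eps : 'I_n -> V).
Hypothesis br_lie : lie_bracket br.
Hypothesis J_cplx : complex_structure br J.
Hypothesis g0_herm : hermitian_metric J g0.
Hypothesis eps_orth : orthonormal_frame g0 eps.
Hypothesis g0_SKT : SKT br J g0.
Hypothesis solvable : solvable_lie br.

Lemma frame_flow_a_priori (T : R) : 0 <= T -> exists r : R, forall y (t : R),
  0 <= t <= T -> solution_on (frame_field br J g0 eps) (@frame_start R n) t y ->
  forall i s, 0 <= s <= t -> `|y s i| <= r.
Proof.
move=> T0.
pose U : R := (\sum_i \sum_j \sum_k g0 (br (eps i) (eps j)) (eps k) ^+ 2) *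
  expR (3 * n%:R * (T - functional br J g0 eps / 6)).
have U0 : 0 <= U.
  rewrite mulr_ge0 ?expR_ge0 //.
  by apply: sumr_ge0 => *; apply: sumr_ge0 => *; apply: sumr_ge0 => *; exact: sqr_ge0.
(* A structure constant has square at most [U], hence absolute value at most [1 + U]. *)
pose mu : R := velocity_constant n (1 + U).
pose w : R := \sum_(i < n) \sum_(j < n) (i == j)%:R ^+ 2 * expR (2 * n%:R * mu * T).
have sqb (x : R) : `|x| <= 1 + x ^+ 2.
  by rewrite -(real_normK (num_real x)); have := sqr_ge0 (`|x| - 2^-1); rewrite sqrrB => h; lra.
have mu0 : 0 <= mu.
  have U1 : 0 <= 1 + U by rewrite addr_ge0.
  by rewrite /mu /velocity_constant !mulr_ge0 // addr_ge0.
exists (1 + w) => y t tT sol -[[b i] j] s /andP[s0 st].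
have sT : s <= T by case/andP: tT => _; exact: le_trans.
have solr r : 0 <= r <= s -> solution_on (frame_field br J g0 eps) (@frame_start R n) r y.
  case/andP=> r0 rs; case: sol => y0 dy; split=> // k q /andP[q0 qr].
  by apply: dy; rewrite q0 (le_trans qr) // (le_trans rs).
have vel r p q : 0 <= r <= s ->
    `|frame_velocity br J g0 eps (y r) p q| <= mu.
  move=> rs; have [r0 _] := andP rs.
  have rr : 0 <= r <= r by rewrite r0 lexx.
  have herm := frame_metric_hermitian br_lie J_cplx g0_herm eps_orth (solr r rs) rr.
  have orth := frame_orthonormal g0_herm eps_orth (solr r rs) rr.
  have bb := bracket_bound br_lie J_cplx g0_herm eps_orth g0_SKT (solr r rs) solvable rr.
  apply: (velocity_bound br_lie J_cplx herm orth); first by rewrite addr_ge0.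
  move=> i' j' l; apply: le_trans (sqb _) _; rewrite lerD2l.
  apply: le_trans (le_trans bb _).
    rewrite (bigD1 i') //= (bigD1 j') //= (bigD1 l) //= -!addrA lerDl.
    by rewrite !addr_ge0 //; do ?(apply: sumr_ge0 => * ); exact: sqr_ge0.
  rewrite ler_wpM2l //.
    by apply: sumr_ge0 => *; apply: sumr_ge0 => *; apply: sumr_ge0 => *; exact: sqr_ge0.
  rewrite ler_expR ler_wpM2l ?mulr_ge0 // lerD2r.
  by case/andP: rs => _ /le_trans; apply.
have half (x : R) : `|x| <= mu -> `|2^-1 * x| <= mu.
  by move=> xm; rewrite normrM ger0_norm //; lra.
have le_w (Z : R -> 'I_n -> 'I_n -> R) p q :
    \sum_i \sum_j Z s i j ^+ 2 <= \sum_i \sum_j Z 0 i j ^+ 2 * expR (2 * n%:R * mu * s) ->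
    (forall i j, Z 0 i j = (i == j)%:R) -> `|Z s p q| <= 1 + w.
  move=> Zs Z0; apply: le_trans (sqb _) _; rewrite lerD2l.
  apply: le_trans (le_trans Zs _).
    rewrite (bigD1 p) //= (bigD1 q) //= -!addrA lerDl.
    by rewrite !addr_ge0 //; do ?(apply: sumr_ge0 => * ); exact: sqr_ge0.
  apply: ler_sum => p' _; apply: ler_sum => q' _; rewrite Z0 ler_wpM2l ?sqr_ge0 //.
  by rewrite ler_expR; apply: ler_wpM2l sT; rewrite mulr_ge0 // mulr_ge0.
have [y0 dy] := sol.
have ssub r : 0 <= r <= s -> 0 <= r <= t by case/andP=> -> /le_trans; apply.
case: b.
  apply: (le_w (fun s i j => y s (true, i, j))) => [|p q]; last by rewrite y0.
  apply: (@linear_growth R n s mu (fun s i j => y s (true, i, j))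
      (fun r p q => - 2^-1 * frame_velocity br J g0 eps (y r) p q) s0) => r p q rs.
    have d := dy (true, p, q) r (ssub r rs).
    by apply: is_derive_eq d _; apply: eq_bigr => l _; rewrite mulrA.
  by rewrite mulNr normrN; apply: half; exact: vel.
(* The inverse matrix satisfies D' = 1/2 D P, so its transpose is taken to reach the form Z' = A
   Z. *)
apply: (le_w (fun s i j => y s (false, j, i)) j i) => [|p q]; last by rewrite y0 eq_sym.
apply: (@linear_growth R n s mu (fun s i j => y s (false, j, i))
    (fun r p q => 2^-1 * frame_velocity br J g0 eps (y r) q p) s0) => r p q rs.
  have d := dy (false, q, p) r (ssub r rs).
  by apply: is_derive_eq d _; apply: eq_bigr => l _; rewrite mulrA mulrAC.
by apply: half; exact: vel.
Qed.

Lemma pluriclosed_flow_long_time : exists g : R -> V -> V -> R,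
  (forall x y, g 0 x y = g0 x y) /\ pluriclosed_flow_on br `[0, +oo[ J g.
Proof.
have [y [y0 dy]] := global_solution
  (frame_field_loc_lipschitz br_lie g0_herm eps_orth) frame_flow_a_priori.
have sol t : solution_on (frame_field br J g0 eps) (@frame_start R n) t y.
  by split=> // i s /andP[s0 _]; exact: dy.
exists (fun t => frame_metric g0 eps (y t)); split=> [u v|t].
  have -> : y 0 = @frame_start R n by apply/funext => k; exact: y0.
  exact: (frame_start_metric g0_herm eps_orth).
rewrite /= in_itv /= andbT => t0.
have tt : 0 <= t <= t by rewrite t0 lexx.
have herm := frame_metric_hermitian br_lie J_cplx g0_herm eps_orth (sol t) tt.
have orth := frame_orthonormal g0_herm eps_orth (sol t) tt.
have skt := frame_metric_SKT br_lie J_cplx g0_herm eps_orth g0_SKT (sol t) tt.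
split=> //.
exists (velocity br J (frame_metric g0 eps (y t)) (frame eps (y t))).
exists (chern_op br J (frame_metric g0 eps (y t)) (frame eps (y t))); split.
- move=> u v.
  exact: is_derive_within (frame_metric_derive br_lie g0_herm eps_orth (sol t) u v tt).
- exact: chern_op_chern.
- move=> m f ff; exact: velocity_comp.
Qed.

End LongTime.

Theorem corollary2 (R : realType) (n : nat) (G : lie_group R n)
    (Lie : lie_algebra_of G) (Gamma : set G)
    (J : 'End(Lie)) (g0 : Lie -> Lie -> R)
    (G_solvable : solvable_lie (@la_bracket R n G Lie))
    (Gamma_discrete : discrete_subgroup Gamma)
    (J_complex : complex_structure (@la_bracket R n G Lie) J)
    (g0_hermitian : hermitian_metric J g0)
    (g0_SKT : SKT (@la_bracket R n G Lie) J g0) :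
  exists g : R -> Lie -> Lie -> R,
    (forall x y, g 0 x y = g0 x y) /\
    pluriclosed_flow_on (@la_bracket R n G Lie) `[0, +oo[ J g.
Proof.
have bl := lie_algebra_bracket Lie.
have [m [eps eps_orth]] := ex_orthonormal_frame g0_hermitian.
exact: (pluriclosed_flow_long_time bl J_complex g0_hermitian eps_orth g0_SKT G_solvable).
Qed.
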